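(* Let $\Omega=B(0,R)\subset\mathbb R^3$ and let $B_0$ be the vector field given, in spherical coordinates $(r,\theta,\phi)$ ($r=|x|$, $\theta$ azimuthal angle, $\phi$ polar angle measured from the positive $z$-axis, with unit vectors $\hat r,\hat\theta,\hat\phi$), by $$B_0=C(R)\hat z-\frac{3R}{r^2\sinh R}\Big(\cosh r-\frac{\sinh r}{r}\Big)\cos\phi\,\hat r+\frac{3R}{2r^2\sinh R}\Big(\frac{1+r^2}{r}\sinh r-\cosh r\Big)\sin\phi\,\hat\phi,$$ $$C(R)=\frac{3}{2R\sinh R}\Big(\frac{1+R^2}{R}\sinh R-\cosh R\Big)$$ (this is the field $B_0$ associated with the Meissner state for the applied field $H_{0,\mathrm{ex}}=\hat z$). Let $\Gamma_0$ be the vertical diameter $\{(0,0,z):|z|\le R\}$ seen as a $1$-current with multiplicity $1$, oriented in the direction of the positive $z$-axis. Then $\Gamma_0$ is the unique element of $X$ with $\mathcal R(\Gamma_0)=\sup_{\Gamma\in\mathcal N}\mathcal R(\Gamma)$, and there exists $C_0>0$ depending only on $R$ such that $$\mathcal R(\Gamma_0)-\mathcal R(\Gamma)\ge C_0\min\big(\|\Gamma-\Gamma_0\|_*^2,1\big)\quad\text{for every }\Gamma\in X.$$ That is, the Nondegeneracy Condition holds with exponent $N=2$.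
   Context: $\mathcal N$ is the space of normal $1$-currents supported in $\overline\Omega$ with boundary supported on $\partial\Omega$; $|\Gamma|$ is the mass; $\langle B,\Gamma\rangle$ the action of $\Gamma$ on the vector field $B$ viewed as a $1$-form; $\mathcal R(\Gamma)=\langle B_0,\Gamma\rangle/|\Gamma|$. $X$ is the class of elements of $\mathcal N$ which are simple oriented Lipschitz curves (loops in $\overline\Omega$ or curves with both endpoints on $\partial\Omega$). $C^{0,1}_T(\Omega,\mathbb R^3)$ is the space of Lipschitz vector fields $B$ with $B\times\vec\nu=0$ on $\partial\Omega$, and $\|\Gamma\|_*=\sup\{\langle B,\Gamma\rangle:\|B\|_{C^{0,1}_T(\Omega,\mathbb R^3)}\le1\}$. *)

(* Defs.v *)
From HB Require Import structures.
From mathcomp Require Import all_boot all_order all_algebra.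
From mathcomp Require Import all_classical all_reals all_analysis.
Set Implicit Arguments. Unset Strict Implicit. Unset Printing Implicit Defensive.
Import Order.TTheory GRing.Theory Num.Theory.
Import numFieldNormedType.Exports.
Local Open Scope classical_set_scope.
Local Open Scope ring_scope.

Section Defs.
Variable R : realType.

Definition pt := 'rV[R]_3.
Definition field := pt -> pt.
(* a 1-current, seen through its action on (continuous) vector fields *)
Definition current := field -> R.

Definition comp (u : pt) (k : nat) : R := u ord0 (inord k).
Definition vec3 (a b c : R) : pt := \row_(i < 3) nth 0 [:: a; b; c] i.

Definition dot (u v : pt) : R := \sum_(i < 3) u ord0 i * v ord0 i.
Definition enorm (u : pt) : R := Num.sqrt (dot u u).
Definition cross (u v : pt) : pt :=
  vec3 (comp u 1 * comp v 2 - comp u 2 * comp v 1)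
       (comp u 2 * comp v 0 - comp u 0 * comp v 2)
       (comp u 0 * comp v 1 - comp u 1 * comp v 0).

Definition cball (Rad : R) : set pt := [set x | enorm x <= Rad].
Definition sphere (Rad : R) : set pt := [set x | enorm x = Rad].

Definition contw (Rad : R) (B : field) : Prop := {within cball Rad, continuous B}.

Definition sinh (x : R) : R := (expR x - expR (- x)) / 2.
Definition cosh (x : R) : R := (expR x + expR (- x)) / 2.

(* The field B_0 of the statement, written in Cartesian coordinates:
   cos(phi) rhat = x3 x / r^2,
   sin(phi) phihat = (x3 x1, x3 x2, -(x1^2+x2^2)) / r^2,
   and extended by continuity at the origin. *)
Definition CR (Rad : R) : R :=
  3 / (2 * Rad * sinh Rad) * ((1 + Rad ^+ 2) / Rad * sinh Rad - cosh Rad).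
Definition fB0 (Rad r : R) : R :=
  3 * Rad / (r ^+ 2 * sinh Rad) * (cosh r - sinh r / r).
Definition gB0 (Rad r : R) : R :=
  3 * Rad / (2 * r ^+ 2 * sinh Rad) * ((1 + r ^+ 2) / r * sinh r - cosh r).
Definition B0 (Rad : R) : field := fun x =>
  let r := enorm x in
  let x1 := comp x 0 in let x2 := comp x 1 in let x3 := comp x 2 in
  if r == 0 then vec3 0 0 (CR Rad - Rad / sinh Rad)
  else vec3 0 0 (CR Rad)
       - (fB0 Rad r * x3 / r ^+ 2) *: x
       + (gB0 Rad r / r ^+ 2) *: vec3 (x3 * x1) (x3 * x2) (- (x1 ^+ 2 + x2 ^+ 2)).

(* A 1-current of finite mass supported in the compact set \bar Omega is the
   same thing as a continuous linear functional on continuous vector fields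
   on \bar Omega (Riesz); we use this representation.  Values of T on fields
   that are not continuous on \bar Omega are irrelevant. *)
Definition finite_mass_current (Rad : R) (T : current) : Prop :=
  (forall (a : R) (B1 B2 : field), contw Rad B1 -> contw Rad B2 ->
     T (fun x => a *: B1 x + B2 x) = a * T B1 + T B2) /\
  (exists M : R, forall B : field, contw Rad B ->
     (forall x, cball Rad x -> enorm (B x) <= 1) -> `|T B| <= M).

Definition mass (Rad : R) (T : current) : R :=
  sup [set T B | B in [set B : field | contw Rad B /\
                         forall x, cball Rad x -> enorm (B x) <= 1]].

Definition partial (k : 'I_3) (f : pt -> R) : pt -> R :=
  fun x => 'D_(delta_mx ord0 k : pt) f x.
Definition iterD (ks : seq 'I_3) (f : pt -> R) : pt -> R :=
  foldr partial f ks.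
Definition smooth (f : pt -> R) : Prop :=
  forall ks : seq 'I_3, continuous (iterD ks f) /\
    forall (k : 'I_3) (x : pt), derivable (iterD ks f) x (delta_mx ord0 k : pt).
Definition compact_support (f : pt -> R) : Prop :=
  compact (closure [set x | f x != 0]).
Definition grad (f : pt -> R) : field := fun x => \row_(k < 3) partial k f x.

Definition boundary_finite_mass (T : current) : Prop :=
  exists C : R, forall f : pt -> R, smooth f -> compact_support f ->
    (forall x, `|f x| <= 1) -> `|T (grad f)| <= C.

Definition boundary_on_sphere (Rad : R) (T : current) : Prop :=
  forall f : pt -> R, smooth f -> compact_support f ->
    closure [set x | f x != 0] `&` sphere Rad = set0 -> T (grad f) = 0.

Definition normal_currents (Rad : R) : set current :=
  [set T | finite_mass_current Rad T /\ boundary_finite_mass T /\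
           boundary_on_sphere Rad T].

Definition Rratio (Rad : R) (T : current) : R := T (B0 Rad) / mass Rad T.

Definition lipschitz01 (g : R -> pt) : Prop :=
  exists L : R, forall s t, s \in `[0, 1] -> t \in `[0, 1] ->
    enorm (g s - g t) <= L * `|s - t|.

Definition curve_current (g : R -> pt) : current := fun B =>
  \int[lebesgue_measure]_(t in `[0, 1]) dot (B (g t)) ('D_1 g t).

Definition simple_loop (Rad : R) (g : R -> pt) : Prop :=
  lipschitz01 g /\ (forall t, t \in `[0, 1] -> cball Rad (g t)) /\
  g 0 = g 1 /\
  (forall s t, s \in `[0, 1[ -> t \in `[0, 1[ -> g s = g t -> s = t).

Definition simple_arc (Rad : R) (g : R -> pt) : Prop :=
  lipschitz01 g /\ (forall t, t \in `[0, 1] -> cball Rad (g t)) /\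
  sphere Rad (g 0) /\ sphere Rad (g 1) /\
  (forall s t, s \in `[0, 1] -> t \in `[0, 1] -> g s = g t -> s = t).

Definition curves (Rad : R) : set current :=
  [set T | exists g : R -> pt, (simple_loop Rad g \/ simple_arc Rad g) /\
                               T = curve_current g].

Definition Gamma0 (Rad : R) : current :=
  curve_current (fun t => vec3 0 0 (Rad * (2 * t - 1))).

Definition lipT (Rad : R) : set field :=
  [set B | (exists L : R, forall x y, cball Rad x -> cball Rad y ->
              enorm (B x - B y) <= L * enorm (x - y)) /\
           (forall x, sphere Rad x -> cross (B x) ((enorm x)^-1 *: x) = 0)].

Definition c01norm (Rad : R) (B : field) : R :=
  sup [set enorm (B x) | x in cball Rad] +
  sup [set enorm (B xy.1 - B xy.2) / enorm (xy.1 - xy.2) |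
         xy in [set xy : pt * pt | cball Rad xy.1 /\ cball Rad xy.2 /\
                                   xy.1 != xy.2]].

Definition dualnorm (Rad : R) (T : current) : R :=
  sup [set T B | B in [set B | lipT Rad B /\ c01norm Rad B <= 1]].

Definition cur_sub (T S : current) : current := fun B => T B - S B.

End Defs.

(* Main.v *)
From HB Require Import structures.
From mathcomp Require Import all_boot all_order all_algebra.
From mathcomp Require Import all_classical all_reals all_analysis.
From mathcomp Require Import measurable_realfun ring lra zify.
Require Import Defs.
Set Implicit Arguments. Unset Strict Implicit. Unset Printing Implicit Defensive.
Import Order.TTheory GRing.Theory Num.Theory.
Import numFieldNormedType.Exports.
Local Open Scope classical_set_scope.
Local Open Scope ring_scope.

(* Write r = |x|, rho for the distance to the vertical axis and M = R(Gamma_0).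
   The field splits as B_0 = om + grad (z P(r^2)), where P(R^2) = 0 and
   om = M zhat - U(r^2) (r^2 zhat - z x) for an entire function U with positive Taylor
   coefficients such that R^2 U(R^2) = M.  Therefore |om|^2 <= M^2 - c rho^2 on the ball
   while om = M zhat on the axis.  Currents of N do not see the gradient term, so
   <B_0, Gamma> = <om, Gamma> <= M |Gamma|, with equality for the diameter.

   For the stability, let eps = M - R(Gamma).  If |eta| <= K rho, or if eta is horizontal,
   then |om + s eta| <= M + C s^2, and pairing Gamma with om + s eta gives
   |<eta, Gamma>| <= |Gamma| (eps / s + C s).  For the gradients of z, rho^2 and rho^2 z
   this excludes loops, bounds |Gamma| and puts the endpoints of Gamma at distance
   O(eps / s + s) from the poles.  For B(x) - B(0, 0, z) and for the horizontal part of
   B(0, 0, z) it reduces <B, Gamma> to the integral of B_z along the axis.  The choice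
   s = sqrt eps yields the exponent 2, and eps = 0, s -> 0 yields uniqueness.  The mass of
   Gamma is never compared with the length of a parametrization. *)


(** * Euclidean geometry of [pt] *)

(** The function [U] is forced: asking that [B_0 - om] be the gradient of [z P(r^2)] leaves a linear
    ODE for [U], solved coefficient by coefficient, and [P(R^2) = 0] then fixes [M]. The gain in
    [|om|] comes from monotonicity: [w = r^2 zhat - z x] satisfies [w . zhat = rho^2] and
    [|w| = r rho], so [|om|^2 = M^2 - U rho^2 (2 M - r^2 U)], where positive coefficients keep
    [s U(s)] below its value [M] on the sphere. This gain absorbs a perturbation linear in [rho],
    while a horizontal one has no first-order pairing with [M zhat]; hence the two classes of test
    fields. The vanishing on gradients is obtained in two ways. The boundary condition in N only
    kills gradients of functions vanishing near the sphere, whereas [z P(r^2)] vanishes just on it,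
    which calls for cutoffs and the bound on the boundary mass. For curves it comes from the
    fundamental theorem of calculus for Lipschitz functions, so that estimates in X go through
    parametrizations; only the diameter is shown to lie in N. *)

Section Geometry.
Context {R : realType}.
Implicit Types (u v w : pt R) (a b c : R).

Lemma comp_ord u (i : 'I_3) : u ord0 i = comp u i.
Proof. by rewrite /comp inord_val. Qed.

Lemma comp_vec3 a b c :
  (comp (vec3 a b c) 0 = a) * (comp (vec3 a b c) 1 = b) * (comp (vec3 a b c) 2 = c).
Proof. by rewrite /comp !mxE /= !inordK. Qed.

Lemma compD u v k : comp (u + v) k = comp u k + comp v k.
Proof. by rewrite /comp mxE. Qed.
Lemma compN u k : comp (- u) k = - comp u k.
Proof. by rewrite /comp mxE. Qed.
Lemma compB u v k : comp (u - v) k = comp u k - comp v k.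
Proof. by rewrite compD compN. Qed.
Lemma compZ a u k : comp (a *: u) k = a * comp u k.
Proof. by rewrite /comp mxE. Qed.
Lemma comp0 k : comp (0 : pt R) k = 0.
Proof. by rewrite /comp mxE. Qed.
Definition compL := (compD, compN, compZ, comp0).

Lemma pt_eqP u v : comp u 0 = comp v 0 -> comp u 1 = comp v 1 ->
  comp u 2 = comp v 2 -> u = v.
Proof.
move=> h0 h1 h2; apply/rowP => i; rewrite !comp_ord.
by case: i => -[|[|[|//]]] ? /=.
Qed.

Lemma dotE u v : dot u v = comp u 0 * comp v 0 + comp u 1 * comp v 1
  + comp u 2 * comp v 2.
Proof.
by rewrite /dot !big_ord_recl big_ord0 addr0 !comp_ord /= addrA.
Qed.

Definition pi3 u : pt R := vec3 0 0 (comp u 2).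
Definition rho2 u : R := comp u 0 ^+ 2 + comp u 1 ^+ 2.
Definition rho u : R := Num.sqrt (rho2 u).
Definition zhat : pt R := vec3 0 0 1.

Lemma rho2_ge0 u : 0 <= rho2 u.
Proof. by rewrite addr_ge0 ?sqr_ge0. Qed.
Lemma rho_ge0 u : 0 <= rho u.
Proof. exact: sqrtr_ge0. Qed.
Lemma sqr_rho u : rho u ^+ 2 = rho2 u.
Proof. by rewrite sqr_sqrtr ?rho2_ge0. Qed.

Lemma dot_ge0 u : 0 <= dot u u.
Proof. by rewrite dotE -!expr2 !addr_ge0 ?sqr_ge0. Qed.
Lemma enorm_ge0 u : 0 <= enorm u.
Proof. exact: sqrtr_ge0. Qed.
Lemma sqr_enorm u : enorm u ^+ 2 = dot u u.
Proof. by rewrite sqr_sqrtr ?dot_ge0. Qed.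
Lemma sqr_enormE u : enorm u ^+ 2 = comp u 0 ^+ 2 + comp u 1 ^+ 2 + comp u 2 ^+ 2.
Proof. by rewrite sqr_enorm dotE -!expr2. Qed.

Lemma ler_sqr_ge0 a b : 0 <= b -> a ^+ 2 <= b ^+ 2 -> a <= b.
Proof.
move=> b0; have [a0|/ltW a0 _] := leP 0 a; last exact: (le_trans a0).
by rewrite ler_sqr.
Qed.

Lemma ler_norm_sqr a b : 0 <= b -> a ^+ 2 <= b ^+ 2 -> `|a| <= b.
Proof. by move=> b0 ab; apply: ler_sqr_ge0 => //; rewrite real_normK ?num_real. Qed.

Lemma comp_le_enorm u (i : nat) : (i < 3)%N -> `|comp u i| <= enorm u.
Proof.
move=> i3; apply: ler_norm_sqr; first exact: enorm_ge0.
rewrite sqr_enormE; move: i i3 => [|[|[|//]]] _; have := sqr_ge0 (comp u 0);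
  have := sqr_ge0 (comp u 1); have := sqr_ge0 (comp u 2); lra.
Qed.

Lemma rho_le_enorm u : rho u <= enorm u.
Proof.
apply: ler_sqr_ge0; first exact: enorm_ge0.
by rewrite sqr_rho sqr_enormE /rho2 lerDl sqr_ge0.
Qed.

Lemma cauchy_schwarz u v : dot u v <= enorm u * enorm v.
Proof.
apply: ler_sqr_ge0; first by rewrite mulr_ge0 ?enorm_ge0.
rewrite exprMn !sqr_enorm !dotE.
have := sqr_ge0 (comp u 0 * comp v 1 - comp u 1 * comp v 0).
have := sqr_ge0 (comp u 0 * comp v 2 - comp u 2 * comp v 0).
have := sqr_ge0 (comp u 1 * comp v 2 - comp u 2 * comp v 1).
rewrite !expr2; lra.
Qed.

Lemma dotC u v : dot u v = dot v u.
Proof. by rewrite !dotE; ring. Qed.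
Lemma dotZl a u w : dot (a *: u) w = a * dot u w.
Proof. by rewrite !dotE !compL; ring. Qed.

Lemma enormD u v : enorm (u + v) <= enorm u + enorm v.
Proof.
apply: ler_sqr_ge0; first by rewrite addr_ge0 ?enorm_ge0.
rewrite sqrrD !sqr_enorm (_ : dot (u + v) (u + v) = dot u u + dot u v *+ 2 + dot v v).
  by rewrite lerD2r lerD2l lerMn2r /= cauchy_schwarz.
by rewrite !dotE !compL; ring.
Qed.

Lemma enormZ a u : enorm (a *: u) = `|a| * enorm u.
Proof.
rewrite /enorm dotZl dotC dotZl mulrA -expr2 sqrtrM ?sqr_ge0//.
by rewrite sqrtr_sqr.
Qed.

Lemma enormN u : enorm (- u) = enorm u.
Proof. by rewrite -scaleN1r enormZ normrN1 mul1r. Qed.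

Lemma enorm0 : enorm (0 : pt R) = 0.
Proof. by rewrite /enorm dotE !compL !mulr0 !addr0 sqrtr0. Qed.

Lemma enorm0_eq0 u : enorm u = 0 -> u = 0.
Proof.
move=> u0; apply: pt_eqP; rewrite comp0; apply/eqP; rewrite -normr_le0 -u0;
  exact: comp_le_enorm.
Qed.

Lemma pi3_sub u : enorm (u - pi3 u) = rho u.
Proof. by rewrite /enorm /rho dotE !compL !comp_vec3; congr Num.sqrt; rewrite /rho2; ring. Qed.

Lemma enorm_pi3 u : enorm (pi3 u) = `|comp u 2|.
Proof. by rewrite /enorm dotE !comp_vec3 -sqrtr_sqr; congr Num.sqrt; ring. Qed.

Lemma enorm_zhat : enorm zhat = 1.
Proof. by rewrite /enorm dotE !comp_vec3 !mulr0 !add0r mulr1 sqrtr1. Qed.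

Lemma pi3_cball Rad u : cball Rad u -> cball Rad (pi3 u).
Proof. by rewrite /cball /= enorm_pi3; apply: le_trans; exact: comp_le_enorm. Qed.

End Geometry.

(** * Continuity relative to a subset, for scalar functions and for vector fields *)

Section Within.
Context {R : realType}.

(** The topology of [pt] comes from the sup norm of matrices and not from [enorm], so convergence is
    checked one coordinate at a time. *)
Lemma cvg_pt {T : Type} (F : set_system T) {FF : Filter F} (f : T -> pt R) (l : pt R) :
  (forall k, (k < 3)%N -> comp (f x) k @[x --> F] --> comp l k) -> f @ F --> l.
Proof.
move=> H; apply/cvgrPdist_le => /= e e0; near=> x.
rewrite /Num.Def.normr/= mx_normrE (bigmax_le _ (ltW e0))//= => -[i j] _.
rewrite !mxE/= !ord1 {i}.
move: j; near: x; apply: filter_forall => /= j.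
have /cvgrPdist_le /(_ _ e0) := H j (ltn_ord j).
by apply: filterS => x; rewrite -!comp_ord.
Unshelve. all: by end_near. Qed.

Lemma comp_continuous k : continuous (fun u : pt R => comp u k).
Proof. exact: coord_continuous. Qed.

Section Topo.
Variables (T : topologicalType) (A : set T).
Implicit Types f g : T -> R.

Lemma withinM f g : {within A, continuous f} -> {within A, continuous g} ->
  {within A, continuous (fun x => f x * g x)}.
Proof. by move=> cf cg x; apply: cvgM; [exact: cf|exact: cg]. Qed.
Lemma withinD f g : {within A, continuous f} -> {within A, continuous g} ->
  {within A, continuous (fun x => f x + g x)}.
Proof. by move=> cf cg x; apply: cvgD; [exact: cf|exact: cg]. Qed.
Lemma withinB f g : {within A, continuous f} -> {within A, continuous g} ->
  {within A, continuous (fun x => f x - g x)}.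
Proof. by move=> cf cg x; apply: cvgB; [exact: cf|exact: cg]. Qed.
Lemma within_cst (c : R) : {within A, continuous (fun=> c)}.
Proof. by move=> x; exact: cvg_cst. Qed.
Lemma withinX f n : {within A, continuous f} -> {within A, continuous (fun x => f x ^+ n)}.
Proof.
elim: n => [|n IH] cf; first exact: within_cst.
by under eq_fun do rewrite exprS; apply: withinM => //; exact: IH.
Qed.

Lemma within_comp1 (phi : R -> R) f : continuous phi ->
  {within A, continuous f} -> {within A, continuous (phi \o f)}.
Proof. by move=> cp cf x; exact: (@continuous_comp (subspace A) _ _ f phi x (cf x) (cp _)). Qed.

Lemma within_vec (B : T -> pt R) :
  (forall k, (k < 3)%N -> {within A, continuous (fun x => comp (B x) k)}) ->
  {within A, continuous B}.
Proof. by move=> H x; apply: cvg_pt => k k3; exact: H. Qed.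

Lemma within_compo (B : T -> pt R) k :
  {within A, continuous B} -> {within A, continuous (fun x => comp (B x) k)}.
Proof.
by move=> cB x; exact: (@continuous_comp (subspace A) _ _ B _ x (cB x) (@comp_continuous k _)).
Qed.

(** The outer function is continuous only relative to [C], so [g] has to carry the trace of
    neighborhoods on [A] into the trace on [C]. *)
Lemma within_comp2 (U V : topologicalType) (C : set U) (g : T -> U) (f : U -> V) :
  {within A, continuous g} -> (forall t, A t -> C (g t)) ->
  {within C, continuous f} -> {within A, continuous (f \o g)}.
Proof.
move=> /subspace_continuousP cg AC /subspace_continuousP cf.
apply/subspace_continuousP => t At.
have h : g @ within A (nbhs t) --> within C (nbhs (g t)).
  move=> P /= wP; have := cg t At _ wP; rewrite /= /nbhs /= /within /=.
  move=> H; near=> s => As; have : A s -> g s \in C -> P (g s).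
    by move=> As'; rewrite inE => Cg; move: As' Cg; near: s.
  by apply => //; rewrite inE; exact: AC.
exact: cvg_trans (cvg_comp _ _ h (cf _ (AC _ At))) _.
Unshelve. all: by end_near. Qed.

End Topo.

Lemma contwP (Rad : R) (B : field R) :
  (forall k, (k < 3)%N -> {within cball Rad, continuous (fun x => comp (B x) k)}) ->
  contw Rad B.
Proof. exact: within_vec. Qed.

Lemma contw_comp Rad (B : field R) k : contw Rad B ->
  {within cball Rad, continuous (fun x => comp (B x) k)}.
Proof. exact: within_compo. Qed.

Lemma within_coord (A : set (pt R)) k : {within A, continuous (fun x : pt R => comp x k)}.
Proof. by apply: continuous_subspaceT; exact: comp_continuous. Qed.

Lemma contwD Rad (B1 B2 : field R) : contw Rad B1 -> contw Rad B2 ->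
  contw Rad (fun x => B1 x + B2 x).
Proof.
move=> c1 c2; apply: contwP => k _; under eq_fun do rewrite compD.
by apply: withinD; exact: contw_comp.
Qed.

Lemma contwZ Rad (f : pt R -> R) (B : field R) : {within cball Rad, continuous f} ->
  contw Rad B -> contw Rad (fun x => f x *: B x).
Proof.
move=> c1 c2; apply: contwP => k _; under eq_fun do rewrite compZ.
by apply: withinM => //; exact: contw_comp.
Qed.

Lemma contw_cst Rad (u : pt R) : contw Rad (fun=> u).
Proof. by move=> x; exact: cvg_cst. Qed.

Lemma contwN Rad (B : field R) : contw Rad B -> contw Rad (fun x => - B x).
Proof.
move=> cB; under eq_fun do rewrite -scaleN1r.
by apply: contwZ => //; exact: within_cst.
Qed.

Lemma contw_pi3 Rad (B : field R) : contw Rad B -> contw Rad (B \o @pi3 R).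
Proof.
move=> cB; apply: (within_comp2 (C := cball Rad)) => //; last exact: pi3_cball.
apply: contwP => k k3; case: k k3 => [|[|[|//]]] _;
  under eq_fun do rewrite comp_vec3; [exact: within_cst|exact: within_cst|exact: within_coord].
Qed.

Lemma contw_vec3 Rad (f g h : pt R -> R) : {within cball Rad, continuous f} ->
  {within cball Rad, continuous g} -> {within cball Rad, continuous h} ->
  contw Rad (fun x => vec3 (f x) (g x) (h x)).
Proof.
move=> cf cg ch; apply: contwP => -[|[|[|//]]] _;
  by under eq_fun do rewrite comp_vec3.
Qed.

Lemma contw_id Rad : contw Rad (@id (pt R)).
Proof. by apply: contwP => k _; exact: within_coord. Qed.

End Within.

(** * Fundamental theorem of calculus for Lipschitz functions *)

Section LipschitzFTC.
Context {R : realType}.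
Notation mu := (@lebesgue_measure R).

Lemma lebesgue_stieltjes_ocitv (K : cumulative R R) (a b : R) : a <= b ->
  lebesgue_stieltjes_measure K `]a, b]%classic = (K b - K a)%:E.
Proof.
move=> ab; rewrite /lebesgue_stieltjes_measure /measure_extension/=.
by rewrite measurable_mu_extE/= ?wlength_itv_bnd//; exact: is_ocitv.
Qed.

Lemma short_map_continuous (f : R -> R) :
  (forall s t, s <= t -> 0 <= f t - f s <= t - s) -> continuous f.
Proof.
move=> hf x; apply/cvgrPdist_lt => e e0; near=> y.
have : `|x - y| < e by near: y; apply: cvgr_dist_lt => //; exact: cvg_id.
apply: le_lt_trans; have [xy|yx] := leP x y.
  have /andP[h1 h2] := hf _ _ xy.
  by rewrite -normrN opprB ger0_norm// -(normrN (x - y)) opprB ger0_norm ?subr_ge0.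
have /andP[h1 h2] := hf _ _ (ltW yx).
by rewrite ger0_norm// ger0_norm ?subr_ge0// ltW.
Unshelve. all: by end_near. Qed.

(* Both [k] and [t - k t] are nondecreasing, and their Stieltjes measures add up to
   Lebesgue measure: the first one is therefore absolutely continuous. *)
Lemma short_map_density (k : R -> R) :
  (forall s t, s <= t -> 0 <= k t - k s <= t - s) ->
  exists2 w : R -> R, mu.-integrable setT (EFin \o w) &
    forall x, 0 <= x <= 1 -> k x - k 0 = \int[mu]_(t in `]0, x]) w t.
Proof.
move=> hk.
pose k2 := fun t => t - k t.
have hk2 s t : s <= t -> 0 <= k2 t - k2 s <= t - s.
  by move=> /hk /andP[h1 h2]; rewrite /k2; apply/andP; split; lra.
have nd (f : R -> R) : (forall s t, s <= t -> 0 <= f t - f s <= t - s) -> nondecreasing f.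
  by move=> hf s t /hf /andP[]; rewrite subr_ge0.
pose K : cumulative R R := HB.pack k
  (isCumulative.Build R _ R k (nd _ hk) (right_continuousW (short_map_continuous hk))).
pose K2 : cumulative R R := HB.pack k2
  (isCumulative.Build R _ R k2 (nd _ hk2) (right_continuousW (short_map_continuous hk2))).
pose m1 : {measure set (measurableTypeR R) -> \bar R} := lebesgue_stieltjes_measure K.
pose m2 : {measure set (measurableTypeR R) -> \bar R} := lebesgue_stieltjes_measure K2.
have mE A : measurable A -> mu A = (m1 A + m2 A)%E.
  pose m12 : {measure set (measurableTypeR R) -> \bar R} := measure_add m1 m2.
  have m12E X : m12 X = (m1 X + m2 X)%E by exact: measure_addE.
  move=> mA; rewrite -m12E.
  apply: lebesgue_measure_unique => // X [[a b] _ <-].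
  rewrite [RHS]m12E /=.
  have [ba|ab] := leP b a.
    rewrite set_itv_ge ?bnd_simp ?measure0 ?adde0// -leNgt//.
  rewrite lebesgue_measure_itv/= lte_fin ab /m1 /m2 /= !lebesgue_stieltjes_ocitv ?ltW//.
  rewrite -!EFinD; congr EFin; rewrite /= /k2; ring.
(* Cutting [m1] down to []0, 1]] makes it a finite measure, whose density is then integrable on the
   whole line. *)
have mI : measurable (`]0, 1]%classic : set (measurableTypeR R)) by [].
have fI : (m1 (`]0%R, 1%R]%classic) < +oo)%E.
  by rewrite /m1 /= lebesgue_stieltjes_ocitv// ltry.
pose nu : {finite_measure set (measurableTypeR R) -> \bar R} := mfrestr mI fI.
have numu : nu `<< mu.
  apply/null_content_dominatesP => A mA A0.
  have mAI : measurable (A `&` `]0, 1]%classic) by apply: measurableI.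
  have : mu (A `&` `]0, 1]) = 0%E by apply: (subset_measure0 _ _ _ A0).
  rewrite mE// => /eqP; rewrite padde_eq0// => /andP[/eqP + _].
  by rewrite /nu /= /mfrestr /mrestr /=.
have [f [f0 ffin fint fE]] := radon_nikodym_sigma_finite numu.
exists (fine \o f).
  apply: eq_integrable fint => //= x _ /=; by rewrite fineK.
move=> x /andP[x0 x1].
have : nu `]0, x]%classic = (k x - k 0)%:E.
  rewrite /nu /= /mfrestr /mrestr setIidl; last first.
    by apply: subset_itvl; rewrite bnd_simp.
  by rewrite lebesgue_stieltjes_ocitv.
rewrite fE// => E; rewrite /Rintegral.
under eq_integral do rewrite /= fineK//.
by rewrite E.
Qed.

(** Extends a function on the unit interval by constants to the whole line, where the Stieltjes
    measures live. *)
Definition clamp01 (t : R) : R := Num.max 0 (Num.min 1 t).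

Lemma clamp01_in t : 0 <= clamp01 t <= 1.
Proof.
by rewrite /clamp01 le_max lexx /= ge_max ler01 ge_min lexx.
Qed.

Lemma clamp01_id t : 0 <= t <= 1 -> clamp01 t = t.
Proof.
by move=> /andP[h1 h2]; rewrite /clamp01 (min_idPr h2) (max_idPr h1).
Qed.

Lemma clamp01_short s t : s <= t -> 0 <= clamp01 t - clamp01 s <= t - s.
Proof.
by move=> st; rewrite /clamp01; case: (leP 1 t); case: (leP 1 s) => ? ?;
  case: (leP (0 : R) 1); case: (leP 0 t); case: (leP 0 s) => ? ? ?; apply/andP; split; lra.
Qed.

Lemma integrable01_cst (c : R) : mu.-integrable `[0, 1] (EFin \o cst c).
Proof.
apply: continuous_compact_integrable; first exact: segment_compact.
by apply: continuous_subspaceT => x; exact: cvg_cst.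
Qed.

(** [h] need not be monotone, but [k = (h / L + t) / 2] has increments between 0 and [t - s]. So
    [short_map_density] writes [k] as an integral, and Lebesgue differentiation recovers its
    derivative almost everywhere. *)
Lemma lipschitz_ftc (h : R -> R) (L : R) :
  (forall s t, 0 <= s <= 1 -> 0 <= t <= 1 -> `|h s - h t| <= L * `|s - t|) ->
  exists w : R -> R, [/\ mu.-integrable `[0, 1] (EFin \o w),
   {ae mu, forall t : R, 0 < t < 1 -> is_derive t (1 : R) h (w t)} &
   \int[mu]_(t in `[0, 1]) w t = h 1 - h 0].
Proof.
wlog L0 : L / 0 < L.
  move=> H hL; apply: (H (`|L| + 1)) => [|s t hs ht].
    by rewrite ltr_wpDl.
  rewrite (le_trans (hL s t hs ht))// ler_wpM2r//.
  by rewrite (le_trans (ler_norm L))// lerDl.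
move=> hL.
pose k t := (h (clamp01 t) / L + t) / 2.
have hk s t : s <= t -> 0 <= k t - k s <= t - s.
  move=> st; have := hL _ _ (clamp01_in t) (clamp01_in s).
  have /andP[c1 c2] := clamp01_short st.
  rewrite (ger0_norm c1) => H.
  have : `|h (clamp01 t) / L - h (clamp01 s) / L| <= t - s.
    rewrite -mulrBl normrM normfV (gtr0_norm L0) ler_pdivrMr// (le_trans H)// mulrC.
    by rewrite ler_wpM2r// ltW.
  rewrite ler_norml /k => /andP[h1 h2].
  by apply/andP; split; lra.
have [w iw wE] := short_map_density hk.
have iwS A : measurable A -> mu.-integrable A (EFin \o w).
  by move=> mA; apply: integrableS iw.
(* On the unit interval [h = L (2 k - t)], and [w] is the density of [k]. *)
exists (fun t => L * (2 * w t - 1)); split.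
- have -> : EFin \o (fun t => L * (2 * w t - 1)) =
     (fun t => ((L * 2)%:E * (w t)%:E - L%:E))%E.
    by apply/funext => t /=; rewrite -EFinM -EFinB; congr EFin; ring.
  apply: integrableB => //.
    by apply: integrableZl => //; apply: iwS.
  exact: integrable01_cst.
- have lw : locally_integrable setT w.
    by apply: open_integrable_locally => //; exact: openT.
  have := @FTC1 R w (BRight 0) (fun y => iwS _ (measurable_itv _)) lw.
  apply: filterS; first exact: (ae_filter_ringOfSetsType mu).
  move=> t Ht /andP[t0 t1].
  have [|D1 D2] := Ht; first by rewrite lte_fin.
  have D : is_derive t (1 : R) (fun x => \int[mu]_(t in `]0, x]) w t) (w t).
    by apply: DeriveDef => //; rewrite -derive1E.
  apply: (@near_eq_is_derive R R^o R^o
    (fun x : R => L * (2 * ((\int[mu]_(t in `]0, x]) w t) + k 0) - x)) h t 1).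
    near=> x; rewrite -wE; last first.
      apply/andP; split; apply: ltW; near: x; [exact: lt_nbhsr|exact: lt_nbhsl].
    rewrite subrK /k clamp01_id ?mulrDr.
      field; by apply: lt0r_neq0.
    apply/andP; split; apply: ltW; near: x; [exact: lt_nbhsr|exact: lt_nbhsl].
  apply: is_derive_eq; rewrite /GRing.scale /=; ring.
- rewrite RintegralZl//; last first.
    have -> : EFin \o (fun t => (2 * w t - 1)) =
     (fun t => ((2)%:E * (w t)%:E - 1%:E))%E.
      by apply/funext => t /=; rewrite -EFinM -EFinB.
    apply: integrableB => //.
      by apply: integrableZl => //; apply: iwS.
    exact: integrable01_cst.
  rewrite RintegralB//; last 2 first.
  + have -> : EFin \o (fun t => (2 * w t)) = (fun t => ((2)%:E * (w t)%:E))%E by [].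
    by apply: integrableZl => //; apply: iwS.
  + exact: integrable01_cst.
  rewrite RintegralZl ?Rintegral_cst//; last exact: iwS.
  have m01 : fine (mu `[0, 1]%classic) = 1.
    by rewrite lebesgue_measure_itv/= lte_fin ltr01 /= oppr0 addr0.
  rewrite [fine _]m01 mul1r.
  rewrite -Rintegral_itv_obnd_cbnd; last exact: iwS.
  rewrite -wE ?lexx ?ler01// /k !clamp01_id ?lexx ?ler01//.
  field; by apply: lt0r_neq0.
Unshelve. all: by end_near. Qed.

End LipschitzFTC.

(** * Currents of Lipschitz curves *)

Section AeIntegral.
Context d (T : measurableType d) {R : realType}.
Variable mu : {measure set T -> \bar R}.

Import HBNNSimple.

(** No measurability of [f] or [g] is assumed: the integral is a supremum over simple functions, and
    a simple function below [f], set to 0 on [N], lies below [g] and keeps its integral. *)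
Lemma ge0_integral_ae_le (N : set T) (f g : T -> \bar R) : measurable N -> mu N = 0%E ->
  (forall x, 0 <= f x)%E -> (forall x, 0 <= g x)%E -> (forall x, ~ N x -> f x = g x) ->
  (\int[mu]_x f x <= \int[mu]_x g x)%E.
Proof.
move=> mN N0 f0 g0 fg; rewrite !ge0_integralTE//; apply: ge_ereal_sup => _ [h hf <-].
have mCN : measurable (~` N) by exact: measurableC.
apply: ereal_sup_ubound => /=; exists (proj_nnsfun h mCN).
  move=> x; rewrite -mrestrict patchE; case: ifPn => xN //.
  by rewrite -fg; [exact: hf|move: xN; rewrite inE].
rewrite -!integralT_nnsfun; apply: ge0_ae_eq_integral => //.
- by apply/measurable_EFinP.
- by apply/measurable_EFinP.
- by move=> x _; rewrite lee_fin.
- by move=> x _; rewrite lee_fin.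
exists N; split => // x; apply: contra_notP => xN _.
by rewrite -mrestrict patchE mem_set.
Qed.

(* The velocity ['D_1 g] of a Lipschitz curve may fail to be Borel on a null set. *)
Lemma Rintegral_ae_eq (D : set T) (f g : T -> R) :
  {ae mu, forall t, D t -> f t = g t} ->
  \int[mu]_(t in D) f t = \int[mu]_(t in D) g t.
Proof.
move=> [N [mN N0 fgN]].
have fg x : ~ N x -> ((EFin \o f) \_ D) x = ((EFin \o g) \_ D) x.
  move=> xN; rewrite !patchE; case: ifPn => // /set_mem xD /=.
  congr EFin; apply: contrapT => fgx; apply: xN; apply: fgN => /=.
  by move=> H; apply: fgx; exact: H.
congr fine; rewrite integral_mkcond [RHS]integral_mkcond integralE [RHS]integralE.
congr (_ - _)%E; apply/eqP; rewrite eq_le;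
  apply/andP; split; apply: (ge0_integral_ae_le mN N0) => // x xN;
  by rewrite ?funeposE ?funenegE fg.
Qed.

End AeIntegral.

Section Curves.
Context {R : realType}.
Notation mu := (@lebesgue_measure R).

Lemma ae01 (P : R -> Prop) :
  {ae mu, forall t, 0 < t < 1 -> P t} -> {ae mu, forall t, `[0, 1]%classic t -> 0 < t < 1 /\ P t}.
Proof.
move=> H.
have n0 : {ae mu, forall t, t <> 0}.
  exists [set 0]; split => //; first exact: lebesgue_measure_set1.
  by move=> t /= /contrapT.
have n1 : {ae mu, forall t, t <> 1}.
  exists [set 1]; split => //; first exact: lebesgue_measure_set1.
  by move=> t /= /contrapT.
have FF := ae_filter_ringOfSetsType mu.
near=> t; rewrite /= in_itv /= => /andP[t0 t1].
have t01 : 0 < t < 1.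
  rewrite !lt_neqAle t0 t1 !andbT; apply/andP; split; apply/eqP.
    by apply/nesym; near: t.
  by near: t.
by split => //; move: t01; near: t.
Unshelve. all: by end_near. Qed.

(** [v] is an integrable representative of the velocity. It agrees with ['D_1 g] almost everywhere,
    which suffices for [curve_current] by [Rintegral_ae_eq]. *)
Definition velocity (g : R -> pt R) (v : nat -> R -> R) : Prop :=
  (forall k, (k < 3)%N -> mu.-integrable `[0, 1] (EFin \o v k)) /\
  {ae mu, forall t : R, 0 < t < 1 -> forall k, (k < 3)%N ->
     is_derive t (1 : R) (fun s => comp (g s) k) (v k t)}.

Lemma lipschitz_velocity (g : R -> pt R) : lipschitz01 g -> exists v, velocity g v.
Proof.
move=> [L hL].
have H (k : nat) : exists w : R -> R, (k < 3)%N -> mu.-integrable `[0, 1] (EFin \o w) /\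
   {ae mu, forall t : R, 0 < t < 1 -> is_derive t (1 : R) (fun s => comp (g s) k) (w t)}.
  have [k3|k3] := ltnP k 3; last by exists (fun=> 0) => //; rewrite ltnNge k3.
  have [|w [w1 w2 _]] := @lipschitz_ftc R (fun s => comp (g s) k) L.
    move=> s t hs ht; rewrite -compB (le_trans (comp_le_enorm _ k3))//.
    by apply: hL; rewrite in_itv.
  by exists w.
have [v hv] := choice H; exists v; split; first by move=> k /hv[].
have FF := ae_filter_ringOfSetsType mu.
have h0 := (hv 0%N isT).2; have h1 := (hv 1%N isT).2; have h2 := (hv 2%N isT).2.
near=> t => t01 -[|[|[|//]]] _; move: t01; near: t; [exact: h0|exact: h1|exact: h2].
Unshelve. all: by end_near. Qed.

Definition vdot (v : nat -> R -> R) (u : pt R) (t : R) : R :=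
  comp u 0 * v 0%N t + comp u 1 * v 1%N t + comp u 2 * v 2%N t.

Lemma velocity_derive (g : R -> pt R) v (t : R) :
  (forall k, (k < 3)%N -> is_derive t (1 : R) (fun s => comp (g s) k) (v k t)) ->
  forall u, dot u ('D_1 g t) = vdot v u t.
Proof.
move=> H u; rewrite dotE.
have D : derivable g t 1.
  apply/derivable_mxP => i j; rewrite ord1.
  have [+ _] := H j (ltn_ord j); congr (derivable _ t 1).
  by apply/funext => s; rewrite comp_ord.
have E k : (k < 3)%N -> comp ('D_1 g t) k = v k t.
  by move=> k3; rewrite derive_mx// /comp mxE; exact: (@derive_val _ _ _ _ _ _ _ (H k k3)).
by rewrite !E.
Qed.

Lemma curve_currentE (g : R -> pt R) v (B : field R) : velocity g v ->
  curve_current g B = \int[mu]_(t in `[0, 1]) vdot v (B (g t)) t.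
Proof.
move=> [_ /ae01 H]; apply: Rintegral_ae_eq.
have FF := ae_filter_ringOfSetsType mu.
apply: filterS H => t H /H[t01 {}H]; exact: velocity_derive.
Qed.

(** [V] plays the gradient of [f], but only through the chain rule along [g]. At almost every time
    both [w], given by [lipschitz_ftc], and the pairing of [V] with the velocity are the derivative
    of [f \o g], so they coincide. *)
Lemma curve_ftc (g : R -> pt R) (f : pt R -> R) (V : field R) (L : R) :
  lipschitz01 g ->
  (forall s t, 0 <= s <= 1 -> 0 <= t <= 1 -> `|f (g s) - f (g t)| <= L * `|s - t|) ->
  (forall (t : R) (v : nat -> R -> R), 0 < t < 1 ->
    (forall k, (k < 3)%N -> is_derive t (1 : R) (fun s => comp (g s) k) (v k t)) ->
    is_derive t (1 : R) (f \o g) (vdot v (V (g t)) t)) ->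
  curve_current g V = f (g 1) - f (g 0).
Proof.
move=> /lipschitz_velocity[v vg] fL fD.
have [w [w1 w2 w3]] := @lipschitz_ftc R (f \o g) L fL.
rewrite (curve_currentE _ vg) -w3; apply: Rintegral_ae_eq.
have [_ vD] := vg.
have FF := ae_filter_ringOfSetsType mu.
have {}w2 := ae01 w2; have {}vD := ae01 vD.
near=> t => t01.
have [t01' Hw] : 0 < t < 1 /\ is_derive t (1 : R) (f \o g) (w t).
  by move: t01; near: t.
have [_ Hv] : 0 < t < 1 /\ forall k, (k < 3)%N ->
     is_derive t (1 : R) (fun s => comp (g s) k) (v k t).
  by move: t01; near: t.
have Hf := fD t v t01' Hv.
by rewrite -(@derive_val _ _ _ _ _ _ _ Hf) (@derive_val _ _ _ _ _ _ _ Hw).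
Unshelve. all: by end_near. Qed.

Lemma lipschitz01_continuous (g : R -> pt R) : lipschitz01 g ->
  {within `[0, 1], continuous g}.
Proof.
move=> [L hL]; apply: within_vec => k k3; apply/subspace_continuousP => t t01.
apply/cvgrPdist_lt => e e0; near=> s.
have s01 : `[0, 1]%classic s by near: s; exact: withinT.
rewrite -compB (le_lt_trans (comp_le_enorm _ k3))//.
rewrite (le_lt_trans (hL _ _ t01 s01))//.
rewrite (@le_lt_trans _ _ ((`|L| + 1) * `|t - s|))//.
  by rewrite ler_wpM2r// (le_trans (ler_norm L))// lerDl.
rewrite -ltr_pdivlMl ?ltr_wpDl//; near: s.
have d0 : 0 < (`|L| + 1)^-1 * e by rewrite mulr_gt0// invr_gt0 ltr_wpDl.
have : \forall s \near t, `|t - s| < (`|L| + 1)^-1 * e.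
  by apply/nbhs_ballP; exists ((`|L| + 1)^-1 * e).
exact: cvg_within.
Unshelve. all: by end_near. Qed.

Section Ball.
Variables (Rad : R) (g : R -> pt R) (v : nat -> R -> R).
Hypotheses (lg : lipschitz01 g) (bg : forall t, t \in `[0, 1] -> cball Rad (g t)).
Hypothesis vg : velocity g v.

Lemma vdot_integrable (B : field R) : contw Rad B ->
  mu.-integrable `[0, 1] (EFin \o (fun t => vdot v (B (g t)) t)).
Proof.
move=> cB.
have cBg : {within `[0, 1], continuous (B \o g)}.
  by apply: (within_comp2 (C := cball Rad)) => //; exact: lipschitz01_continuous.
have I k : (k < 3)%N -> mu.-integrable `[0, 1] (fun t => (comp (B (g t)) k * v k t)%R%:E).
  move=> k3.
  have ck : {within `[0, 1], continuous (fun t => comp (B (g t)) k)}.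
    exact: within_compo cBg.
  have -> : (fun t => (comp (B (g t)) k * v k t)%R%:E) =
    ((EFin \o (fun t => comp (B (g t)) k)) \* (EFin \o v k))%E by [].
  apply: integrableMr => //; last exact: vg.1.
    by apply: subspace_continuous_measurable_fun.
  have := @continuous_compact _ _ _ _ ck (@segment_compact R 0 1).
  move=> /compact_bounded; rewrite /bounded_near /=.
  move=> [M [Mr MP]]; exists M; split => // x /MP H t t01; apply: H.
  by exists t.
have -> : EFin \o (fun t => vdot v (B (g t)) t) =
  (fun t => (comp (B (g t)) 0 * v 0%N t)%:E + (comp (B (g t)) 1 * v 1%N t)%:E
     + (comp (B (g t)) 2 * v 2%N t)%:E)%E.
  by apply/funext => t; rewrite /= /vdot !EFinD.
by do 2! (apply: integrableD => //; last exact: I); exact: I.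
Qed.

Lemma curve_finite_mass : finite_mass_current Rad (curve_current g).
Proof.
split=> [a B1 B2 c1 c2|].
  have c3 : contw Rad (fun x => a *: B1 x + B2 x).
    by apply: contwD => //; apply: contwZ => //; exact: within_cst.
  rewrite !(curve_currentE _ vg) -RintegralZl//; last exact: vdot_integrable.
  rewrite -RintegralD//; last 2 first.
  - have -> : EFin \o (fun t => a * vdot v (B1 (g t)) t) =
      (fun t => a%:E * (vdot v (B1 (g t)) t)%:E)%E by [].
    by apply: integrableZl => //; exact: vdot_integrable.
  - exact: vdot_integrable.
  by apply: eq_Rintegral => t _; rewrite /vdot !compL; ring.
have I : mu.-integrable `[0, 1]
   (EFin \o (fun t => `|v 0%N t| + `|v 1%N t| + `|v 2%N t|)).
  have -> : EFin \o (fun t => `|v 0%N t| + `|v 1%N t| + `|v 2%N t|) =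
    (fun t => `|(v 0%N t)%:E| + `|(v 1%N t)%:E| + `|(v 2%N t)%:E|)%E by [].
  do 2! (apply: integrableD => //; last by apply: integrable_abse; exact: vg.1).
  by apply: integrable_abse; exact: vg.1.
(* The sum of the integrals of the speeds in each coordinate bounds the action on every field whose
   components are at most 1. *)
exists (\int[mu]_(t in `[0, 1]) (`|v 0%N t| + `|v 1%N t| + `|v 2%N t|)) => B cB B1.
rewrite (curve_currentE _ vg).
apply: le_trans (le_normr_Rintegral _ (vdot_integrable cB)) _ => //.
apply: le_Rintegral => //.
  by have := integrable_abse (vdot_integrable cB).
move=> t t01; rewrite /vdot.
have h k : (k < 3)%N -> `|comp (B (g t)) k * v k t| <= `|v k t|.
  move=> k3; rewrite normrM ler_piMl// (le_trans (comp_le_enorm _ k3))//.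
  by apply: B1; exact: bg.
rewrite (le_trans (ler_normD _ _))// lerD ?h// (le_trans (ler_normD _ _))// lerD ?h//.
Qed.

End Ball.
End Curves.

(** * Entire power series and the field [B0] *)

Section Entire.
Context {R : realType}.
Implicit Types (c d : nat -> R) (s t : R).

(** Factorial decay is stronger than an infinite radius of convergence, and termwise differentiation
    preserves it with the same constant [A]. *)
Definition entire c := exists A, forall k, `|c k| <= A / k`!%:R.
Definition ps c s : R := limn (pseries c s).

Lemma entire_cvg c s : entire c -> cvgn (pseries c s).
Proof.
move=> [A hA]; apply: normed_cvg.
have A0 : 0 <= A by have := hA 0%N; rewrite fact0 divr1; exact: le_trans.
apply: (series_le_cvg (v_ := fun k => A * exp_coeff `|s| k)) => //.
- by move=> n /=.
- by move=> n /=; rewrite mulr_ge0// exp_coeff_ge0.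
- move=> n /=; rewrite normrM normrX /exp_coeff /= (mulrC (_ ^+ _)) mulrA.
  by rewrite ler_wpM2r// exprn_ge0.
- rewrite (_ : series _ = (fun n => A * series (exp_coeff `|s|) n)); last first.
    by apply/funext => n; rewrite /series /= mulr_sumr.
  apply/cvg_ex; exists (A * limn (series (exp_coeff `|s|))).
  by apply: cvgM; [exact: cvg_cst|exact: is_cvg_series_exp_coeff].
Qed.

Lemma ps_cvg c s : entire c -> pseries c s @ \oo --> ps c s.
Proof. by move=> ec; exact: (@entire_cvg c s ec). Qed.

Lemma entire_diffs c : entire c -> entire (pseries_diffs c).
Proof.
move=> [A hA]; exists A => k; rewrite /pseries_diffs normrM ger0_norm ?ler0n//.
have := hA k.+1; rewrite factS natrM invfM mulrA mulrAC => H.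
rewrite -ler_pdivlMl ?ltr0n// mulrC; exact: H.
Qed.

Lemma entire_shift c : entire c -> entire (c \o S).
Proof.
move=> [A hA]; exists A => k /=.
have A0 : 0 <= A by have := hA 0%N; rewrite fact0 divr1; exact: le_trans.
rewrite (le_trans (hA _))// ler_wpM2l// lef_pV2 ?posrE ?ltr0n ?fact_gt0// ler_nat.
by rewrite factS leq_pmull.
Qed.

Lemma entireD c d : entire c -> entire d -> entire (fun k => c k + d k).
Proof.
move=> [A hA] [B hB]; exists (A + B) => k.
by rewrite (le_trans (ler_normD _ _))// mulrDl lerD.
Qed.

Lemma entireZ a c : entire c -> entire (fun k => a * c k).
Proof.
by move=> [A hA]; exists (`|a| * A) => k; rewrite normrM -mulrA ler_wpM2l.
Qed.

Lemma ps_is_derive c s : entire c -> is_derive s (1 : R) (ps c) (ps (pseries_diffs c) s).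
Proof.
move=> ec; apply: (@pseries_snd_diffs _ _ (`|s| + 1)).
- exact: entire_cvg.
- exact/entire_cvg/entire_diffs.
- exact/entire_cvg/entire_diffs/entire_diffs.
- by rewrite (@ger0_norm _ (`|s| + 1)) ?addr_ge0// ltrDl.
Qed.

Lemma ps_continuous c : entire c -> continuous (ps c).
Proof.
move=> ec s; have [D _] := @ps_is_derive c s ec.
by apply: differentiable_continuous; exact/derivable1_diffP.
Qed.

(** Serves to divide a series without constant term by its variable, which removes the singularities
    of [B0] at the origin. *)
Lemma ps_shift c s : entire c -> ps c s = c 0%N + s * ps (c \o S) s.
Proof.
move=> ec; apply/cvg_lim => //.
rewrite -(cvg_shiftS (pseries c s)) /=.
have -> : (fun n => pseries c s n.+1) = (fun n => c 0%N + s * pseries (c \o S) s n).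
  apply/funext => n; rewrite /pseries /series /= big_nat_recl//= expr0 mulr1.
  congr (_ + _); rewrite mulr_sumr; apply: eq_bigr => i _.
  by rewrite exprS; ring.
apply: cvgD; first exact: cvg_cst.
by apply: cvgM; [exact: cvg_cst|apply: ps_cvg; exact: entire_shift].
Qed.

Lemma psD c d s : entire c -> entire d -> ps (fun k => c k + d k) s = ps c s + ps d s.
Proof.
move=> ec ed; apply/cvg_lim => //.
have -> : pseries (fun k => c k + d k) s = (fun n => pseries c s n + pseries d s n).
  apply/funext => n; rewrite /pseries /series /= -big_split /=.
  by apply: eq_bigr => i _; rewrite mulrDl.
by apply: cvgD; exact: ps_cvg.
Qed.

Lemma psZ a c s : entire c -> ps (fun k => a * c k) s = a * ps c s.
Proof.
move=> ec; apply/cvg_lim => //.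
have -> : pseries (fun k => a * c k) s = (fun n => a * pseries c s n).
  apply/funext => n; rewrite /pseries /series /= mulr_sumr.
  by apply: eq_bigr => i _; rewrite mulrA.
by apply: cvgM; [exact: cvg_cst|exact: ps_cvg].
Qed.

(** Euler's operator [s d/ds] is diagonal on coefficients; this turns the ODE for [cU] into a
    recursion. *)
Lemma ps_euler c s : entire c -> entire (fun k => k%:R * c k) ->
  s * ps (pseries_diffs c) s = ps (fun k => k%:R * c k) s.
Proof. by move=> ec ek; rewrite [RHS]ps_shift// mul0r add0r. Qed.

Lemma ps_ge0_le c s t : entire c -> (forall k, 0 <= c k) -> 0 <= s <= t ->
  ps c s <= ps c t.
Proof.
move=> ec c0 /andP[s0 st]; apply: ler_lim; [exact: entire_cvg|exact: entire_cvg|].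
near=> n; apply: ler_sum => i _; apply: ler_wpM2l => //.
by apply: lerXn2r => //; rewrite nnegrE ?(le_trans s0 st).
Unshelve. all: by end_near. Qed.

Lemma ps0 c : entire c -> ps c 0 = c 0%N.
Proof. by move=> ec; rewrite ps_shift// mul0r addr0. Qed.

End Entire.

(** * Hyperbolic functions and the profiles of [B0] as entire series in the squared radius *)

Section Hyperbolic.
Context {R : realType}.
Implicit Types (r s : R) (k n : nat).

Lemma cvg_double (u : nat -> R) (l : R) : u @ \oo --> l -> (fun n => u n.*2) @ \oo --> l.
Proof.
move=> ul; apply: (@cvg_comp _ _ _ double u \oo \oo _ _ ul).
move=> P [N _ NP]; exists N => // n /= Nn; apply: NP => /=.
by rewrite (leq_trans Nn)// -addnn leq_addr.
Qed.

(** [cA] and [cS] are the Taylor coefficients of [cosh r] and [sinh r / r] in the variable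
    [s = r ^+ 2]. *)
Definition cA k : R := ((k.*2)`!%:R)^-1.
Definition cS k : R := ((k.*2.+1)`!%:R)^-1.

Lemma fact_leq m n : (m <= n)%N -> (m`! <= n`!)%N.
Proof.
elim: n => [|n IH]; first by rewrite leqn0 => /eqP ->.
rewrite leq_eqVlt => /predU1P[->//|]; rewrite ltnS => /IH /leq_trans; apply.
by rewrite factS leq_pmull.
Qed.

Lemma entire_invfact (m : nat -> nat) (c : nat -> R) : (forall k, (k <= m k)%N) ->
  (forall k, 0 <= c k <= ((m k)`!%:R)^-1) -> entire c.
Proof.
move=> km cm; exists 1 => k; have /andP[c0 c1] := cm k.
rewrite ger0_norm// div1r (le_trans c1)// lef_pV2 ?posrE ?ltr0n ?fact_gt0//.
by rewrite ler_nat fact_leq.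
Qed.

Lemma leq_double_self k : (k <= k.*2)%N.
Proof. by rewrite -addnn leq_addr. Qed.

Lemma entire_cA : entire cA.
Proof. by apply: (entire_invfact leq_double_self) => k; rewrite lexx invr_ge0 ler0n. Qed.

Lemma entire_cS : entire cS.
Proof.
apply: (@entire_invfact (fun k => k.*2.+1)) => k; last by rewrite lexx invr_ge0 ler0n.
by rewrite (leq_trans (leq_double_self k)).
Qed.

Lemma series_exp_sum r n :
  series (exp_coeff r) n.*2 + series (exp_coeff (- r)) n.*2 = 2 * pseries cA (r ^+ 2) n.
Proof.
elim: n => [|n IH]; first by rewrite /pseries /series /= !big_geq// addr0 mulr0.
have e (u : nat -> R) : series u n.+1.*2 = series u n.*2 + u n.*2 + u n.*2.+1.
  by rewrite doubleS /series /= !big_nat_recr.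
have e2 : pseries cA (r ^+ 2) n.+1 = pseries cA (r ^+ 2) n + cA n * (r ^+ 2) ^+ n.
  by rewrite /pseries /series /= !big_nat_recr.
rewrite !e e2 mulrDr -IH /exp_coeff /= /cA -exprM mul2n !exprS.
have -> : (- r) ^+ n.*2 = r ^+ n.*2 by rewrite -mul2n !exprM sqrrN.
by rewrite mulNr mulNr; ring.
Qed.

Lemma series_exp_diff r n :
  series (exp_coeff r) n.*2 - series (exp_coeff (- r)) n.*2 = 2 * (r * pseries cS (r ^+ 2) n).
Proof.
elim: n => [|n IH]; first by rewrite /pseries /series /= !big_geq// subrr !mulr0.
have e (u : nat -> R) : series u n.+1.*2 = series u n.*2 + u n.*2 + u n.*2.+1.
  by rewrite doubleS /series /= !big_nat_recr.
have e2 : pseries cS (r ^+ 2) n.+1 = pseries cS (r ^+ 2) n + cS n * (r ^+ 2) ^+ n.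
  by rewrite /pseries /series /= !big_nat_recr.
rewrite !e e2 mulrDr mulrDr -IH /exp_coeff /= /cS -exprM mul2n !exprS.
have -> : (- r) ^+ n.*2 = r ^+ n.*2 by rewrite -mul2n !exprM sqrrN.
by rewrite mulNr mulNr; ring.
Qed.

Lemma expR_cvg r : series (exp_coeff r) @ \oo --> expR r.
Proof. rewrite /expR; exact: is_cvg_series_exp_coeff. Qed.

Lemma coshE r : cosh r = ps cA (r ^+ 2).
Proof.
have h : (fun n => 2^-1 * (series (exp_coeff r) n.*2 + series (exp_coeff (- r)) n.*2)) @ \oo
   --> 2^-1 * (expR r + expR (- r)).
  apply: cvgM; first exact: cvg_cst.
  by apply: cvgD; apply: (cvg_double (u := series _)); exact: expR_cvg.
rewrite /cosh mulrC -(cvg_lim _ h)//; congr (limn _); apply/funext => n.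
by rewrite series_exp_sum mulKf.
Qed.

Lemma sinhE r : sinh r = r * ps cS (r ^+ 2).
Proof.
have h : (fun n => 2^-1 * (series (exp_coeff r) n.*2 - series (exp_coeff (- r)) n.*2)) @ \oo
   --> 2^-1 * (expR r - expR (- r)).
  apply: cvgM; first exact: cvg_cst.
  by apply: cvgB; apply: (cvg_double (u := series _)); exact: expR_cvg.
have h2 : (fun n => 2^-1 * (series (exp_coeff r) n.*2 - series (exp_coeff (- r)) n.*2)) @ \oo
   --> r * ps cS (r ^+ 2).
  have -> : (fun n => 2^-1 * (series (exp_coeff r) n.*2 - series (exp_coeff (- r)) n.*2))
    = (fun n => r * pseries cS (r ^+ 2) n).
    by apply/funext => n; rewrite series_exp_diff mulKf.
  by apply: cvgM; [exact: cvg_cst|apply: ps_cvg; exact: entire_cS].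
by rewrite /sinh mulrC -(cvg_lim _ h)// (cvg_lim _ h2).
Qed.

(* With [s = r ^+ 2], [gB0 Rad r = kappa Rad * ps cG s] and [fB0 Rad r = kappa Rad * ps cF s];
   [cU] is the solution of [ps_ode], which makes [B0 - omcal] a gradient. *)
Definition cG k : R := 4 * k.+1%:R ^+ 2 / (k.*2.+3)`!%:R.
Definition cF k : R := 4 * k.+1%:R / (k.*2.+3)`!%:R.
Definition cU k : R := 2 * k.+1%:R / (k.*2.+3%:R * (k.*2.+3)`!%:R).

Lemma natr_double k : k.*2%:R = 2 * k%:R :> R.
Proof. by rewrite -mul2n natrM. Qed.

Lemma natr_S k : k.+1%:R = k%:R + 1 :> R.
Proof. by rewrite natr1. Qed.

Lemma fact_neq0 k : k`!%:R != 0 :> R.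
Proof. by rewrite pnatr_eq0 -lt0n fact_gt0. Qed.

(** The combination [(1 + s) sinh r / r - cosh r] in [gB0] has vanishing constant term; these are
    its coefficients after division by [s]. *)
Lemma cG_rec k : cG k = cS k.+1 - cA k.+1 + cS k.
Proof.
rewrite /cG /cS /cA doubleS !(factS k.*2.+1.+1) !(factS k.*2.+1).
have := fact_neq0 k.*2.+1; move: (k.*2.+1`!) => f f0.
rewrite !natrM !natr_S natr_double; field.
by rewrite f0 -!natr_double !natr1 !pnatr_eq0.
Qed.

Lemma cF_rec k : cF k = 2 * (cA k.+1 - cS k.+1).
Proof.
rewrite /cF /cS /cA doubleS !(factS k.*2.+1.+1) !(factS k.*2.+1).
have := fact_neq0 k.*2.+1; move: (k.*2.+1`!) => f f0.
rewrite !natrM !natr_S natr_double; field.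
by rewrite f0 -!natr_double !natr1 !pnatr_eq0.
Qed.

(** Coefficientwise form of [ps_ode]. Since [3 + 2 k] is never zero, it determines [cU]. *)
Lemma cU_rec k : (3 + 2 * k%:R) * cU k = (cG k.+1 - cF k.+1) + 2 * (k.+1%:R * cG k.+1).
Proof.
rewrite /cU /cG /cF doubleS !(factS k.*2.+4) !(factS k.*2.+3).
have := fact_neq0 k.*2.+3; move: (k.*2.+3`!) => f f0.
rewrite !natrM !natr_S natr_double; field.
by rewrite f0 -!natr_double !natr1 !pnatr_eq0.
Qed.

Lemma cF_ge0 k : 0 <= cF k.
Proof. by rewrite /cF !mulr_ge0 ?invr_ge0 ?ler0n. Qed.

Lemma cFG k : cF k <= cG k.
Proof.
rewrite /cF /cG ler_wpM2r ?invr_ge0 ?ler0n// ler_wpM2l ?ler0n//.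
by rewrite expr2 ler_peMl ?ler0n// ler1n.
Qed.

Lemma cGS k : cG k <= cS k.
Proof.
rewrite cG_rec -lerBrDr subrr subr_le0 /cS /cA doubleS.
by rewrite lef_pV2 ?posrE ?ltr0n ?fact_gt0// ler_nat fact_leq.
Qed.

Lemma cU_gt0 k : 0 < cU k.
Proof. by rewrite /cU divr_gt0// mulr_gt0 ?ltr0n ?fact_gt0. Qed.

(** Controls [cU k] and [k * cU k] at once: both are at most [cF k], hence at most [cS k], and so
    define entire series. *)
Lemma cUF k : k.+1%:R * cU k <= cF k.
Proof.
rewrite /cU /cF; have := fact_neq0 k.*2.+3; have : 0 <= (k.*2.+3)`!%:R :> R by [].
move: (k.*2.+3)`! => f fge f0; rewrite -subr_ge0.
have -> : 4 * k.+1%:R / f%:R - k.+1%:R * (2 * k.+1%:R / (k.*2.+3%:R * f%:R)) =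
  (2 * k.+1%:R * (2 * k.*2.+3%:R - k.+1%:R)) / (k.*2.+3%:R * f%:R) :> R.
  by field; rewrite f0 -natrD pnatr_eq0.
rewrite divr_ge0 ?mulr_ge0 ?ler0n// subr_ge0 -natrM ler_nat; lia.
Qed.

Lemma cS_bound (c : nat -> R) : (forall k, 0 <= c k) -> (forall k, c k <= cS k) -> entire c.
Proof.
move=> c0 c1; apply: (@entire_invfact (fun k => k.*2.+1)) => k; last by rewrite c0 c1.
by rewrite (leq_trans (leq_double_self k)).
Qed.

Lemma cG_ge0 k : 0 <= cG k.
Proof. exact: le_trans (cF_ge0 k) (cFG k). Qed.

Lemma entire_cG : entire cG.
Proof. by apply: cS_bound cGS => k; exact: cG_ge0. Qed.
Lemma entire_cF : entire cF.
Proof. by apply: cS_bound => k; [exact: cF_ge0|exact: le_trans (cFG k) (cGS k)]. Qed.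
Lemma entire_cU : entire cU.
Proof.
apply: cS_bound => k; first exact: ltW (cU_gt0 k).
apply: le_trans (le_trans (cFG k) (cGS k)); apply: le_trans (cUF k).
by rewrite ler_peMl ?ler1n// ltW// cU_gt0.
Qed.
Lemma entire_kcU : entire (fun k => k%:R * cU k).
Proof.
apply: cS_bound => k; first by rewrite mulr_ge0// ltW// cU_gt0.
apply: le_trans (le_trans (cFG k) (cGS k)); apply: le_trans (cUF k).
by rewrite ler_wpM2r ?ler_nat// ltW// cU_gt0.
Qed.

(** Coefficients of [(ps cG s - ps cF s) / s]. The division is exact because
    [cG 0 = cF 0 = 2 / 3]. *)
Definition cH k : R := cG k.+1 - cF k.+1.

Lemma entire_cGF : entire (fun k => cG k - cF k).
Proof.
have := entireD entire_cG (entireZ (-1) entire_cF).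
by congr entire; apply/funext => k; rewrite mulN1r.
Qed.

Lemma entire_cH : entire cH.
Proof. exact: (entire_shift entire_cGF). Qed.

Lemma ps_cF s : s * ps cF s = 2 * (ps cA s - ps cS s).
Proof.
rewrite (@ps_shift _ cA)// ?(@ps_shift _ cS)//; [|exact: entire_cS|exact: entire_cA].
rewrite /cA /cS /= double0 fact0 -!/cA -!/cS (_ : 1`! = 1%N)// opprD addrACA subrr add0r.
rewrite -mulrBr mulrCA; congr (_ * _).
have -> : cF = (fun k => 2 * (cA k.+1 + -1 * cS k.+1)).
  by apply/funext => k; rewrite cF_rec mulN1r.
have eA := entire_shift entire_cA; have eS := entire_shift entire_cS.
have eN : entire (fun k => -1 * cS k.+1) by exact: entireZ eS.
by rewrite psZ; [rewrite psD// psZ// mulN1r|exact: entireD].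
Qed.

Lemma ps_cG s : s * ps cG s = (1 + s) * ps cS s - ps cA s.
Proof.
have eA := entire_shift entire_cA; have eS := entire_shift entire_cS.
have -> : cG = (fun k => (cS k.+1 + -1 * cA k.+1) + cS k).
  by apply/funext => k; rewrite cG_rec mulN1r.
rewrite psD; [|by apply: entireD => //; exact: entireZ|exact: entire_cS].
rewrite psD//; last exact: entireZ.
rewrite psZ// mulrDl mul1r {2}(@ps_shift _ cS)//; last exact: entire_cS.
rewrite (@ps_shift _ cA)//; last exact: entire_cA.
by rewrite {3}/cS {2}/cA double0 /= fact0 (_ : 1`! = 1%N)// /comp; ring.
Qed.

Lemma ps_ode s : 3 * ps cU s + 2 * (s * ps (pseries_diffs cU) s) =
  ps cH s + 2 * ps (pseries_diffs cG) s.
Proof.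
rewrite (ps_euler _ entire_cU entire_kcU).
have eU a : entire (fun k => a * cU k) by exact: entireZ entire_cU.
have ekU a : entire (fun k => a * (k%:R * cU k)) by exact: entireZ entire_kcU.
have eG a : entire (fun k => a * pseries_diffs cG k).
  exact: entireZ (entire_diffs entire_cG).
transitivity (ps (fun k => 3 * cU k + 2 * (k%:R * cU k)) s).
  by rewrite psD// !psZ//; [exact: entire_kcU|exact: entire_cU].
transitivity (ps (fun k => cH k + 2 * pseries_diffs cG k) s); last first.
  by rewrite psD ?psZ//; [exact: entire_diffs entire_cG|exact: entire_cH].
congr (ps _ s); apply/funext => k.
by rewrite /cH /pseries_diffs -cU_rec; ring.
Qed.

Lemma ps_cGF s : ps cG s - ps cF s = s * ps cH s.
Proof.
have eF : entire (fun k => -1 * cF k) by exact: entireZ entire_cF.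
transitivity (ps (fun k => cG k + -1 * cF k) s).
  by rewrite psD ?psZ ?mulN1r//; [exact: entire_cF|exact: entire_cG].
rewrite ps_shift; last by apply: entireD => //; exact: entire_cG.
have -> : cG 0 + -1 * cF 0 = 0 by rewrite /cG /cF; field.
rewrite add0r; congr (_ * ps _ s); apply/funext => k.
by rewrite /= mulN1r.
Qed.

Lemma sinh_gt0 r : 0 < r -> 0 < sinh r.
Proof.
move=> r0; rewrite sinhE mulr_gt0//.
have c0 k : 0 <= cS k by rewrite invr_ge0 ler0n.
have := ps_ge0_le entire_cS c0 (_ : 0 <= 0 <= r ^+ 2).
rewrite lexx sqr_ge0 => /(_ isT); apply: lt_le_trans.
by rewrite ps0; [rewrite invr_gt0 ltr0n|exact: entire_cS].
Qed.

Definition kappa (Rad : R) : R := 3 * Rad / (2 * sinh Rad).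

Lemma gB0E Rad r : sinh Rad != 0 -> r != 0 -> gB0 Rad r = kappa Rad * ps cG (r ^+ 2).
Proof.
move=> S0 r0; have r20 : r ^+ 2 != 0 by rewrite expf_neq0.
apply: (mulfI r20); rewrite [RHS]mulrCA ps_cG /gB0 /kappa coshE (sinhE r).
by field; rewrite r0 S0.
Qed.

Lemma fB0E Rad r : sinh Rad != 0 -> r != 0 -> fB0 Rad r = kappa Rad * ps cF (r ^+ 2).
Proof.
move=> S0 r0; have r20 : r ^+ 2 != 0 by rewrite expf_neq0.
apply: (mulfI r20); rewrite [RHS]mulrCA ps_cF /fB0 /kappa coshE (sinhE r).
by field; rewrite r0 S0.
Qed.

Lemma CRE Rad : 0 < Rad -> CR Rad = kappa Rad * ps cG (Rad ^+ 2).
Proof.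
move=> R0; have S0 := sinh_gt0 R0; rewrite -gB0E ?gt_eqF// /CR /gB0.
by field; rewrite !gt_eqF.
Qed.

(** Since [sin phi phihat = (z x - r^2 zhat) / r^2], the field equals
    [(CR - g) zhat + ((g - f) / r^2) z x], whose coefficients are entire in [r^2]. The value
    prescribed at the origin fits because [kappa Rad * cG 0 = Rad / sinh Rad]. *)
Lemma B0E Rad (x : pt R) (s := enorm x ^+ 2) : 0 < Rad ->
  B0 Rad x = (kappa Rad * (ps cG (Rad ^+ 2) - ps cG s)) *: zhat
    + (kappa Rad * ps cH s * comp x 2) *: x.
Proof.
move=> R0; have S0 := sinh_gt0 R0; rewrite /B0 CRE//.
case: ifPn => [/eqP x0|x0].
  rewrite /s x0 expr0n /= ps0; last exact: entire_cG.
  rewrite (enorm0_eq0 x0) scaler0 addr0.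
  have -> : cG 0 = 2 / 3 :> R by rewrite /cG (_ : 3`! = 6%N)//; field.
  by apply: pt_eqP; rewrite !compL !comp_vec3 ?mulr0// /kappa; field; rewrite gt_eqF.
have Sn : sinh Rad != 0 by rewrite gt_eqF.
rewrite gB0E// fB0E// -/s.
have s0 : s != 0 by rewrite expf_neq0.
have Fs : ps cF s = ps cG s - s * ps cH s by rewrite -ps_cGF; ring.
have E : comp x 0 ^+ 2 + comp x 1 ^+ 2 = s - comp x 2 ^+ 2.
  by rewrite /s sqr_enormE addrK.
rewrite E Fs; apply: pt_eqP; rewrite !compL !comp_vec3; field; exact: s0.
Qed.

End Hyperbolic.

(** * Smooth cutoffs *)

Section Smooth1D.
Context {R : realType}.
Implicit Types (f g : R -> R) (n k : nat).

(** [Dk n f] provides [n + 1] successive derivatives. Carrying them as existential witnesses makes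
    the closure properties plain inductions on [n]. *)
Fixpoint Dk n f : Prop := exists2 f' : R -> R,
  (forall x, is_derive x (1 : R) f (f' x)) & (if n is n'.+1 then Dk n' f' else True).

Definition smooth1 f := forall n, Dk n f.

Lemma DkW n f : Dk n.+1 f -> Dk n f.
Proof.
elim: n f => [|n IH] f [f' df Df']; first by exists f'.
by exists f' => //; exact: IH.
Qed.

Lemma Dk_cst n (c : R) : Dk n (fun=> c).
Proof.
elim: n c => [|n IH] c; exists (fun=> 0) => // x; exact: is_derive_cst.
Qed.

Lemma Dk_id n : Dk n id.
Proof.
case: n => [|n]; exists (fun=> 1) => //; try (by move=> x; exact: is_derive_id).
exact: Dk_cst.
Qed.

Lemma DkD n f g : Dk n f -> Dk n g -> Dk n (fun x => f x + g x).
Proof.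
elim: n f g => [|n IH] f g [f' df Df] [g' dg Dg]; exists (fun x => f' x + g' x) => //;
  by [move=> x; exact: is_deriveD|exact: IH].
Qed.

Lemma DkM n f g : Dk n f -> Dk n g -> Dk n (fun x => f x * g x).
Proof.
elim: n f g => [|n IH] f g Hf Hg;
  have [f' df Df] := Hf; have [g' dg Dg] := Hg;
  exists (fun x => f x * g' x + g x * f' x) => //; try by move=> x; exact: is_deriveM.
by apply: DkD; apply: IH => //; exact: DkW.
Qed.

Lemma DkN n f : Dk n f -> Dk n (fun x => - f x).
Proof.
move=> Hf; have := DkM (@Dk_cst n (-1)) Hf.
by congr Dk; apply/funext => x; rewrite mulN1r.
Qed.

Lemma Dk_comp n f g : Dk n f -> Dk n g -> Dk n (fun x => f (g x)).
Proof.
elim: n f g => [|n IH] f g Hf Hg;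
  have [f' df Df] := Hf; have [g' dg Dg] := Hg;
  exists (fun x => f' (g x) * g' x) => //.
- by move=> x; exact: is_derive1_comp.
- by move=> x; exact: is_derive1_comp.
by apply: DkM => //; apply: IH => //; exact: DkW.
Qed.

Lemma DkV n f : (forall x, f x != 0) -> Dk n f -> Dk n (fun x => (f x)^-1).
Proof.
move=> f0; elim: n f f0 => [|n IH] f f0 Hf; have [f' df Df] := Hf;
  exists (fun x => - ((f x)^-1 * (f x)^-1) * f' x) => //.
- by move=> x; have := is_deriveV (f0 x) (df x); rewrite -exprVn expr2.
- by move=> x; have := is_deriveV (f0 x) (df x); rewrite -exprVn expr2.
by apply: DkM => //; apply: DkN; apply: DkM; apply: IH => //; exact: DkW.
Qed.

Lemma Dk_ps n (c : nat -> R) : entire c -> Dk n (ps c).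
Proof.
elim: n c => [|n IH] c ec; exists (ps (pseries_diffs c)) => //; try by move=> x; exact: ps_is_derive.
by apply: IH; exact: entire_diffs.
Qed.

(** The power of [x^-1] is there to make the family stable under differentiation: the derivative of
    [flat k] is a combination of [flat k.+2] and [flat k.+1], at the origin as well. *)
Definition flat k (x : R) : R := if 0 < x then x^-1 ^+ k * expR (- x^-1) else 0.

Lemma flat_ge0 k x : 0 <= flat k x.
Proof.
rewrite /flat; case: ifPn => // x0.
by rewrite mulr_ge0 ?expR_ge0// exprn_ge0// invr_ge0 ltW.
Qed.

(** With [y = 1 / x], this is the inequality [y^(k+1) / (k+1)! <= exp y]. It makes every [flat k]
    continuous at 0. *)
Lemma flat_le k (x : R) : flat k x <= k.+1`!%:R * `|x|.
Proof.
rewrite /flat; case: ifPn => [x0|_]; last by rewrite mulr_ge0.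
have y0 : 0 < x^-1 by rewrite invr_gt0.
rewrite gtr0_norm// -[x in leRHS]invrK; move: x^-1 y0 => y y0 {x x0}.
rewrite expRN ler_pdivrMr ?expR_gt0//.
have H := expR_ge1Dxn k (ltW y0).
have : y ^+ k.+1 / k.+1`!%:R <= expR y by apply: le_trans H; rewrite lerDr.
rewrite ler_pdivrMr ?ltr0n ?fact_gt0// => {}H.
rewrite mulrAC ler_pdivlMr// -exprSr (le_trans H)// mulrC //.
Qed.

Lemma flat_derive k (x : R) : is_derive x (1 : R) (flat k) (flat k.+2 x - k%:R * flat k.+1 x).
Proof.
have [x0|x0|->] := ltgtP x 0.
- rewrite /flat ltNge (ltW x0) /= mulr0 subr0.
  apply: (@near_eq_is_derive R R^o R^o (fun=> 0)) => //.
  near=> y; rewrite ltNge (_ : y <= 0)//.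
  by apply: ltW; near: y; exact: lt_nbhsl.
- rewrite /flat x0.
  apply: (@near_eq_is_derive R R^o R^o (fun y => y^-1 ^+ k * expR (- y^-1))) => //.
    by near=> y; rewrite ifT//; near: y; exact: lt_nbhsr.
  have xn0 : x != 0 by rewrite gt_eqF.
  have D1 : is_derive x (1 : R) (fun y : R => y^-1) (- x ^- 2 * 1) by exact: is_deriveV.
  have D2 : is_derive x (1 : R) (fun y : R => expR (- y^-1)) (expR (- x^-1) * - (- x ^- 2 * 1)).
    by apply: is_derive1_comp.
  have D3 : is_derive x (1 : R) (fun y : R => y^-1 ^+ k) ((k%:R * x^-1 ^+ k.-1) *: (- x ^- 2 * 1)).
    by have := @is_deriveX _ _ (fun y : R => y^-1) k x 1 _ D1; rewrite exprfctE.
  apply: is_derive_eq; rewrite /GRing.scale /=.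
  case: k {D3} => [|k] /=; rewrite !exprS -?exprVn ?expr0 ; field => //.
- have H : h^-1 *: (flat k (h *: 1 + 0) - flat k 0) @[h --> (0 : R)^'] --> (0 : R).
    apply/cvgrPdist_le => e e0; near=> h; rewrite /= sub0r normrN.
    rewrite {2}/flat ltxx subr0 addr0 [h *: 1]mulr1 /GRing.scale /=.
    have [h0|h0] := leP h 0; first by rewrite /flat ltNge h0 mulr0 normr0 ltW.
    (* The difference quotient at 0 is again a member of the family, so [flat_le] sends it to 0. *)
    have -> : h^-1 * flat k h = flat k.+1 h by rewrite /flat h0 mulrA -exprS.
    rewrite ger0_norm ?flat_ge0// (le_trans (flat_le _ _))//.
    rewrite -ler_pdivlMl ?ltr0n ?fact_gt0// ltW//.
    near: h; apply: dnbhs0_lt.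
    by rewrite mulr_gt0 ?invr_gt0 ?ltr0n ?fact_gt0.
  apply: DeriveDef; first by apply/cvg_ex; exists 0.
  rewrite /flat ltxx mulr0 subrr; exact/cvg_lim.
Unshelve. all: by end_near. Qed.

Lemma Dk_flat n k : Dk n (flat k).
Proof.
elim: n k => [|n IH] k; exists (fun x => flat k.+2 x - k%:R * flat k.+1 x) => //;
  try exact: flat_derive.
by apply: DkD => //; apply: DkN; apply: DkM => //; exact: Dk_cst.
Qed.

Definition step (x : R) : R := flat 0 x / (flat 0 x + flat 0 (1 - x)).

Lemma flat0_gt0 x : 0 < x -> 0 < flat 0 x.
Proof. by move=> x0; rewrite /flat x0 mul1r expR_gt0. Qed.

Lemma step_den_gt0 x : 0 < flat 0 x + flat 0 (1 - x).
Proof.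
have [x0|x0] := ltP 0 x; first by rewrite ltr_wpDr ?flat_ge0 ?flat0_gt0.
by rewrite ltr_wpDl ?flat_ge0 ?flat0_gt0// subr_gt0 (le_lt_trans x0).
Qed.

Lemma smooth1_step : smooth1 step.
Proof.
move=> n; apply: DkM; first exact: Dk_flat.
apply: DkV; first by move=> x; rewrite gt_eqF ?step_den_gt0.
apply: DkD; first exact: Dk_flat.
apply: (@Dk_comp n (flat 0) (fun x => 1 - x)); first exact: Dk_flat.
by apply: DkD; [exact: Dk_cst|apply: DkN; exact: Dk_id].
Qed.

Lemma step_in01 x : 0 <= step x <= 1.
Proof.
rewrite divr_ge0 ?flat_ge0 ?(ltW (step_den_gt0 _))//=.
by rewrite ler_pdivrMr ?step_den_gt0// mul1r lerDl flat_ge0.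
Qed.

Lemma step0 x : x <= 0 -> step x = 0.
Proof. by move=> x0; rewrite /step {1}/flat ltNge x0 /= mul0r. Qed.

Lemma step1 x : 1 <= x -> step x = 1.
Proof.
move=> x1; rewrite /step (_ : flat 0 (1 - x) = 0); last by rewrite /flat ltNge subr_le0 x1.
by rewrite addr0 divff// gt_eqF// flat0_gt0// (lt_le_trans ltr01).
Qed.

End Smooth1D.

Section ContinuousAlg.
Context {R : realType} {T : topologicalType}.
Implicit Types f g : T -> R.

Lemma contD f g : continuous f -> continuous g -> continuous (fun x => f x + g x).
Proof. by move=> cf cg x; apply: cvgD; [exact: cf|exact: cg]. Qed.

Lemma contM f g : continuous f -> continuous g -> continuous (fun x => f x * g x).
Proof. by move=> cf cg x; apply: cvgM; [exact: cf|exact: cg]. Qed.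

Lemma cont_comp (th : R -> R) f : continuous th -> continuous f ->
  continuous (fun x => th (f x)).
Proof. by move=> ct cf x; apply: continuous_comp; [exact: cf|exact: ct]. Qed.

End ContinuousAlg.

(** * Smooth functions of three variables, and potentials of the form [z th(|x|^2)] *)

Section Smooth3D.
Context {R : realType}.
Implicit Types (f g : pt R -> R) (x u : pt R) (k : 'I_3).

Definition ek k : pt R := delta_mx ord0 k.

Lemma comp_ek k j : (j < 3)%N -> comp (ek k) j = (j == k)%:R.
Proof. by move=> j3; rewrite /comp /ek mxE eqxx /= -val_eqE /= inordK. Qed.

(** Gives access to the one-variable chain rule for directional derivatives. *)
Lemma is_derive_line f x u d :
  is_derive (0 : R) (1 : R) (fun h => f (h *: u + x)) d <-> is_derive x u f d.
Proof.
have E : (fun h : R => h^-1 *: (f ((h *: 1 + 0) *: u + x) - f (0 *: u + x)))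
   = (fun h => h^-1 *: (f (h *: u + x) - f x)).
  by apply/funext => h; rewrite addr0 scale0r add0r [h *: 1]mulr1.
by split=> -[D1 D2]; split; move: D1 D2; rewrite /derivable /derive /= E.
Qed.

Lemma is_derive_comp1 (th : R -> R) f x u d d' :
  is_derive (f x) (1 : R) th d' -> is_derive x u f d ->
  is_derive x u (fun y => th (f y)) (d' * d).
Proof.
move=> Dt /is_derive_line Df; apply/is_derive_line.
apply: (@is_derive1_comp R th (fun h => f (h *: u + x))).
by rewrite /= scale0r add0r.
Qed.

Lemma is_derive_coord x u j : is_derive x u (fun y : pt R => comp y j) (comp u j).
Proof.
apply/is_derive_line; under eq_fun do rewrite compD compZ.
have : is_derive (0 : R) (1 : R) (fun h : R => h * comp u j + comp x j)
  (0 *: 0 + comp u j *: 1 + 0).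
  apply: is_deriveD; exact: is_deriveM.
by rewrite scale0r add0r addr0 [_ *: 1]mulr1.
Qed.

(** Continuity is part of every level because, in several variables, it does not follow from the
    existence of partial derivatives. *)
Fixpoint Ck (n : nat) f : Prop := continuous f /\
  exists2 f' : 'I_3 -> pt R -> R,
    (forall k x, is_derive x (ek k) f (f' k x)) &
    (if n is n'.+1 then forall k, Ck n' (f' k) else True).

Lemma Ck_cont n f : Ck n f -> continuous f.
Proof. by case: n => [|n] []. Qed.

Lemma CkW n f : Ck n.+1 f -> Ck n f.
Proof.
elim: n f => [|n IH] f [cf [f' df Df']]; split => //; exists f' => // k.
by apply: IH.
Qed.

Lemma Ck_smooth f : (forall n, Ck n f) -> smooth f.
Proof.
move=> Hf ks; have {Hf} := Hf (size ks).
(* [iterD] differentiates along the last index of the list first, whence an induction from the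
   right. *)
elim/last_ind: ks f => [|ks k IH] f.
  move=> [cf [f' df _]]; split => // k x; exact: (df k x).(ex_derive).
rewrite size_rcons /= => -[cf [f' df Df]].
have -> : iterD (rcons ks k) f = iterD ks (partial k f).
  by rewrite /iterD foldr_rcons.
apply: IH; have -> : partial k f = f' k; last exact: Df.
by apply/funext => x; exact: (@derive_val _ _ _ _ _ _ _ (df k x)).
Qed.

Lemma Ck_cst n (c : R) : Ck n (fun=> c).
Proof.
elim: n c => [|n IH] c; (split; first (exact: cst_continuous));
  exists (fun _ _ => 0) => //; by move=> k x; exact: is_derive_cst.
Qed.

Lemma Ck_coord n j : Ck n (fun x => comp x j).
Proof.
case: n => [|n]; (split; first exact: comp_continuous);
  exists (fun k _ => comp (ek k) j) => //; try (by move=> k x; exact: is_derive_coord).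
by move=> k; exact: Ck_cst.
Qed.

Lemma CkD n f g : Ck n f -> Ck n g -> Ck n (fun x => f x + g x).
Proof.
elim: n f g => [|n IH] f g [cf [f' df Df]] [cg [g' dg Dg]];
  (split; first exact: contD);
  exists (fun k x => f' k x + g' k x) => //; try (by move=> k x; exact: (is_deriveD (df k x) (dg k x))).
by move=> k; exact: IH (Df k) (Dg k).
Qed.

Lemma CkM n f g : Ck n f -> Ck n g -> Ck n (fun x => f x * g x).
Proof.
elim: n f g => [|n IH] f g Hf Hg;
  have [cf [f' df Df]] := Hf; have [cg [g' dg Dg]] := Hg;
  (split; first exact: contM);
  exists (fun k x => f x * g' k x + g x * f' k x) => //;
  try (by move=> k x; exact: (is_deriveM (df k x) (dg k x))).
by move=> k; apply: CkD; apply: IH; by [exact: CkW|exact: Df|exact: Dg].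
Qed.

Lemma Ck_comp n (th : R -> R) f : Dk n th -> Ck n f -> Ck n (fun x => th (f x)).
Proof.
have ct (t t' : R -> R) : (forall x : R, is_derive x (1 : R) t (t' x)) -> continuous t.
  move=> H x; have [D _] := H x.
  by apply: differentiable_continuous; exact/derivable1_diffP.
elim: n th f => [|n IH] th f Ht Hf;
  have [t' dt Dt] := Ht; have [cf [f' df Df]] := Hf;
  (split; first (apply: cont_comp => //; exact: (ct _ _ dt)));
  exists (fun k x => t' (f x) * f' k x) => //;
  try (by move=> k x; exact: (is_derive_comp1 (dt _) (df k x))).
by move=> k; apply: CkM; [apply: IH => //; exact: CkW|exact: Df].
Qed.

(** The gradient part of [B0] has a potential of this shape; a radial cutoff of it only changes
    [th]. *)
Definition zfun (th : R -> R) x : R := comp x 2 * th (dot x x).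

Lemma Ck_dot n : Ck n (fun x : pt R => dot x x).
Proof.
have -> : (fun x : pt R => dot x x) = (fun x => comp x 0 * comp x 0 + comp x 1 * comp x 1
  + comp x 2 * comp x 2) by apply/funext => x; rewrite dotE.
by do 2! (apply: CkD; last by apply: CkM; exact: Ck_coord); apply: CkM; exact: Ck_coord.
Qed.

Lemma smooth_zfun th : smooth1 th -> smooth (zfun th).
Proof.
move=> Ht; apply: Ck_smooth => n; apply: CkM; first exact: Ck_coord.
by apply: Ck_comp => //; exact: Ck_dot.
Qed.

Lemma continuous_dot : continuous (fun x : pt R => dot x x).
Proof. exact: Ck_cont (Ck_dot 0). Qed.

Definition vfield (th : R -> R) : field R := fun x =>
  th (dot x x) *: zhat + (2 * derive1 th (dot x x) * comp x 2) *: x.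

Lemma is_derive_dot x u : is_derive x u (fun y : pt R => dot y y) (2 * dot x u).
Proof.
have -> : (fun x : pt R => dot x x) = (fun x => comp x 0 * comp x 0 + comp x 1 * comp x 1
  + comp x 2 * comp x 2) by apply/funext => y; rewrite dotE.
have D j := is_derive_coord x u j.
have DM j := is_deriveM (D j) (D j).
have := is_deriveD (is_deriveD (DM 0%N) (DM 1%N)) (DM 2%N).
by congr is_derive; rewrite dotE /GRing.scale /=; ring.
Qed.

Lemma grad_zfun th : smooth1 th -> grad (zfun th) = vfield th.
Proof.
move=> Ht; apply/funext => x.
have [t' dt _] := Ht 0%N.
have D u : is_derive x u (zfun th)
    (comp x 2 *: (t' (dot x x) * (2 * dot x u)) + th (dot x x) *: comp u 2).
  exact: (is_deriveM (is_derive_coord x u 2)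
    (is_derive_comp1 (dt _) (is_derive_dot x u))).
have t'E : derive1 th (dot x x) = t' (dot x x).
  by rewrite derive1E; exact: (@derive_val _ _ _ _ _ _ _ (dt _)).
apply/rowP => k; rewrite mxE /partial (@derive_val _ _ _ _ _ _ _ (D _)) /GRing.scale /=.
rewrite (_ : vfield th x 0 k = comp (vfield th x) k); last first.
  by rewrite -comp_ord; congr (vfield th x _ _); exact: ord1.
rewrite !compL t'E -![delta_mx _ _]/(ek k) [dot x (ek k)]dotE !comp_ek//.
case: k => -[|[|[|//]]] k3 /=; rewrite !comp_vec3; ring.
Qed.

Lemma closure_sub_closed (A B : set (pt R)) : closed B -> A `<=` B -> closure A `<=` B.
Proof. by move=> cB /closureS H x /H; exact: cB. Qed.

Lemma closed_dot_le (S : R) : closed [set x : pt R | dot x x <= S].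
Proof.
have -> : [set x : pt R | dot x x <= S] = (fun x => dot x x) @^-1` [set s | s <= S] by [].
by apply: closed_comp; [move=> x _; exact: continuous_dot|exact: closed_le].
Qed.

Lemma compact_support_zfun th (S : R) : (forall s, S < s -> th s = 0) ->
  compact_support (zfun th).
Proof.
move=> tS; apply: bounded_closed_compact; last exact: closed_closure.
have sub : closure [set x | zfun th x != 0] `<=` [set x : pt R | dot x x <= S].
  apply: closure_sub_closed; first exact: closed_dot_le.
  move=> x /=; apply: contraNT; rewrite -ltNge => /tS; rewrite /zfun => ->.
  by rewrite mulr0.
exists (Num.sqrt S); split; first exact: num_real.
move=> M SM x /sub /= xS.
rewrite /Num.Def.normr/= mx_normrE.
apply: bigmax_le => [|[i j] _ /=]; first exact: le_trans (sqrtr_ge0 S) (ltW SM).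
rewrite ord1 comp_ord (le_trans (comp_le_enorm _ (ltn_ord j)))//.
by rewrite (le_trans _ (ltW SM))// /enorm ler_wsqrtr.
Qed.

End Smooth3D.

(** * Normal currents vanish on gradients of functions that are zero on the sphere *)

Section FiniteMass.
Context {R : realType}.
Variables (Rad : R) (T : current R).
Hypothesis fT : finite_mass_current Rad T.
Implicit Types B : field R.

Lemma cur_lin (a : R) B1 B2 : contw Rad B1 -> contw Rad B2 ->
  T (fun x => a *: B1 x + B2 x) = a * T B1 + T B2.
Proof. by case: fT => + _; apply. Qed.

Lemma curD B1 B2 : contw Rad B1 -> contw Rad B2 ->
  T (fun x => B1 x + B2 x) = T B1 + T B2.
Proof.
by move=> c1 c2; rewrite -[T B1]mul1r -cur_lin//; under eq_fun do rewrite -[B1 _]scale1r.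
Qed.

Lemma cur0 : T (fun=> 0) = 0.
Proof.
have := curD (@contw_cst R Rad 0) (@contw_cst R Rad 0).
under eq_fun do rewrite addr0.
by move=> /eqP; rewrite -subr_eq0 opprD addrA subrr sub0r oppr_eq0 => /eqP.
Qed.

Lemma curZ a B : contw Rad B -> T (fun x => a *: B x) = a * T B.
Proof.
move=> cB; rewrite -[RHS]addr0 -cur0 -cur_lin//; last exact: contw_cst.
by under [in RHS]eq_fun do rewrite addr0.
Qed.

Lemma curN B : contw Rad B -> T (fun x => - B x) = - T B.
Proof. by move=> cB; under eq_fun do rewrite -scaleN1r; rewrite curZ// mulN1r. Qed.

Lemma curB B1 B2 : contw Rad B1 -> contw Rad B2 ->
  T (fun x => B1 x - B2 x) = T B1 - T B2.
Proof. by move=> c1 c2; rewrite curD ?curN//; exact: contwN. Qed.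

Let unitB := [set B | contw Rad B /\ forall x, cball Rad x -> enorm (B x) <= 1].

Lemma mass_has_ub : has_ubound [set T B | B in unitB].
Proof.
have [_ [M HM]] := fT; exists M => _ [B [cB B1] <-].
by rewrite (le_trans (ler_norm _))// HM.
Qed.

Lemma le_mass1 B : contw Rad B -> (forall x, cball Rad x -> enorm (B x) <= 1) ->
  T B <= mass Rad T.
Proof. by move=> cB B1; apply: ub_le_sup; [exact: mass_has_ub|exists B]. Qed.

Lemma mass_ge0 : 0 <= mass Rad T.
Proof.
rewrite -cur0; apply: le_mass1; first exact: contw_cst.
by move=> x _; rewrite enorm0.
Qed.

Lemma le_mass B (c : R) : 0 <= c -> contw Rad B ->
  (forall x, cball Rad x -> enorm (B x) <= c) -> T B <= c * mass Rad T.
Proof.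
rewrite le_eqVlt => /predU1P[<-|c0] cB Bc.
  rewrite mul0r leNgt; apply/negP => TB.
  (* All multiples of a field that vanishes on the ball are admissible in the mass; the one chosen
     would have action [mass Rad T + 1]. *)
  have m0 := mass_ge0; have : (mass Rad T + 1) / T B * T B <= mass Rad T.
    rewrite -curZ//; apply: le_mass1.
      by apply: contwZ => //; exact: within_cst.
    move=> x xR; rewrite enormZ (_ : enorm (B x) = 0) ?mulr0//.
    by apply/eqP; rewrite eq_le Bc ?enorm_ge0.
  by rewrite divfK ?gt_eqF// gerDl lt_geF.
rewrite -ler_pdivrMl// -curZ//; apply: le_mass1.
  by apply: contwZ => //; exact: within_cst.
move=> x xR; rewrite enormZ gtr0_norm ?invr_gt0// ler_pdivrMl// mulr1; exact: Bc.
Qed.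

Lemma le_mass_norm B (c : R) : 0 <= c -> contw Rad B ->
  (forall x, cball Rad x -> enorm (B x) <= c) -> `|T B| <= c * mass Rad T.
Proof.
move=> c0 cB Bc; rewrite ler_norml le_mass// andbT lerNl -curN// le_mass//.
  exact: contwN.
by move=> x xR; rewrite enormN; exact: Bc.
Qed.

(** That a current only sees the ball is not part of its definition: it follows from [le_mass_norm]
    with the bound 0. *)
Lemma cur_ext B1 B2 : contw Rad B1 -> contw Rad B2 ->
  (forall x, cball Rad x -> B1 x = B2 x) -> T B1 = T B2.
Proof.
move=> c1 c2 e; apply/eqP; rewrite -subr_eq0 -curB// -normr_le0.
rewrite -(mul0r (mass Rad T)); apply: le_mass_norm => //.
  by apply: contwD => //; exact: contwN.
by move=> x xR; rewrite e// subrr enorm0.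
Qed.

End FiniteMass.

Section NormalGrad.
Context {R : realType}.
Variables (Rad : R) (T : current R).
Hypotheses (R0 : 0 < Rad) (nT : normal_currents Rad T).
Let fT : finite_mass_current Rad T := nT.1.

Lemma cball_dot (x : pt R) : cball Rad x -> dot x x <= Rad ^+ 2.
Proof.
by rewrite /cball /= -sqr_enorm => xR; apply: lerXn2r => //; rewrite nnegrE ?enorm_ge0// ltW.
Qed.

Lemma smooth1_derive1 (th : R -> R) : smooth1 th ->
  [/\ (forall s : R, is_derive s (1 : R) th (derive1 th s)) & smooth1 (derive1 th)].
Proof.
move=> H; have E (t' : R -> R) : (forall s : R, is_derive s (1 : R) th (t' s)) ->
    derive1 th = t'.
  by move=> D; apply/funext => s; rewrite derive1E; exact: (@derive_val _ _ _ _ _ _ _ (D s)).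
split; first by have [t' D _] := H 0%N; rewrite (E t' D).
by move=> n; have [t' D Dt] := H n.+1; rewrite (E t' D).
Qed.

Lemma smooth1_continuous (th : R -> R) : smooth1 th -> continuous th.
Proof.
move=> H s; have [D _] := smooth1_derive1 H; have [Ds _] := D s.
by apply: differentiable_continuous; exact/derivable1_diffP.
Qed.

Lemma within_dot (A : set (pt R)) : {within A, continuous (fun x : pt R => dot x x)}.
Proof. by apply: continuous_subspaceT; exact: continuous_dot. Qed.

Lemma contw_vfield (th : R -> R) : smooth1 th -> contw Rad (vfield th).
Proof.
move=> H; have [_ H'] := smooth1_derive1 H.
apply: contwD.
  apply: contwZ; last exact: contw_cst.
  by apply: within_comp1; [exact: smooth1_continuous|exact: within_dot].
apply: contwZ; last exact: contw_id.
apply: withinM; last exact: within_coord.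
apply: withinM; first exact: within_cst.
by apply: within_comp1; [exact: smooth1_continuous|exact: within_dot].
Qed.

Lemma cur_vfield_off_sphere (th : R -> R) (S d : R) : smooth1 th -> 0 < d ->
  (forall s, S < s -> th s = 0) -> (forall s, `|s - Rad ^+ 2| < d -> th s = 0) ->
  T (vfield th) = 0.
Proof.
move=> H d0 tS td; rewrite -grad_zfun//; apply: nT.2.2.
- exact: smooth_zfun.
- exact: compact_support_zfun tS.
apply/seteqP; split => // x [/= xc xs].
suff : [set x : pt R | d <= `|dot x x - Rad ^+ 2|] x.
  by rewrite /= -sqr_enorm (_ : enorm x = Rad)// subrr normr0 leNgt d0.
move: x xc {xs}; apply: closure_sub_closed.
  have -> : [set x : pt R | d <= `|dot x x - Rad ^+ 2|] =
     (fun x => `|dot x x - Rad ^+ 2|) @^-1` [set s | d <= s] by [].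
  apply: closed_comp; last exact: closed_ge.
  move=> x _.
  apply: (cont_comp (th := fun s => `|s - Rad ^+ 2|) _ continuous_dot).
  move=> s; apply: (@continuous_comp _ _ _ (fun s => s - Rad ^+ 2) Num.norm).
    by apply: cvgB; [exact: cvg_id|exact: cvg_cst].
  exact: norm_continuous.
move=> x /=; apply: contraNT; rewrite -ltNge => /td; rewrite /zfun => ->.
by rewrite mulr0.
Qed.

(** The bound on the boundary mass, made homogeneous by rescaling: only the sup norm of the
    potential matters, however large its gradient. *)
Lemma cur_vfield_small : exists2 C, 0 <= C &
  forall (th : R -> R) (S t : R), 0 < t -> smooth1 th ->
  (forall s, S < s -> th s = 0) -> (forall x, `|zfun th x| <= t) ->
  `|T (vfield th)| <= C * t.
Proof.
have [C HC] := nT.2.1; exists `|C| => // th S t t0 H tS tt.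
have H' : smooth1 (fun s => t^-1 * th s).
  by move=> n; apply: DkM; [exact: Dk_cst|exact: H].
have := HC (zfun (fun s => t^-1 * th s)) (smooth_zfun H').
rewrite grad_zfun// => /(_ _ _)/wrap[||].
- by apply: (@compact_support_zfun _ _ S) => s /tS ->; rewrite mulr0.
- move=> x; rewrite /zfun mulrCA normrM gtr0_norm ?invr_gt0//.
  by rewrite ler_pdivrMl// mulr1; exact: tt.
have -> : vfield (fun s => t^-1 * th s) = (fun x => t^-1 *: vfield th x).
  apply/funext => x; rewrite /vfield scalerDr !scalerA.
  congr (_ + _ *: _); rewrite !mulrA; congr (_ * _).
  have [D _] := smooth1_derive1 H.
  have D2 : is_derive (dot x x) (1 : R) (fun s => t^-1 * th s)
     (t^-1 *: derive1 th (dot x x) + th (dot x x) *: 0).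
    exact: (is_deriveM (is_derive_cst _ _ _) (D _)).
  rewrite derive1E (@derive_val _ _ _ _ _ _ _ D2) scaler0 addr0 /GRing.scale /=.
  by ring.
rewrite (curZ fT); last exact: contw_vfield.
rewrite normrM gtr0_norm ?invr_gt0// ler_pdivrMl// => /le_trans; apply.
by rewrite mulrC; apply: ler_wpM2r; [exact: ltW|exact: ler_norm].
Qed.

Lemma near_derive1 (f g : R -> R) (s : R) : (\near s, f s = g s) ->
  derive1 f s = derive1 g s.
Proof. by move=> fg; rewrite !derive1E; exact: (@near_eq_derive R R^o R^o). Qed.

(** [th] vanishes at [Rad ^+ 2] only, while the boundary condition wants a whole neighborhood. The
    function is split into a part that vanishes near the sphere, killed by the boundary condition,
    and a part carried by a thin shell. By continuity the latter has a small sup norm, which is all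
    that [cur_vfield_small] asks for. *)
Lemma normal_grad0 (th : R -> R) : smooth1 th -> th (Rad ^+ 2) = 0 ->
  T (vfield th) = 0.
Proof.
move=> H th0.
(* Outer cutoff: it leaves [th] unchanged up to [Rad ^+ 2 + 1] and gives the potential a compact
   support. *)
pose L s := step (Rad ^+ 2 + 2 - s).
have HL : smooth1 L.
  move=> n; apply: Dk_comp; first exact: smooth1_step.
  by apply: DkD; [exact: Dk_cst|apply: DkN; exact: Dk_id].
pose t1 s := th s * L s.
have H1 : smooth1 t1 by move=> n; apply: DkM.
have t1E s : s <= Rad ^+ 2 + 1 -> t1 s = th s.
  by move=> sR; rewrite /t1 /L step1 ?mulr1//; lra.
have t1S s : Rad ^+ 2 + 2 < s -> t1 s = 0.
  by move=> sR; rewrite /t1 /L step0 ?mulr0//; lra.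
have -> : T (vfield th) = T (vfield t1).
  apply: (cur_ext fT); [exact: contw_vfield|exact: contw_vfield|].
  move=> x /cball_dot xR; rewrite /vfield t1E; last by lra.
  suff -> : derive1 th (dot x x) = derive1 t1 (dot x x) by [].
  apply: near_derive1; near=> s; rewrite t1E//.
  apply: ltW; near: s; apply: lt_nbhsl; lra.
have [C C0 HC] := cur_vfield_small.
apply/eqP; rewrite -normr_le0; apply/ler_addgt0Pl => e e0; rewrite addr0.
pose t := e / (C + 1).
have t0 : 0 < t by rewrite divr_gt0// ltr_wpDl.
suff : `|T (vfield t1)| <= C * t.
  move=> /le_trans; apply; rewrite /t mulrCA ler_piMr ?(ltW e0)//.
  by rewrite ler_pdivrMr ?mul1r ?lerDl// ltr_wpDl.
(* The division by [Rad + 1] compensates the factor [z] of [zfun], which is at most [Rad + 1] in the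
   shell because [d <= 1]. *)
have [d d0 [d1 Hd]] : exists2 d, 0 < d & d <= 1 /\
   forall s, `|s - Rad ^+ 2| < d -> `|t1 s| <= t / (Rad + 1).
  have tR : 0 < t / (Rad + 1) by rewrite divr_gt0// ltr_wpDl// ltW.
  have := smooth1_continuous H1 (x := Rad ^+ 2).
  move=> /cvgrPdist_le /(_ _ tR) /nbhs_ballP[d /= d0 Hd].
  exists (Num.min d 1); first by rewrite lt_min d0 ltr01.
  split; first by rewrite ge_min lexx orbT.
  move=> s; rewrite lt_min => /andP[sd _].
  have := Hd s; rewrite /ball /= distrC => /(_ sd).
  by rewrite t1E ?th0 ?sub0r ?normrN// lerDl.
(* [q] is 0 within [d / 2] of [Rad ^+ 2] and 1 beyond [d]; squaring the distance keeps it smooth. *)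
pose q s := step (((s - Rad ^+ 2) * (2 / d)) ^+ 2 - 1).
have Hq : smooth1 q.
  move=> n; apply: (@Dk_comp R n step (fun s => ((s - Rad ^+ 2) * (2 / d)) ^+ 2 - 1)).
    exact: smooth1_step.
  apply: DkD; last exact: Dk_cst.
  by apply: DkM; (apply: DkM; last exact: Dk_cst); (apply: DkD; first exact: Dk_id);
    exact: Dk_cst.
pose tA s := t1 s * q s.
pose tB s := t1 s * (1 - q s).
have HA : smooth1 tA by move=> n; apply: DkM.
have HB : smooth1 tB.
  move=> n; apply: DkM; first exact: H1.
  by apply: DkD; [exact: Dk_cst|apply: DkN; exact: Hq].
have VE : vfield t1 = (fun x => vfield tA x + vfield tB x).
  have E : t1 = (fun s => tA s + tB s).
    by apply/funext => s; rewrite /tA /tB; ring.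
  have DE s : derive1 t1 s = derive1 tA s + derive1 tB s.
    have [DA _] := smooth1_derive1 HA; have [DB _] := smooth1_derive1 HB.
    have := is_deriveD (DA s) (DB s).
    by rewrite [LHS]derive1E E => D; exact: (@derive_val _ _ _ _ _ _ _ D).
  apply/funext => x; rewrite /vfield DE {1}E; apply: pt_eqP; rewrite !compL; ring.
have sq_lt s c : 0 < c -> `|s - Rad ^+ 2| < c / 2 * d -> ((s - Rad ^+ 2) * (2 / d)) ^+ 2 < c ^+ 2.
  move=> c0 sc; rewrite -(real_normK (num_real (_ * _))).
  have h : `|(s - Rad ^+ 2) * (2 / d)| < c.
    rewrite normrM (gtr0_norm (_ : 0 < 2 / d)) ?divr_gt0//.
    by rewrite mulrA ltr_pdivrMr// -ltr_pdivlMr// mulrAC.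
  by rewrite ltrXn2r.
rewrite VE (curD fT); [|exact: contw_vfield|exact: contw_vfield].
rewrite (@cur_vfield_off_sphere tA (Rad ^+ 2 + 2) (d / 2)) ?divr_gt0//; last 2 first.
- by move=> s /t1S; rewrite /tA => ->; rewrite mul0r.
- move=> s sd; rewrite /tA /q step0 ?mulr0// subr_le0; apply: ltW.
  by have := @sq_lt s 1 ltr01; rewrite expr1n; apply; rewrite div1r mulrC.
rewrite add0r; apply: (HC _ (Rad ^+ 2 + 2)) => //.
  by move=> s /t1S; rewrite /tB => ->; rewrite mul0r.
move=> x; rewrite /zfun /tB normrM.
have [xd|xd] := ltP `|dot x x - Rad ^+ 2| d; last first.
  rewrite (_ : 1 - q _ = 0) ?mulr0 ?normr0 ?mulr0 ?(ltW t0)//.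
  rewrite /q step1 ?subrr//.
  have h : 2 <= `|(dot x x - Rad ^+ 2) * (2 / d)|.
    by rewrite normrM (gtr0_norm (_ : 0 < 2 / d)) ?divr_gt0// mulrA ler_pdivlMr// mulrC ler_wpM2r.
  have : 2 ^+ 2 <= `|(dot x x - Rad ^+ 2) * (2 / d)| ^+ 2 by apply: lerXn2r; rewrite ?nnegrE.
  by rewrite real_normK ?num_real//; lra.
have xz : `|comp x 2| <= Rad + 1.
  rewrite (le_trans (comp_le_enorm x _))//; apply: ler_sqr_ge0; first by rewrite addr_ge0// ltW.
  rewrite sqr_enorm sqrrD; move: xd; rewrite ltr_norml => /andP[_].
  by have := R0; lra.
have q1 : `|1 - q (dot x x)| <= 1.
  by have /andP[qa qb] := step_in01 (((dot x x - Rad ^+ 2) * (2 / d)) ^+ 2 - 1);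
    rewrite ler_norml; apply/andP; split; rewrite /q; lra.
have tx := Hd _ xd.
rewrite normrM; apply: (@le_trans _ _ ((Rad + 1) * (t / (Rad + 1) * 1))).
  by apply: ler_pM => //; apply: ler_pM.
by rewrite mulr1 mulrC divfK// gt_eqF// addr_gt0.
Unshelve. all: by end_near. Qed.

End NormalGrad.

(** * The calibration *)

Section Calibration.
Context {R : realType}.
Variable Rad : R.
Hypothesis R0 : 0 < Rad.
Implicit Types (x : pt R) (s : R).

Lemma kappa_gt0 : 0 < kappa Rad.
Proof. by apply: divr_gt0; apply: mulr_gt0 => //; exact: sinh_gt0. Qed.

Definition Ucal s : R := kappa Rad * ps cU s.
Definition Mcal : R := Rad ^+ 2 * Ucal (Rad ^+ 2).
(** Read off the [zhat] component of [B0 = omcal + vfield Pcal]; the component along [x] is then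
    exactly [ps_ode]. *)
Definition Pcal s : R :=
  kappa Rad * ps cG (Rad ^+ 2) - Mcal - kappa Rad * ps cG s + s * Ucal s.
Definition wcal x : pt R := dot x x *: zhat - comp x 2 *: x.
Definition omcal x : pt R := Mcal *: zhat - Ucal (dot x x) *: wcal x.
Definition U0cal : R := kappa Rad * cU 0.
Definition Dcal : R := Ucal (Rad ^+ 2) * Rad.

Lemma Ucal_le s t : 0 <= s <= t -> Ucal s <= Ucal t.
Proof.
move=> st; apply: ler_wpM2l; first exact: ltW kappa_gt0.
apply: ps_ge0_le => //.
  exact: entire_cU.
by move=> k; exact: ltW (cU_gt0 k).
Qed.

Lemma U0cal_gt0 : 0 < U0cal.
Proof. by rewrite mulr_gt0 ?kappa_gt0 ?cU_gt0. Qed.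

Lemma U0cal_le s : 0 <= s -> U0cal <= Ucal s.
Proof.
move=> s0; have := @Ucal_le 0 s; rewrite lexx s0 => /(_ isT); apply: le_trans.
by rewrite /Ucal ps0//; exact: entire_cU.
Qed.

Lemma Ucal_gt0 s : 0 <= s -> 0 < Ucal s.
Proof. by move=> /U0cal_le; exact: lt_le_trans U0cal_gt0. Qed.

Lemma Mcal_gt0 : 0 < Mcal.
Proof. by rewrite mulr_gt0 ?exprn_gt0 ?Ucal_gt0 ?sqr_ge0. Qed.

Lemma Dcal_gt0 : 0 < Dcal.
Proof. by rewrite mulr_gt0 ?Ucal_gt0 ?sqr_ge0. Qed.

Lemma Pcal_sphere : Pcal (Rad ^+ 2) = 0.
Proof. by rewrite /Pcal /Mcal; ring. Qed.

Lemma smooth1_Pcal : smooth1 Pcal.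
Proof.
move=> n; apply: DkD.
  apply: DkD; first exact: Dk_cst.
  by apply: DkN; apply: DkM; [exact: Dk_cst|apply: Dk_ps; exact: entire_cG].
apply: DkM; first exact: Dk_id.
by apply: DkM; [exact: Dk_cst|apply: Dk_ps; exact: entire_cU].
Qed.

Lemma derive1_Pcal s : derive1 Pcal s = kappa Rad *
  (ps cU s + s * ps (pseries_diffs cU) s - ps (pseries_diffs cG) s).
Proof.
have DG := ps_is_derive s entire_cG; have DU := ps_is_derive s entire_cU.
have D : is_derive s (1 : R) Pcal
   (0 - (kappa Rad *: ps (pseries_diffs cG) s + ps cG s *: 0) +
   (s *: (kappa Rad *: ps (pseries_diffs cU) s + ps cU s *: 0) + (Ucal s) *: 1)).
  have C (c : R) := is_derive_cst c s (1 : R).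
  exact: (is_deriveD (is_deriveB (C _) (is_deriveM (C (kappa Rad)) DG))
    (is_deriveM (is_derive_id _ _) (is_deriveM (C (kappa Rad)) DU))).
rewrite derive1E (@derive_val _ _ _ _ _ _ _ D) /GRing.scale /= /Ucal; ring.
Qed.

Lemma B0_decomp : B0 Rad = (fun x => omcal x + vfield Pcal x).
Proof.
apply/funext => x; rewrite B0E// sqr_enorm /vfield derive1_Pcal /omcal /wcal.
have E : ps cH (dot x x) = 3 * ps cU (dot x x) +
   2 * (dot x x * ps (pseries_diffs cU) (dot x x)) - 2 * ps (pseries_diffs cG) (dot x x).
  by rewrite ps_ode; ring.
by rewrite E /Pcal /Ucal; apply: pt_eqP; rewrite !compL; ring.
Qed.

(** [wcal x] is [- cross x (cross x zhat)], of length [|x|] times the distance to the axis. *)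
Lemma dot_wcal x : dot (wcal x) (wcal x) = dot x x * rho2 x.
Proof.
rewrite /wcal !dotE !compL !comp_vec3 /rho2; ring.
Qed.

Lemma sqr_omcal x : dot (omcal x) (omcal x) =
  Mcal ^+ 2 - Ucal (dot x x) * rho2 x * (2 * Mcal - dot x x * Ucal (dot x x)).
Proof.
have -> : dot (omcal x) (omcal x) = Mcal ^+ 2 - 2 * Mcal * Ucal (dot x x) * rho2 x +
   Ucal (dot x x) ^+ 2 * dot (wcal x) (wcal x).
  by rewrite /omcal /wcal !dotE !compL !comp_vec3 /rho2; ring.
rewrite dot_wcal; ring.
Qed.

(** [s U(s)] is nondecreasing and [Mcal] is its value on the sphere. Hence the factor
    [2 Mcal - s U(s)] in [sqr_omcal] is at least [Mcal]. *)
Lemma dotUcal_le x : cball Rad x -> dot x x * Ucal (dot x x) <= Mcal.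
Proof.
move=> /(cball_dot R0) xR; rewrite /Mcal; apply: ler_pM => //.
- exact: dot_ge0.
- by rewrite ltW// Ucal_gt0// dot_ge0.
- by apply: Ucal_le; rewrite dot_ge0.
Qed.

Lemma sqr_omcal_le x : cball Rad x ->
  dot (omcal x) (omcal x) <= Mcal ^+ 2 - U0cal * Mcal * rho2 x.
Proof.
move=> xR; rewrite sqr_omcal lerD2l lerN2.
have h1 := dotUcal_le xR; have h2 := U0cal_le (dot_ge0 x).
have h3 := rho2_ge0 x; have h4 := Mcal_gt0; have h5 := U0cal_gt0.
rewrite -[leLHS]mulrA [Mcal * _]mulrC mulrA; apply: ler_pM.
- by rewrite mulr_ge0// ltW.
- exact: ltW.
- by rewrite ler_wpM2r.
- by lra.
Qed.

Lemma rho2_le x : cball Rad x -> rho2 x <= Rad ^+ 2.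
Proof.
move=> /(cball_dot R0); apply: le_trans; rewrite dotE /rho2 -!expr2 lerDl sqr_ge0//.
Qed.

Lemma enorm_omcal_le x : cball Rad x -> enorm (omcal x) <= Mcal - U0cal / 2 * rho2 x.
Proof.
move=> xR; have h1 := rho2_le xR; have h2 := U0cal_le (sqr_ge0 Rad).
have h3 := rho2_ge0 x; have h4 := U0cal_gt0.
have h : U0cal * rho2 x <= Mcal.
  by rewrite /Mcal mulrC; apply: ler_pM => //; exact: ltW.
apply: ler_sqr_ge0; first by have := Mcal_gt0; lra.
rewrite sqr_enorm (le_trans (sqr_omcal_le xR))//.
have := sqr_ge0 (U0cal / 2 * rho2 x); rewrite sqrrB; lra.
Qed.

Lemma enorm_omcal_leM x : cball Rad x -> enorm (omcal x) <= Mcal.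
Proof.
move=> /enorm_omcal_le /le_trans; apply; rewrite gerBl.
by rewrite mulr_ge0 ?rho2_ge0// divr_ge0// ltW// U0cal_gt0.
Qed.

Lemma enorm_Uw_le x : cball Rad x -> enorm (Ucal (dot x x) *: wcal x) <= Dcal * rho x.
Proof.
move=> xR; have xd := cball_dot R0 xR; have d0 := dot_ge0 x.
have U1 := Ucal_gt0 d0.
rewrite enormZ gtr0_norm// /Dcal -mulrA; apply: ler_pM; [exact: ltW|exact: enorm_ge0| |].
  by apply: Ucal_le; rewrite d0.
apply: ler_sqr_ge0; first by rewrite mulr_ge0 ?rho_ge0// ltW.
rewrite sqr_enorm dot_wcal exprMn sqr_rho.
by rewrite ler_wpM2r ?rho2_ge0.
Qed.

Lemma within_Ucal : {within cball Rad, continuous (fun x => Ucal (dot x x))}.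
Proof.
apply: withinM; first exact: within_cst.
by apply: within_comp1; [exact: ps_continuous entire_cU|exact: within_dot].
Qed.

Lemma contw_wcal : contw Rad wcal.
Proof.
apply: contwD.
  by apply: contwZ; [exact: within_dot|exact: contw_cst].
apply: contwN; apply: contwZ; [exact: within_coord|exact: contw_id].
Qed.

Lemma contw_Uw : contw Rad (fun x => Ucal (dot x x) *: wcal x).
Proof. by apply: contwZ; [exact: within_Ucal|exact: contw_wcal]. Qed.

Lemma contw_omcal : contw Rad omcal.
Proof. by apply: contwD; [exact: contw_cst|apply: contwN; exact: contw_Uw]. Qed.

Section Estimates.
Variable T : current R.
Hypothesis fT : finite_mass_current Rad T.
Hypothesis TP : T (vfield Pcal) = 0.
Let m := mass Rad T.

Lemma cur_B0 : T (B0 Rad) = T omcal.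
Proof.
rewrite B0_decomp (curD fT) ?TP ?addr0//; first exact: contw_omcal.
by apply: contw_vfield => //; exact: smooth1_Pcal.
Qed.

Lemma Rratio_le : Rratio Rad T <= Mcal.
Proof.
have m0 : 0 <= m := mass_ge0 fT; rewrite /Rratio -/m.
move: m0; rewrite le_eqVlt => /predU1P[m0|m0].
  by rewrite -m0 invr0 mulr0 ltW// Mcal_gt0.
rewrite ler_pdivrMr// cur_B0; apply: (le_mass fT) => //.
- exact: ltW Mcal_gt0.
- exact: contw_omcal.
- exact: enorm_omcal_leM.
Qed.

Variable eps : R.
Hypothesis Teps : T omcal = m * (Mcal - eps).

(* Testing the mass against [omcal + s *: eta] turns the deficit [eps] into a bound on [T eta]. *)
Lemma test_field (eta : field R) (s c : R) : 0 < s -> 0 <= Mcal + s * c ->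
  contw Rad eta -> (forall x, cball Rad x -> enorm (omcal x + s *: eta x) <= Mcal + s * c) ->
  T eta <= m * (eps / s + c).
Proof.
move=> s0 c0 ce H.
have cs : contw Rad (fun x => s *: eta x) by apply: contwZ => //; exact: within_cst.
have := @le_mass R Rad T fT (fun x => omcal x + s *: eta x) _ c0
  (contwD contw_omcal cs) H.
rewrite (curD fT contw_omcal cs) (curZ fT)// Teps -/m => h.
have : s * T eta <= m * (eps + s * c) by lra.
rewrite -ler_pdivlMl// => /le_trans; apply.
rewrite (_ : s^-1 * _ = m * (eps / s + c))//.
by field; rewrite gt_eqF.
Qed.

(** Completing the square: the gain [U0cal / 2 * rho ^+ 2] of [enorm_omcal_le] pays for
    [s * K * rho] up to [s^2 K^2 / (2 U0cal)]. The additive [del] leaves room for fields that are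
    continuous but not Lipschitz. *)
Lemma test_radial (eta : field R) (s del K : R) : 0 < s -> 0 <= del -> 0 <= K ->
  contw Rad eta -> (forall x, cball Rad x -> enorm (eta x) <= del + K * rho x) ->
  T eta <= m * (eps / s + (del + s * (K ^+ 2 / (2 * U0cal)))).
Proof.
move=> s0 d0 K0 ce H; have u0 := U0cal_gt0; have M0 := Mcal_gt0.
have a0 : 0 <= s * (K ^+ 2 / (2 * U0cal)).
  by apply: mulr_ge0; [exact: ltW|apply: divr_ge0; [exact: sqr_ge0|apply: mulr_ge0 => //; exact: ltW]].
apply: test_field => //; first by rewrite addr_ge0 ?(ltW M0)// mulr_ge0 ?(ltW s0)// addr_ge0.
move=> x xR; rewrite (le_trans (enormD _ _))// enormZ gtr0_norm//.
have h1 := enorm_omcal_le xR.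
have h2 : s * enorm (eta x) <= s * (del + K * rho x) by rewrite ler_wpM2l ?(ltW s0) ?H.
apply: le_trans (lerD h1 h2) _; rewrite -sqr_rho.
rewrite -subr_ge0.
have -> : Mcal + s * (del + s * (K ^+ 2 / (2 * U0cal))) -
  (Mcal - U0cal / 2 * rho x ^+ 2 + s * (del + K * rho x)) =
  (U0cal * rho x - s * K) ^+ 2 / (2 * U0cal) by field; rewrite gt_eqF.
by rewrite divr_ge0 ?sqr_ge0// mulr_ge0// ltW.
Qed.

(** In [2 * Mcal * Ecal], the summand 1 pays for the squared norm of [s *: eta] in
    [test_horizontal], and the other summand is what remains of the cross term after completing the
    square. *)
Definition Ecal : R := (1 + Dcal ^+ 2 / (U0cal * Mcal)) / (2 * Mcal).

Lemma Ecal_gt0 : 0 < Ecal.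
Proof.
have u0 := U0cal_gt0; have M0 := Mcal_gt0.
apply: divr_gt0; last exact: mulr_gt0.
apply: ltr_pwDl => //; apply: divr_ge0; first exact: sqr_ge0.
by apply: mulr_ge0; exact: ltW.
Qed.

(** A horizontal [eta] is orthogonal to [Mcal *: zhat], so its cross term involves only
    [Ucal *: wcal]. That field is of order [rho], and the gain in [sqr_omcal_le] absorbs the
    product. *)
Lemma test_horizontal (eta : field R) (s N0 : R) : 0 < s -> 0 <= N0 ->
  contw Rad eta -> (forall x, cball Rad x -> enorm (eta x) <= N0) ->
  (forall x, cball Rad x -> comp (eta x) 2 = 0) ->
  T eta <= m * (eps / s + s * (N0 ^+ 2 * Ecal)).
Proof.
move=> s0 N00 ce H Hz; have u0 := U0cal_gt0; have M0 := Mcal_gt0.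
have E0 := Ecal_gt0.
have b0 : 0 <= Mcal + s * (s * (N0 ^+ 2 * Ecal)).
  have e2 : 0 <= N0 ^+ 2 * Ecal by rewrite mulr_ge0 ?sqr_ge0 ?ltW.
  by rewrite addr_ge0 ?(ltW M0)// mulr_ge0 ?(ltW s0)// mulr_ge0// ltW.
apply: test_field => // x xR; apply: ler_sqr_ge0 => //.
have h1 := sqr_omcal_le xR; have h2 := enorm_Uw_le xR; have r0 := rho_ge0 x.
have e1 := H x xR; have e0 := enorm_ge0 (eta x).
pose u := Ucal (dot x x) *: wcal x.
have E1 : dot (omcal x + s *: eta x) (omcal x + s *: eta x) =
  dot (omcal x) (omcal x) + 2 * s * dot (- u) (eta x) + s ^+ 2 * enorm (eta x) ^+ 2.
  rewrite sqr_enorm /omcal -/u !dotE !compL !comp_vec3 (Hz x xR); ring.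
have E2 : dot (- u) (eta x) <= Dcal * rho x * N0.
  rewrite (le_trans (cauchy_schwarz _ _))// enormN; apply: ler_pM => //; exact: enorm_ge0.
have E3 : enorm (eta x) ^+ 2 <= N0 ^+ 2 by apply: lerXn2r; rewrite ?nnegrE.
rewrite sqr_enorm E1.
have F2 : 2 * s * dot (- u) (eta x) <= 2 * s * (Dcal * rho x * N0).
  by rewrite ler_wpM2l// mulr_ge0// ltW.
have F3 : s ^+ 2 * enorm (eta x) ^+ 2 <= s ^+ 2 * N0 ^+ 2 by rewrite ler_wpM2l// sqr_ge0.
apply: le_trans (lerD (lerD h1 F2) F3) _.
have sq : 0 <= (s * (s * (N0 ^+ 2 * Ecal))) ^+ 2 by exact: sqr_ge0.
rewrite sqrrD -subr_ge0 -sqr_rho.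
have -> : Mcal ^+ 2 + Mcal * (s * (s * (N0 ^+ 2 * Ecal))) *+ 2 + (s * (s * (N0 ^+ 2 * Ecal))) ^+ 2 -
 (Mcal ^+ 2 - U0cal * Mcal * rho x ^+ 2 + 2 * s * (Dcal * rho x * N0) + s ^+ 2 * N0 ^+ 2)
 = (U0cal * Mcal * rho x - s * Dcal * N0) ^+ 2 / (U0cal * Mcal)
   + (s * (s * (N0 ^+ 2 * Ecal))) ^+ 2.
  rewrite /Ecal; field; by rewrite !gt_eqF.
rewrite addr_ge0// divr_ge0 ?sqr_ge0// mulr_ge0// ltW//.
Qed.

End Estimates.
End Calibration.

(** * Gradients along a curve *)

Section GradAlong.
Context {R : realType}.
Notation mu := (@lebesgue_measure R).

Lemma derive_bound_lipschitz (th th' : R -> R) (K C : R) :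
  (forall x : R, `|x| < K -> is_derive x (1 : R) th (th' x)) ->
  (forall x, `|x| < K -> `|th' x| <= C) ->
  forall a b, `|a| < K -> `|b| < K -> `|th a - th b| <= C * `|a - b|.
Proof.
move=> D B a b; wlog ab : a b / a <= b.
  move=> H aK bK; have [ab|/ltW ba] := leP a b; first exact: H.
  by rewrite distrC (distrC a); exact: H.
move=> aK bK.
have in_K x : x \in `[a, b] -> `|x| < K.
  rewrite in_itv /= => /andP[ax xb]; move: aK bK; rewrite !ltr_norml => /andP[? ?] /andP[? ?].
  by apply/andP; split; lra.
have [||c cab E] := @MVT_segment R th th' a b ab.
- by move=> x xab; apply: D; apply: in_K; apply: subset_itv_oo_cc xab.
- apply: continuous_in_subspaceT => x; rewrite inE => /in_K /D[Dx _].
  by apply: differentiable_continuous; exact/derivable1_diffP.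
by rewrite distrC E normrM (distrC a) ler_wpM2r// B// in_K.
Qed.

Lemma continuous_bounded (f : R -> R) (K : R) : continuous f ->
  exists C, forall x, `|x| < K -> `|f x| <= C.
Proof.
move=> cf.
have cf' : {within `[- K, K], continuous f} by exact: continuous_subspaceT.
have := @continuous_compact _ _ _ _ cf' (@segment_compact R (- K) K).
move=> /compact_bounded [M [_ HM]]; exists (M + 1) => x.
rewrite ltr_norml => /andP[x1 x2]; apply: (HM (M + 1)); first by rewrite ltrDl.
by exists x => //=; rewrite in_itv /= !ltW.
Qed.

Lemma antiderivative (b : R -> R) (K : R) : continuous b ->
  exists H : R -> R, forall x : R, `|x| < K -> is_derive x (1 : R) H (b x).
Proof.
move=> cb; exists (fun x => \int[mu]_(t in `[- K, x]) b t) => x.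
rewrite ltr_norml => /andP[x1 x2].
have I : mu.-integrable `[- K, K] (EFin \o b).
  apply: continuous_compact_integrable; first exact: segment_compact.
  exact: continuous_subspaceT.
have [D1 D2] := @continuous_FTC1_closed R b (- K) x K x2 I x1 (cb x).
by apply: DeriveDef; [exact: D1|rewrite -derive1E; exact: D2].
Qed.

Variables (Rad : R) (g : R -> pt R).
Hypotheses (lg : lipschitz01 g) (bg : forall t, t \in `[0, 1] -> cball Rad (g t)).
Implicit Types (f : pt R -> R) (V : field R).

(** The hypotheses of [curve_ftc], packaged as a calculus of gradients along one curve: it is stable
    under sums, products and composition, starting from the coordinates. *)
Definition grad_along f V : Prop :=
  (exists L, forall s t, 0 <= s <= 1 -> 0 <= t <= 1 -> `|f (g s) - f (g t)| <= L * `|s - t|) /\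
  (forall (t : R) (v : nat -> R -> R), 0 < t < 1 ->
    (forall k, (k < 3)%N -> is_derive t (1 : R) (fun s => comp (g s) k) (v k t)) ->
    is_derive t (1 : R) (f \o g) (vdot v (V (g t)) t)).

Lemma grad_along_ftc f V : grad_along f V -> curve_current g V = f (g 1) - f (g 0).
Proof. by move=> [[L hL] D]; exact: (curve_ftc lg hL D). Qed.

Lemma grad_along_coord k : (k < 3)%N ->
  grad_along (fun x => comp x k) (fun=> ek (inord k)).
Proof.
move=> k3; split.
  have [L hL] := lg; exists L => s t hs ht; rewrite -compB.
  by rewrite (le_trans (comp_le_enorm _ k3))// hL// in_itv.
move=> t v _ H; have := H k k3; congr is_derive.
rewrite /vdot !comp_ek// inordK//; case: k {H} k3 => [|[|[|//]]] _ /=; ring.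
Qed.

Lemma grad_along_bound f V : grad_along f V ->
  exists2 C, 0 <= C & forall t, 0 <= t <= 1 -> `|f (g t)| <= C.
Proof.
move=> [[L hL] _]; exists (`|f (g 0)| + `|L|); first by rewrite addr_ge0.
move=> t t01; have := hL t 0 t01; rewrite lexx ler01 => /(_ isT) h.
rewrite -[f (g t)](subrK (f (g 0))) addrC (le_trans (ler_normD _ _))// lerD2l.
rewrite (le_trans h)// subr0 (le_trans (ler_norm _))// normrM normr_id.
by case/andP: t01 => t0 t1; rewrite ler_piMr// ger0_norm.
Qed.

Lemma grad_alongM f1 f2 V1 V2 : grad_along f1 V1 -> grad_along f2 V2 ->
  grad_along (fun x => f1 x * f2 x) (fun x => f1 x *: V2 x + f2 x *: V1 x).
Proof.
move=> H1 H2; have [C1 C10 B1] := grad_along_bound H1.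
have [C2 C20 B2] := grad_along_bound H2.
have [[L1 h1] D1] := H1; have [[L2 h2] D2] := H2; split.
  exists (C1 * `|L2| + C2 * `|L1|) => s t hs ht.
  have -> : f1 (g s) * f2 (g s) - f1 (g t) * f2 (g t) =
    f1 (g s) * (f2 (g s) - f2 (g t)) + f2 (g t) * (f1 (g s) - f1 (g t)) by ring.
  have nn (L : R) : L * `|s - t| <= `|L| * `|s - t| by rewrite ler_wpM2r// ler_norm.
  rewrite (le_trans (ler_normD _ _))// mulrDl !normrM -!mulrA; apply: lerD.
    by apply: ler_pM => //; [exact: B1|exact: le_trans (h2 _ _ hs ht) (nn _)].
  by apply: ler_pM => //; [exact: B2|exact: le_trans (h1 _ _ hs ht) (nn _)].
move=> t v t01 H; have := is_deriveM (D1 t v t01 H) (D2 t v t01 H).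
by congr is_derive; rewrite /vdot !compL /GRing.scale /=; ring.
Qed.

Lemma grad_alongD f1 f2 V1 V2 : grad_along f1 V1 -> grad_along f2 V2 ->
  grad_along (fun x => f1 x + f2 x) (fun x => V1 x + V2 x).
Proof.
move=> [[L1 h1] D1] [[L2 h2] D2]; split.
  exists (L1 + L2) => s t hs ht; rewrite opprD addrACA (le_trans (ler_normD _ _))//.
  by rewrite mulrDl lerD ?h1 ?h2.
move=> t v t01 H; have := is_deriveD (D1 t v t01 H) (D2 t v t01 H).
by congr is_derive; rewrite /vdot !compL /GRing.scale /=; ring.
Qed.

Lemma grad_along_comp (th th' : R -> R) (K C : R) f V : 0 <= C ->
  (forall x : R, `|x| < K -> is_derive x (1 : R) th (th' x)) ->
  (forall x, `|x| < K -> `|th' x| <= C) ->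
  (forall t, 0 <= t <= 1 -> `|f (g t)| < K) ->
  grad_along f V -> grad_along (fun x => th (f x)) (fun x => th' (f x) *: V x).
Proof.
move=> C0 Dt Bt fK [[L h] D]; split.
  exists (C * L) => s t hs ht.
  rewrite (le_trans (derive_bound_lipschitz Dt Bt (fK s hs) (fK t ht)))//.
  by rewrite -mulrA ler_wpM2l// h.
move=> t v t01 H; have t01' : 0 <= t <= 1 by case/andP: t01 => ? ?; rewrite !ltW.
have := @is_derive1_comp R th (f \o g) t _ _ (Dt _ (fK t t01')) (D t v t01 H).
by congr is_derive; rewrite /vdot !compL /=; ring.
Qed.

Lemma curve_zhat : curve_current g (fun=> zhat) = comp (g 1) 2 - comp (g 0) 2.
Proof.
have -> : zhat = ek (inord 2) :> pt R by apply: pt_eqP; rewrite comp_vec3 comp_ek// inordK.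
exact: (grad_along_ftc (grad_along_coord _)).
Qed.

Let G0 := grad_along_coord (isT : (0 < 3)%N).
Let G1 := grad_along_coord (isT : (1 < 3)%N).
Let G2 := grad_along_coord (isT : (2 < 3)%N).

Let Grho2 := grad_alongD (grad_alongM G0 G0) (grad_alongM G1 G1).

Lemma curve_rho2 : curve_current g (fun x => vec3 (2 * comp x 0) (2 * comp x 1) 0) =
  rho2 (g 1) - rho2 (g 0).
Proof.
have := grad_along_ftc Grho2; rewrite /rho2 !expr2 => <-; congr curve_current.
apply/funext => x; apply: pt_eqP; rewrite !compL !comp_vec3 !comp_ek// !inordK//=; ring.
Qed.

Lemma curve_rho2z : curve_current g
   (fun x => vec3 (2 * comp x 2 * comp x 0) (2 * comp x 2 * comp x 1) (rho2 x)) =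
  rho2 (g 1) * comp (g 1) 2 - rho2 (g 0) * comp (g 0) 2.
Proof.
have := grad_along_ftc (grad_alongM Grho2 G2); rewrite /rho2 !expr2 => <-.
congr curve_current; apply/funext => x; apply: pt_eqP;
  rewrite !compL !comp_vec3 !comp_ek// !inordK//= /rho2; ring.
Qed.

Let Gdot := grad_alongD Grho2 (grad_alongM G2 G2).

Lemma curve_vfield (th : R -> R) : smooth1 th ->
  curve_current g (vfield th) = zfun th (g 1) - zfun th (g 0).
Proof.
move=> H; have [D H'] := smooth1_derive1 H.
have [K K0 fK] := grad_along_bound Gdot.
have [C HC] := continuous_bounded (K + 1) (smooth1_continuous H').
have HC' x : `|x| < K + 1 -> `|derive1 th x| <= `|C|.
  by move=> /HC /le_trans; apply; exact: ler_norm.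
have fK' t : 0 <= t <= 1 -> `|comp (g t) 0 * comp (g t) 0 + comp (g t) 1 * comp (g t) 1
   + comp (g t) 2 * comp (g t) 2| < K + 1.
  by move=> /fK /le_lt_trans; apply; rewrite ltrDl.
have := grad_along_ftc (grad_alongM G2
  (grad_along_comp (normr_ge0 C) (fun x _ => D x) HC' fK' Gdot)).
rewrite /zfun !dotE => <-; congr curve_current; apply/funext => x.
by apply: pt_eqP; rewrite /vfield !compL !comp_vec3 !comp_ek// !inordK//= !dotE; ring.
Qed.

Lemma curve_height (b H : R -> R) (N0 : R) :
  (forall x : R, `|x| < Rad + 1 -> is_derive x (1 : R) H (b x)) ->
  (forall z, `|b z| <= N0) ->
  curve_current g (fun x => b (comp x 2) *: zhat) = H (comp (g 1) 2) - H (comp (g 0) 2).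
Proof.
move=> D B; have N00 : 0 <= N0 by apply: le_trans (B 0).
have fK t : 0 <= t <= 1 -> `|comp (g t) 2| < Rad + 1.
  move=> t01; have := bg (_ : t \in `[0, 1]); rewrite in_itv /= => /(_ t01).
  by rewrite /cball /= => h; rewrite (le_lt_trans (comp_le_enorm _ _))// (le_lt_trans h)// ltrDl.
rewrite -(grad_along_ftc (grad_along_comp N00 D (fun x _ => B x) fK G2)).
congr curve_current; apply/funext => x; congr (_ *: _).
by apply: pt_eqP; rewrite comp_vec3 comp_ek// inordK.
Qed.

End GradAlong.

(** * The vertical diameter *)

Section Diameter.
Context {R : realType}.
Notation mu := (@lebesgue_measure R).
Variable Rad : R.
Hypothesis R0 : 0 < Rad.
Implicit Types B : field R.

Definition g0 (t : R) : pt R := vec3 0 0 (Rad * (2 * t - 1)).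

Lemma enorm_axis (z : R) : enorm (vec3 0 0 z) = `|z|.
Proof. by have := enorm_pi3 (vec3 0 0 z); rewrite /pi3 comp_vec3. Qed.

Lemma lipschitz_g0 : lipschitz01 g0.
Proof.
exists (2 * Rad) => s t _ _.
have -> : g0 s - g0 t = vec3 0 0 (2 * Rad * (s - t)).
  by apply: pt_eqP; rewrite !compL !comp_vec3; ring.
by rewrite enorm_axis normrM ger0_norm// mulr_ge0// ltW.
Qed.

Lemma g0_cball t : t \in `[0, 1] -> cball Rad (g0 t).
Proof.
rewrite in_itv /= => /andP[t0 t1]; rewrite /cball /= enorm_axis normrM gtr0_norm//.
by rewrite ler_piMr ?(ltW R0)// ler_norml; apply/andP; split; lra.
Qed.

Lemma simple_arc_g0 : simple_arc Rad g0.
Proof.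
split; first exact: lipschitz_g0.
split; first exact: g0_cball.
split; first by rewrite /sphere /= enorm_axis mulr0 sub0r mulrN1 normrN gtr0_norm.
split.
  rewrite /sphere /= enorm_axis (_ : 2 * 1 - 1 = 1 :> R) ?mulr1 ?gtr0_norm//; ring.
move=> s t _ _ /(congr1 (fun x => comp x 2)); rewrite !comp_vec3.
by move=> /(mulfI (lt0r_neq0 R0)) h; lra.
Qed.

Definition v0 (k : nat) (t : R) : R := if k == 2 then 2 * Rad else 0.

Lemma is_derive_g0 (t : R) k : (k < 3)%N ->
  is_derive t (1 : R) (fun s => comp (g0 s) k) (v0 k t).
Proof.
have C (c : R) := is_derive_cst c t (1 : R).
case: k => [|[|[|//]]] _; rewrite /v0 /=.
- by under eq_fun do rewrite comp_vec3; exact: C.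
- by under eq_fun do rewrite comp_vec3; exact: C.
under eq_fun do rewrite comp_vec3.
have := is_deriveM (C Rad) (is_deriveB (is_deriveM (C 2) (is_derive_id t (1 : R))) (C 1)).
by congr is_derive; rewrite /GRing.scale /=; ring.
Qed.

Lemma velocity_g0 : velocity g0 v0.
Proof.
split; first by move=> k _; exact: integrable01_cst.
by apply: aeW => t _ k k3; exact: is_derive_g0.
Qed.

Lemma Gamma0E B : Gamma0 Rad B = \int[mu]_(t in `[0, 1]) (comp (B (g0 t)) 2 * (2 * Rad)).
Proof.
rewrite /Gamma0 (curve_currentE _ velocity_g0); apply: eq_Rintegral => t _.
by rewrite /vdot /v0 /= !mulr0 !add0r.
Qed.

Lemma Gamma0_axis B1 B2 : (forall z, `|z| <= Rad ->
  comp (B1 (vec3 0 0 z)) 2 = comp (B2 (vec3 0 0 z)) 2) -> Gamma0 Rad B1 = Gamma0 Rad B2.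
Proof.
move=> H; rewrite !Gamma0E; apply: eq_Rintegral => t t01; rewrite H//.
by have := g0_cball (_ : t \in `[0, 1]); rewrite /cball /= enorm_axis; apply; move: t01; rewrite inE.
Qed.

Lemma Gamma0_finite_mass : finite_mass_current Rad (Gamma0 Rad).
Proof. exact: (curve_finite_mass lipschitz_g0 g0_cball velocity_g0). Qed.

Lemma Gamma0_vfield (th : R -> R) : smooth1 th -> th (Rad ^+ 2) = 0 ->
  Gamma0 Rad (vfield th) = 0.
Proof.
move=> H th0; rewrite /Gamma0 (curve_vfield lipschitz_g0 H) /zfun !dotE !comp_vec3.
have E1 : 0 * 0 + 0 * 0 + Rad * (2 * 1 - 1) * (Rad * (2 * 1 - 1)) = Rad ^+ 2 by ring.
have E0 : 0 * 0 + 0 * 0 + Rad * (2 * 0 - 1) * (Rad * (2 * 0 - 1)) = Rad ^+ 2 by ring.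
by rewrite E1 E0 th0 !mulr0 subrr.
Qed.

Lemma Gamma0_zhat : Gamma0 Rad (fun=> zhat) = 2 * Rad.
Proof. by rewrite /Gamma0 (curve_zhat lipschitz_g0) !comp_vec3; ring. Qed.

Lemma mass_Gamma0 : mass Rad (Gamma0 Rad) = 2 * Rad.
Proof.
apply/eqP; rewrite eq_le; apply/andP; split; last first.
  rewrite -Gamma0_zhat; apply: (le_mass1 Gamma0_finite_mass); first exact: contw_cst.
  by move=> x _; rewrite enorm_zhat.
apply: ge_sup; first by exists (Gamma0 Rad (fun=> zhat)), (fun=> zhat) => //; split;
  [exact: contw_cst|move=> x _; rewrite enorm_zhat].
move=> _ [B [cB B1] <-]; rewrite Gamma0E.
have c2 : 2 * Rad = \int[mu]_(t in `[0, 1]) (cst (2 * Rad) t).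
  have := Gamma0_zhat; rewrite Gamma0E => {1}<-; apply: eq_Rintegral => t _.
  by rewrite comp_vec3 mul1r.
rewrite [leRHS]c2; apply: le_Rintegral => //; last first.
- move=> t t01; rewrite ler_piMl ?mulr_ge0 ?(ltW R0)//.
  rewrite (le_trans (ler_norm _))// (le_trans (comp_le_enorm _ _))//.
  by apply: B1; exact: g0_cball.
- exact: integrable01_cst.
have := vdot_integrable lipschitz_g0 g0_cball velocity_g0 cB.
by congr (integrable mu _ _); apply/funext => t; rewrite /= /vdot /v0 /= !mulr0 !add0r.
Qed.

Lemma Rratio_Gamma0 : Rratio Rad (Gamma0 Rad) = Mcal Rad.
Proof.
rewrite /Rratio mass_Gamma0 (cur_B0 R0 Gamma0_finite_mass); last first.
  by apply: Gamma0_vfield; [exact: smooth1_Pcal|exact: Pcal_sphere].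
rewrite (@Gamma0_axis _ (fun=> Mcal Rad *: zhat)).
  rewrite (curZ Gamma0_finite_mass) ?Gamma0_zhat; last exact: contw_cst.
  by rewrite mulfK// gt_eqF// mulr_gt0.
move=> z _; rewrite /omcal /wcal !compL dotE !comp_vec3; ring.
Qed.

(** The diameter follows a coordinate direction, so a single partial derivative is enough and no
    multivariable chain rule is invoked. *)
Lemma Gamma0_grad (f : pt R -> R) : smooth f ->
  Gamma0 Rad (grad f) = f (g0 1) - f (g0 0).
Proof.
move=> sf; pose k2 : 'I_3 := inord 2.
have ek2 : ek k2 = zhat :> pt R.
  by apply: pt_eqP; rewrite comp_vec3 comp_ek// inordK.
have D t : is_derive t (1 : R) (f \o g0) (partial k2 f (g0 t) * (2 * Rad)).
  have [_ /(_ k2 (g0 t)) Dt] := sf [::].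
  have D1 : is_derive (g0 t) (ek k2) f (partial k2 f (g0 t)) by apply: DeriveDef.
  have D2 : is_derive t (1 : R) (fun s : R => 2 * Rad * (s - t)) (2 * Rad).
    have C (c : R) := is_derive_cst c t (1 : R).
    have := is_deriveM (C (2 * Rad)) (is_deriveB (is_derive_id t (1 : R)) (C t)).
    by congr is_derive; rewrite /GRing.scale /=; ring.
  move/is_derive_line: D1 => D1.
  have E : f \o g0 = (fun h => f (h *: ek k2 + g0 t)) \o (fun s : R => 2 * Rad * (s - t)).
    apply/funext => s /=; congr f; apply: pt_eqP; rewrite ek2 !compL !comp_vec3; ring.
  rewrite E; apply: is_derive1_comp => //.
  by rewrite subrr mulr0.
have cg0 : continuous g0.
  move=> t; apply: cvg_pt => k k3; have [Dk _] := is_derive_g0 t k3.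
  by apply: (@differentiable_continuous R R^o R^o); exact/derivable1_diffP.
have cD : continuous (fun t => partial k2 f (g0 t) * (2 * Rad)).
  apply: contM; last exact: cst_continuous.
  move=> t; apply: (continuous_comp (cg0 t)).
  by have [+ _] := sf [:: k2]; apply.
have [C HC] := continuous_bounded 2 cD.
have HL s t : 0 <= s <= 1 -> 0 <= t <= 1 -> `|f (g0 s) - f (g0 t)| <= C * `|s - t|.
  have h (u : R) : 0 <= u <= 1 -> `|u| < 2.
    by move=> /andP[u0 u1]; rewrite ger0_norm//; lra.
  by move=> /h hs /h ht; exact: (derive_bound_lipschitz (fun x _ => D x) HC).
apply: (curve_ftc lipschitz_g0 HL) => t v _ Hv; have := D t; congr is_derive.
have E k : (k < 3)%N -> v k t = v0 k t.
  move=> k3; have d1 := Hv k k3; have d2 := is_derive_g0 t k3.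
  by rewrite -(@derive_val _ _ _ _ _ _ _ d1) (@derive_val _ _ _ _ _ _ _ d2).
rewrite /vdot !E// /v0 /= !mulr0 !add0r; congr (_ * _).
by rewrite /comp mxE.
Qed.

Lemma g0_sphere : sphere Rad (g0 0) /\ sphere Rad (g0 1).
Proof. by have [_ [_ [h0 [h1 _]]]] := simple_arc_g0. Qed.

Lemma Gamma0_normal : normal_currents Rad (Gamma0 Rad).
Proof.
split; first exact: Gamma0_finite_mass.
split.
  exists 2 => f sf _ f1; rewrite Gamma0_grad//.
  have := f1 (g0 1); have := f1 (g0 0); rewrite !ler_norml => /andP[? ?] /andP[? ?].
  by apply/andP; split; lra.
move=> f sf _ fS; rewrite Gamma0_grad//.
have [s0 s1] := g0_sphere.
have f0 x : sphere Rad x -> f x = 0.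
  move=> xs; apply: contrapT => fx.
  suff : (closure [set x | f x != 0] `&` sphere Rad) x by rewrite fS.
  by split => //; apply: subset_closure => /=; apply/eqP.
by rewrite !f0// subrr.
Qed.

Lemma sup_Rratio : sup [set Rratio Rad T | T in normal_currents Rad] = Mcal Rad.
Proof.
have ub : ubound [set Rratio Rad T | T in normal_currents Rad] (Mcal Rad).
  move=> _ [T nT <-]; apply: Rratio_le => //; first exact: nT.1.
  by apply: (normal_grad0 R0 nT); [exact: smooth1_Pcal|exact: Pcal_sphere].
have G : [set Rratio Rad T | T in normal_currents Rad] (Mcal Rad).
  by exists (Gamma0 Rad); [exact: Gamma0_normal|exact: Rratio_Gamma0].
apply/eqP; rewrite eq_le; apply/andP; split.
  by apply: ge_sup => //; exists (Mcal Rad).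
by apply: ub_le_sup => //; exists (Mcal Rad).
Qed.

End Diameter.

(** * Nondegeneracy *)

Section Nondegeneracy.
Context {R : realType}.
Variable Rad : R.
Hypothesis R0 : 0 < Rad.
Let M := Mcal Rad.

(** The coefficient left by [test_radial] once [eps / s] and [s] are both bounded by [e]. *)
Definition crad (K : R) : R := 1 + K ^+ 2 / (2 * U0cal Rad).
Definition czhat : R := 1 + crad (Dcal Rad).
Definition cend1 : R := 2 * (crad (3 * Rad) + crad 2 * Rad).
Definition cend0 : R := cend1 + 4 * Rad * crad 2.

Lemma crad_gt0 K : 0 < crad K.
Proof.
have u0 := U0cal_gt0 R0; apply: ltr_pwDl => //; apply: divr_ge0; first exact: sqr_ge0.
by apply: mulr_ge0 => //; exact: ltW.
Qed.

Lemma czhat_gt0 : 0 < czhat.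
Proof. by have := crad_gt0 (Dcal Rad); rewrite /czhat; lra. Qed.

Lemma cend1_gt0 : 0 < cend1.
Proof.
have h := crad_gt0 (3 * Rad); have h2 : 0 < crad 2 * Rad by rewrite mulr_gt0// crad_gt0.
by rewrite /cend1; lra.
Qed.

Lemma cend0_gt0 : 0 < cend0.
Proof.
have h := cend1_gt0; have h2 : 0 < 4 * Rad * crad 2 by rewrite !mulr_gt0// crad_gt0.
by rewrite /cend0; lra.
Qed.

(** * Actions of a current with small deficit, measured by [e = eps / s + s] *)

Section Current.
Variables (T : current R) (eps s e : R).
Hypothesis fT : finite_mass_current Rad T.
Let m := mass Rad T.
Hypotheses (m0 : 0 < m) (eps0 : 0 <= eps) (s0 : 0 < s) (eE : e = eps / s + s).
Hypothesis Teps : T (omcal Rad) = m * (M - eps).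

Lemma e_bounds : [/\ 0 < e, eps / s <= e & s <= e].
Proof.
have h : 0 <= eps / s by rewrite divr_ge0// ltW.
by rewrite eE; move: (eps / s) h => q h; split; move: s0 h; lra.
Qed.

Lemma cur_radial (eta : field R) (del K : R) : 0 <= del -> 0 <= K ->
  contw Rad eta -> (forall x, cball Rad x -> enorm (eta x) <= del + K * rho x) ->
  `|T eta| <= m * (del + crad K * e).
Proof.
move=> d0 K0 ce H; have [e0 e1 e2] := e_bounds; have u0 := U0cal_gt0 R0.
have le : eps / s + (del + s * (K ^+ 2 / (2 * U0cal Rad))) <= del + crad K * e.
  have a0 : 0 <= K ^+ 2 / (2 * U0cal Rad).
    apply: divr_ge0; first exact: sqr_ge0.
    by apply: mulr_ge0 => //; exact: ltW.
  rewrite /crad; move: (K ^+ 2 / _) a0 (eps / s) e1 => a a0 q e1.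
  have := ler_wpM2r a0 e2; move: e1; lra.
have h1 := test_radial R0 fT Teps s0 d0 K0 ce H.
have cN := contwN ce.
have h2 := test_radial R0 fT Teps s0 d0 K0 cN.
rewrite ler_norml; apply/andP; split.
  rewrite lerNl -(curN fT)//; apply: le_trans (h2 _) _.
    by move=> x xR; rewrite enormN; exact: H.
  by apply: ler_wpM2l => //; exact: ltW.
by apply: le_trans h1 _; apply: ler_wpM2l => //; exact: ltW.
Qed.

Lemma cur_horizontal (eta : field R) (N0 : R) : 0 <= N0 ->
  contw Rad eta -> (forall x, cball Rad x -> enorm (eta x) <= N0) ->
  (forall x, cball Rad x -> comp (eta x) 2 = 0) ->
  `|T eta| <= m * ((1 + N0 ^+ 2 * Ecal Rad) * e).
Proof.
move=> N00 ce H Hz; have [e0 e1 e2] := e_bounds; have E0 := Ecal_gt0 R0.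
have le : eps / s + s * (N0 ^+ 2 * Ecal Rad) <= (1 + N0 ^+ 2 * Ecal Rad) * e.
  have a0 : 0 <= N0 ^+ 2 * Ecal Rad by apply: mulr_ge0; [exact: sqr_ge0|exact: ltW].
  move: (N0 ^+ 2 * _) a0 (eps / s) e1 => a a0 q e1.
  have := ler_wpM2r a0 e2; move: e1; lra.
have h1 := test_horizontal R0 fT Teps s0 N00 ce H Hz.
have cN := contwN ce.
have h2 := test_horizontal R0 fT Teps s0 N00 cN.
rewrite ler_norml; apply/andP; split.
  rewrite lerNl -(curN fT)//; apply: le_trans (h2 _ _) _.
  - by move=> x xR; rewrite enormN; exact: H.
  - by move=> x xR; rewrite compN Hz// oppr0.
  by apply: ler_wpM2l => //; exact: ltW.
by apply: le_trans h1 _; apply: ler_wpM2l => //; exact: ltW.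
Qed.

(** [omcal] and [M *: zhat] differ by [Ucal *: wcal], a radial field with [K = Dcal Rad], so the
    deficit passes from one to the other. *)
Lemma cur_zhat_ge : e <= 1 -> m * (M - czhat * e) <= M * T (fun=> zhat).
Proof.
move=> e1; have [e0 ee se] := e_bounds.
have h := @cur_radial (fun x => Ucal Rad (dot x x) *: wcal x) 0 (Dcal Rad) (lexx _)
  (ltW (Dcal_gt0 R0)) (@contw_Uw R Rad).
have {}h : `|T (fun x => Ucal Rad (dot x x) *: wcal x)| <= m * (0 + crad (Dcal Rad) * e).
  by apply: h => x xR; rewrite add0r; exact: enorm_Uw_le.
have E : T (omcal Rad) = M * T (fun=> zhat) - T (fun x => Ucal Rad (dot x x) *: wcal x).
  rewrite -(curZ fT); last exact: contw_cst.
  rewrite -(curB fT) //; last exact: contw_Uw.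
  by apply: contwZ; [exact: within_cst|exact: contw_cst].
(* [eps] is the product of [eps / s <= e] and [s <= e <= 1]. *)
have epse : eps <= e.
  have -> : eps = eps / s * s by rewrite divfK// gt_eqF.
  rewrite -[leRHS]mulr1; apply: ler_pM => //; [|exact: ltW|exact: le_trans se e1].
  by rewrite divr_ge0// ltW.
have m1 : m * eps <= m * e by rewrite ler_wpM2l// ltW.
move: h; rewrite ler_norml => /andP[h _].
move: E; rewrite Teps /czhat => E; move: h m1; rewrite add0r; lra.
Qed.

End Current.

(** * Mass, endpoints and position of a curve with small deficit *)

Section Curve.
Variable g : R -> pt R.
Hypotheses (lg : lipschitz01 g) (bg : forall t, t \in `[0, 1] -> cball Rad (g t)).
Hypothesis ends : g 0 = g 1 \/ (sphere Rad (g 0) /\ sphere Rad (g 1)).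
Let T := curve_current g.
Let m := mass Rad T.

Lemma curve_fm : finite_mass_current Rad T.
Proof. by have [v vg] := lipschitz_velocity lg; exact: curve_finite_mass vg. Qed.

Lemma curve_Pcal : T (vfield (Pcal Rad)) = 0.
Proof.
rewrite /T (curve_vfield lg); last exact: smooth1_Pcal.
case: ends => [->|[s0 s1]]; first by rewrite subrr.
by rewrite /zfun -!sqr_enorm s0 s1 Pcal_sphere !mulr0 subrr.
Qed.

Lemma end_cball : cball Rad (g 0) /\ cball Rad (g 1).
Proof. by split; apply: bg; rewrite in_itv /= ?lexx ?ler01. Qed.

Lemma height_bound (x : pt R) : cball Rad x -> - Rad <= comp x 2 <= Rad.
Proof. by move=> xR; rewrite -ler_norml (le_trans (comp_le_enorm _ _)). Qed.

Variables (eps s e : R).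
Hypotheses (m0 : 0 < m) (eps0 : 0 <= eps) (s0 : 0 < s) (eE : e = eps / s + s).
Hypothesis Teps : T (omcal Rad) = m * (M - eps).
Hypotheses (e1 : e <= 1) (ez : czhat * e <= M / 2)
  (ep : 2 * (cend0 * e) <= Rad ^+ 2) (ec : 8 * (crad 2 * e) <= Rad).

Let z1 := comp (g 1) 2.
Let z0 := comp (g 0) 2.
Let r1 := rho2 (g 1).
Let r0 := rho2 (g 0).

Let e0 : 0 < e. Proof. by have [] := e_bounds eps0 s0 eE. Qed.

(** The field [zhat] integrates to the rise of the curve, and [ez] limits the loss in [cur_zhat_ge]
    to half of [M * m]. *)
Lemma height_ge : m <= 2 * (z1 - z0).
Proof.
have := cur_zhat_ge curve_fm m0 eps0 s0 eE Teps e1.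
rewrite /T (curve_zhat lg) -/T -/m => h.
have M0 : 0 < M := Mcal_gt0 R0.
have h2 : m * (M / 2) <= m * (M - czhat * e) by apply: ler_wpM2l; [exact: ltW|move: ez; lra].
have : M * m <= M * (2 * (z1 - z0)) by move: h h2; rewrite /z1 /z0; lra.
by rewrite ler_pM2l.
Qed.

(* A closed curve has [z1 = z0], which the previous lemma excludes. *)
Lemma excess_arc : sphere Rad (g 0) /\ sphere Rad (g 1).
Proof.
case: ends => // g01; have := height_ge; rewrite /z1 /z0 g01 subrr mulr0.
by rewrite leNgt m0.
Qed.

Lemma excess_mass : m <= 4 * Rad.
Proof.
have := height_ge; have [/height_bound + /height_bound] := end_cball.
by rewrite -/z0 -/z1 => /andP[? ?] /andP[? ?]; lra.
Qed.

Lemma rho2_diff : `|r1 - r0| <= m * (crad 2 * e).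
Proof.
rewrite /r1 /r0 -(curve_rho2 lg) -/T -(add0r (crad 2 * e)).
apply: (cur_radial curve_fm m0 eps0 s0 eE Teps) => //.
  apply: contw_vec3; [| |exact: within_cst]; (apply: withinM; first exact: within_cst);
    exact: within_coord.
move=> x _; rewrite add0r; apply: ler_sqr_ge0; first by rewrite mulr_ge0 ?rho_ge0.
rewrite sqr_enorm dotE !comp_vec3 exprMn sqr_rho /rho2; lra.
Qed.

(** The gradient of [rho2 * z] has squared norm [(4 z^2 + rho2) rho2], at most [(3 Rad)^2 rho2] on
    the ball. *)
Lemma rho2z_diff : `|r1 * z1 - r0 * z0| <= m * (crad (3 * Rad) * e).
Proof.
rewrite /r1 /r0 /z1 /z0 -(curve_rho2z lg) -/T -(add0r (crad (3 * Rad) * e)).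
apply: (cur_radial curve_fm m0 eps0 s0 eE Teps) => //.
- by rewrite mulr_ge0// ltW.
- apply: contw_vec3.
  + by do 2! (apply: withinM; last exact: within_coord); exact: within_cst.
  + by do 2! (apply: withinM; last exact: within_coord); exact: within_cst.
  + by apply: withinD; apply: withinX; exact: within_coord.
move=> x xR; rewrite add0r; apply: ler_sqr_ge0.
  by rewrite !mulr_ge0 ?rho_ge0// ltW.
rewrite sqr_enorm dotE !comp_vec3 exprMn sqr_rho.
have h1 := rho2_le R0 xR; have h2 := rho2_ge0 x.
have /height_bound/andP[h3 h4] := xR.
have h5 : comp x 2 ^+ 2 <= Rad ^+ 2.
  rewrite -(real_normK (num_real (comp x 2))); apply: lerXn2r; rewrite ?nnegrE//.
    exact: ltW.
  by rewrite ler_norml h3 h4.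
have -> : 2 * comp x 2 * comp x 0 * (2 * comp x 2 * comp x 0) +
 2 * comp x 2 * comp x 1 * (2 * comp x 2 * comp x 1) + rho2 x * rho2 x
 = (4 * comp x 2 ^+ 2 + rho2 x) * rho2 x by rewrite /rho2; ring.
by apply: ler_wpM2r => //; rewrite exprMn; lra.
Qed.

(** [rho2_diff] only says that [r1] and [r0] are close. Weighting by the height separates them:
    [r1 (z1 - z0)] is of order [m e], and the rise [z1 - z0] is at least [m / 2], so the mass
    cancels. *)
Lemma excess_r1 : r1 <= cend1 * e.
Proof.
have a := height_ge; have h1 := rho2_diff; have h2 := rho2z_diff.
have [/height_bound/andP[b1 b2] _] := end_cball.
have A : 0 < z1 - z0 by move: m0 a; lra.
have h3 : `|(r0 - r1) * z0| <= m * (crad 2 * e) * Rad.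
  rewrite normrM distrC; apply: ler_pM => //.
  by rewrite ler_norml; apply/andP.
have h4 : r1 * (z1 - z0) <= m * (cend1 / 2 * e).
  have -> : r1 * (z1 - z0) = (r1 * z1 - r0 * z0) + (r0 - r1) * z0 by ring.
  have -> : m * (cend1 / 2 * e) = m * (crad (3 * Rad) * e) + m * (crad 2 * e) * Rad.
    by rewrite /cend1; field.
  by apply: lerD; [exact: le_trans (ler_norm _) h2|exact: le_trans (ler_norm _) h3].
have h5 : m * (cend1 / 2 * e) <= 2 * (z1 - z0) * (cend1 / 2 * e).
  by apply: ler_wpM2r => //; apply: mulr_ge0; [have := cend1_gt0; lra|exact: ltW].
rewrite -(ler_pM2r A); apply: le_trans h4 (le_trans h5 _); lra.
Qed.

Lemma excess_r0 : r0 <= cend0 * e.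
Proof.
have h1 := excess_r1; have := rho2_diff; rewrite ler_norml => /andP[h2 _].
have h3 : m * (crad 2 * e) <= 4 * Rad * (crad 2 * e).
  apply: ler_wpM2r excess_mass; apply: mulr_ge0; [exact: ltW (crad_gt0 _)|exact: ltW].
rewrite /cend0; lra.
Qed.

Lemma excess_r1' : r1 <= cend0 * e.
Proof.
apply: le_trans excess_r1 _; apply: ler_wpM2r; first exact: ltW.
by rewrite /cend0 lerDl !mulr_ge0 ?(ltW R0)// ltW// crad_gt0.
Qed.

Lemma sphere_height (x : pt R) : sphere Rad x -> comp x 2 ^+ 2 = Rad ^+ 2 - rho2 x.
Proof. by move=> xs; have := sqr_enormE x; rewrite xs /rho2 => ->; ring. Qed.

(** On the sphere [rho2] determines only the square of the height. The signs come from
    [(z1 + z0) (z1 - z0) = r0 - r1], of order [m e]: after division by the rise, the two heights are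
    nearly opposite. Then [rho2 = (Rad - z) (Rad + z)] produces the factor [1 / Rad]. *)
Lemma excess_ends : Rad - z1 <= cend0 / Rad * e /\ Rad + z0 <= cend0 / Rad * e.
Proof.
have [S0 S1] := excess_arc; have := sphere_height S1; have := sphere_height S0.
rewrite -/z0 -/z1 -/r0 -/r1 => E0 E1.
have a := height_ge; have h1 := excess_r1'; have h0 := excess_r0.
have [/height_bound/andP[b1 b2] /height_bound/andP[b3 b4]] := end_cball.
rewrite -/z0 -/z1 in b1 b2 b3 b4.
have A : 0 < z1 - z0 by move: m0 a; lra.
have hs : `|z1 + z0| <= 2 * (crad 2 * e).
  have : `|z1 + z0| * (z1 - z0) <= m * (crad 2 * e).
    rewrite -{1}(gtr0_norm A) -normrM (_ : (z1 + z0) * (z1 - z0) = - (r1 - r0)).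
      by rewrite normrN; exact: rho2_diff.
    by rewrite mulrC -subr_sqr E0 E1; ring.
  move=> /le_trans h; rewrite -(ler_pM2r A); apply: h.
  have -> : 2 * (crad 2 * e) * (z1 - z0) = 2 * (z1 - z0) * (crad 2 * e) by ring.
  by apply: ler_wpM2r => //; apply: mulr_ge0; [exact: ltW (crad_gt0 _)|exact: ltW].
have R2 : (Rad / 2) ^+ 2 < Rad ^+ 2 - cend0 * e.
  have : 0 < Rad ^+ 2 by rewrite exprn_gt0.
  by move: ep; rewrite expr_div_n; lra.
have half_lt z : z ^+ 2 >= Rad ^+ 2 - cend0 * e -> 0 <= z -> Rad / 2 < z.
  move=> hz z_ge0; rewrite ltNge; apply/negP => zR.
  have : z ^+ 2 <= (Rad / 2) ^+ 2 by apply: lerXn2r; rewrite ?nnegrE//; move: R0; lra.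
  by move: R2; lra.
move: hs; rewrite ler_norml => /andP[hs1 hs2].
(* Otherwise [z1 < - Rad / 2], and [z0 < z1] makes [|z1 + z0|] exceed [Rad], against [hs1] and
   [ec]. *)
have z1p : Rad / 2 < z1.
  apply: (half_lt); first by rewrite E1; lra.
  rewrite leNgt; apply/negP => z1n.
  have z1n' : 0 <= - z1 by lra.
  have : Rad / 2 < - z1 by apply: (half_lt (- z1) _ z1n'); rewrite sqrrN E1; lra.
  by move: ec; lra.
have z0n : Rad / 2 < - z0.
  apply: (half_lt); first by rewrite sqrrN E0; lra.
  rewrite leNgt; apply/negP => z0p.
  have z0p' : 0 <= z0 by lra.
  have : Rad / 2 < z0 by apply: (half_lt z0 _ z0p'); rewrite E0; lra.
  by move: ec; lra.
have fin z r : Rad / 2 < z -> z <= Rad -> z ^+ 2 = Rad ^+ 2 - r -> r <= cend0 * e ->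
    Rad - z <= cend0 / Rad * e.
  move=> zb zR zE rE; rewrite mulrAC ler_pdivlMr//.
  apply: le_trans rE; have -> : r = (Rad - z) * (Rad + z).
    by rewrite -subr_sqr zE; ring.
  by apply: ler_wpM2l; move: R0; lra.
split; first exact: (fin z1 r1).
rewrite -[z0]opprK; apply: (fin (- z0) r0) => //; [move: b1; lra|by rewrite sqrrN].
Qed.

(** The vertical field [Bv] is the gradient of [H(z)] and is integrated exactly along both curves.
    It therefore contributes only the distances of the endpoints to the poles, whence
    [2 * N0 * (cend0 / Rad)]. The factors [4 * Rad] come from [excess_mass]. *)
Lemma curve_close (B : field R) (del K N0 : R) : 0 <= del -> 0 <= K -> 0 <= N0 ->
  contw Rad B ->
  (forall x, cball Rad x -> enorm (B x - B (pi3 x)) <= del + K * rho x) ->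
  (forall x, cball Rad x -> enorm (B x) <= N0) ->
  `|T B - Gamma0 Rad B| <= 4 * Rad * del +
     (4 * Rad * crad K + 4 * Rad * (1 + N0 ^+ 2 * Ecal Rad) + 2 * N0 * (cend0 / Rad)) * e.
Proof.
move=> d0 K0 N00 cB BK BN.
(* [B] is continuous only on the ball: clamping the height to [[- Rad, Rad]] makes [b] continuous on
   the whole line, so that a primitive exists on an open interval containing the diameter. *)
pose cl (z : R) : R := Rad * (2 * clamp01 ((z / Rad + 1) / 2) - 1).
have cl_id z : `|z| <= Rad -> cl z = z.
  rewrite ler_norml => /andP[h1 h2]; rewrite /cl clamp01_id; first by field; rewrite gt_eqF.
  have h3 : -1 <= z / Rad by rewrite ler_pdivlMr// mulN1r.
  have h4 : z / Rad <= 1 by rewrite ler_pdivrMr// mul1r.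
  by apply/andP; split; lra.
have cl_ball z : cball Rad (vec3 0 0 (cl z)).
  rewrite /cball /= enorm_axis /cl normrM gtr0_norm// ler_piMr ?(ltW R0)// ler_norml.
  by have /andP[? ?] := clamp01_in ((z / Rad + 1) / 2); apply/andP; split; lra.
have c_cl : continuous cl.
  apply: contM; first exact: cst_continuous.
  apply: contD; last exact: cst_continuous.
  apply: contM; first exact: cst_continuous.
  apply: (cont_comp (short_map_continuous clamp01_short)).
  apply: contM; last exact: cst_continuous.
  apply: contD; last exact: cst_continuous.
  apply: contM; last exact: cst_continuous.
  by move=> z; exact: cvg_id.
pose b z := comp (B (vec3 0 0 (cl z))) 2.
have cb : continuous b.
  apply/continuous_subspace_setT; apply: within_compo.
  apply: (within_comp2 (C := cball Rad) (g := fun z => vec3 0 0 (cl z)) (f := B)) => //.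
  apply: within_vec => -[|[|[|//]]] _; under eq_fun do rewrite comp_vec3;
    [exact: within_cst|exact: within_cst|exact: continuous_subspaceT].
have bN z : `|b z| <= N0 by rewrite (le_trans (comp_le_enorm _ _))// BN.
have [H HD] := @antiderivative R b (Rad + 1) cb.
pose Bv : field R := fun x => b (comp x 2) *: zhat.
pose Bh : field R := fun x => vec3 (comp (B (pi3 x)) 0) (comp (B (pi3 x)) 1) 0.
have cBpi := contw_pi3 cB.
have bE x : cball Rad x -> b (comp x 2) = comp (B (pi3 x)) 2.
  move=> /height_bound/andP[h1 h2]; rewrite /b cl_id//.
  by rewrite ler_norml h1 h2.
have cBv : contw Rad Bv.
  apply: contwZ; last exact: contw_cst.
  by apply: within_comp1 => //; exact: within_coord.
have cBh : contw Rad Bh.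
  by apply: contw_vec3; [exact: contw_comp cBpi|exact: contw_comp cBpi|exact: within_cst].
have cBd : contw Rad (fun x => B x - B (pi3 x)) := contwD cB (contwN cBpi).
have cs := contwD cBd cBh; have cs2 := contwD cs cBv.
have TE : T B = T (fun x => B x - B (pi3 x)) + T Bh + T Bv.
  rewrite -(curD curve_fm cBd cBh) -(curD curve_fm cs cBv).
  apply: (cur_ext curve_fm cB cs2) => x xR; by apply: pt_eqP; rewrite !compL !comp_vec3 ?bE//; ring.
have TvE : T Bv = H z1 - H z0 by apply: (curve_height lg bg HD bN).
have GE : Gamma0 Rad B = H Rad - H (- Rad).
  rewrite (@Gamma0_axis R Rad R0 B Bv).
    rewrite /Gamma0 (curve_height (lipschitz_g0 R0) (g0_cball R0) HD bN) !comp_vec3.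
    by congr (H _ - H _); ring.
  by move=> z zR; rewrite /Bv compZ !comp_vec3 mulr1 /b cl_id.
have [q1 q0] := excess_ends.
have [/height_bound/andP[b1 b2] /height_bound/andP[b3 b4]] := end_cball.
rewrite -/z0 -/z1 in b1 b2 b3 b4.
have HL (u v : R) : - Rad <= u <= Rad -> - Rad <= v <= Rad -> `|H u - H v| <= N0 * `|u - v|.
  move=> hu hv; apply: (derive_bound_lipschitz HD) => [x _||]; first exact: bN.
  - by rewrite ltr_norml; case/andP: hu => ? ?; apply/andP; split; lra.
  - by rewrite ltr_norml; case/andP: hv => ? ?; apply/andP; split; lra.
have k1 : `|H z1 - H Rad| <= N0 * (cend0 / Rad * e).
  apply: le_trans (HL _ _ _ _) _; [by rewrite b3 b4|by rewrite lexx andbT; move: R0; lra|].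
  by apply: ler_wpM2l => //; rewrite distrC ger0_norm ?subr_ge0.
have k0 : `|H z0 - H (- Rad)| <= N0 * (cend0 / Rad * e).
  apply: le_trans (HL _ _ _ _) _; [by rewrite b1 b2|by rewrite lexx /=; move: R0; lra|].
  by apply: ler_wpM2l => //; rewrite ger0_norm; lra.
have k2 : `|T (fun x => B x - B (pi3 x))| <= 4 * Rad * (del + crad K * e).
  apply: le_trans (cur_radial curve_fm m0 eps0 s0 eE Teps d0 K0 cBd BK) _.
  apply: ler_wpM2r excess_mass; apply: addr_ge0 => //.
  by apply: mulr_ge0; [exact: ltW (crad_gt0 _)|exact: ltW].
have k3 : `|T Bh| <= 4 * Rad * ((1 + N0 ^+ 2 * Ecal Rad) * e).
  apply: le_trans (cur_horizontal curve_fm m0 eps0 s0 eE Teps N00 cBh _ _) _.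
  - move=> x xR; apply: le_trans (BN _ (pi3_cball xR)).
    apply: ler_sqr_ge0; first exact: enorm_ge0.
    rewrite !sqr_enormE !comp_vec3 expr0n /= addr0 lerDl sqr_ge0//.
  - by move=> x _; rewrite comp_vec3.
  apply: ler_wpM2r excess_mass; apply: mulr_ge0; last exact: ltW.
  by apply: addr_ge0 => //; apply: mulr_ge0; [exact: sqr_ge0|exact: ltW (Ecal_gt0 R0)].
have -> : T B - Gamma0 Rad B = T (fun x => B x - B (pi3 x)) + T Bh +
   ((H z1 - H Rad) - (H z0 - H (- Rad))) by rewrite TE TvE GE; ring.
have k4 : `|(H z1 - H Rad) - (H z0 - H (- Rad))| <=
   N0 * (cend0 / Rad * e) + N0 * (cend0 / Rad * e).
  by apply: le_trans (ler_normB _ _) _; exact: lerD.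
apply: le_trans (ler_normD _ _) _; apply: le_trans (lerD (ler_normD _ _) (lexx _)) _.
apply: le_trans (lerD (lerD k2 k3) k4) _; lra.
Qed.

End Curve.
End Nondegeneracy.

(** * Constants uniform over the curves, uniqueness, and the quadratic estimate *)

Section Conclusion.
Context {R : realType}.
Variable Rad : R.
Hypothesis R0 : 0 < Rad.
Let M := Mcal Rad.

Lemma small_excess : exists2 e0, 0 < e0 & forall e, 0 < e -> e <= e0 ->
  [/\ e <= 1, czhat Rad * e <= M / 2, 2 * (cend0 Rad * e) <= Rad ^+ 2 &
      8 * (crad Rad 2 * e) <= Rad].
Proof.
have M0 : 0 < M := Mcal_gt0 R0; have c1 := czhat_gt0 R0; have c2 := cend0_gt0 R0.
have c3 := crad_gt0 R0 2; have r2 : 0 < Rad ^+ 2 by rewrite exprn_gt0.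
have div_le (a b e : R) : 0 < a -> e <= b / a -> a * e <= b.
  by move=> a0; rewrite ler_pdivlMr// mulrC.
exists (Num.min (Num.min 1 (M / 2 / czhat Rad))
  (Num.min (Rad ^+ 2 / (2 * cend0 Rad)) (Rad / (8 * crad Rad 2)))).
  by rewrite !lt_min ltr01 !divr_gt0// mulr_gt0.
move=> e e_gt0; rewrite !le_min => /andP[/andP[h1 h2] /andP[h3 h4]].
split => //; first exact: div_le.
  by rewrite mulrA; apply: div_le => //; rewrite mulr_gt0.
by rewrite mulrA; apply: div_le => //; rewrite mulr_gt0.
Qed.

Lemma curvesP (G : current R) : curves Rad G -> exists g : R -> pt R,
  [/\ lipschitz01 g, (forall t, t \in `[0, 1] -> cball Rad (g t)),
      g 0 = g 1 \/ (sphere Rad (g 0) /\ sphere Rad (g 1)) & G = curve_current g].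
Proof.
move=> [g [[[lg [bg [g01 _]]]|[lg [bg [s0 [s1 _]]]]] ->]]; exists g; split => //.
  by left.
by right.
Qed.

Lemma curve_Rratio_le (G : current R) : curves Rad G -> Rratio Rad G <= M.
Proof.
move=> /curvesP[g [lg bg ends ->]].
exact: (Rratio_le R0 (curve_fm lg bg) (curve_Pcal lg ends)).
Qed.

Lemma curve_excess (G : current R) : curves Rad G -> 0 < mass Rad G ->
  G (omcal Rad) = mass Rad G * (M - (M - Rratio Rad G)).
Proof.
move=> /curvesP[g [lg bg ends ->]] m0.
rewrite -(cur_B0 R0 (curve_fm lg bg) (curve_Pcal lg ends)) opprB addrC subrK.
by rewrite /Rratio mulrC divfK// gt_eqF.
Qed.

Lemma curve_mass_ge0 (G : current R) : curves Rad G -> 0 <= mass Rad G.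
Proof. by move=> /curvesP[g [lg bg _ ->]]; exact: mass_ge0 (curve_fm lg bg). Qed.

Lemma curves_close : exists2 e0, 0 < e0 &
  forall (G : current R) (s : R), curves Rad G -> 0 < mass Rad G -> 0 < s ->
  (M - Rratio Rad G) / s + s <= e0 ->
  forall (B : field R) (del K N0 : R), 0 <= del -> 0 <= K -> 0 <= N0 ->
  contw Rad B ->
  (forall x, cball Rad x -> enorm (B x - B (pi3 x)) <= del + K * rho x) ->
  (forall x, cball Rad x -> enorm (B x) <= N0) ->
  `|G B - Gamma0 Rad B| <= 4 * Rad * del +
     (4 * Rad * crad Rad K + 4 * Rad * (1 + N0 ^+ 2 * Ecal Rad)
       + 2 * N0 * (cend0 Rad / Rad)) * ((M - Rratio Rad G) / s + s).
Proof.
have [e0 e0_gt0 He] := small_excess; exists e0 => // G s cG m0 s0 le0.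
have eps0 : 0 <= M - Rratio Rad G by rewrite subr_ge0; exact: curve_Rratio_le.
have TE := curve_excess cG m0.
have [e_gt0 _ _] := e_bounds eps0 s0 erefl.
have [e1 ez ep ec] := He _ e_gt0 le0.
have [g [lg bg ends GE]] := curvesP cG.
move: TE m0 eps0 le0 e1 ez ep ec {e_gt0 cG}; rewrite GE => TE m0 eps0 le0 e1 ez ep ec.
exact: (curve_close R0 lg bg ends m0 eps0 s0 erefl TE e1 ez ep ec).
Qed.

Lemma cball_compact : compact (cball Rad : set (pt R)).
Proof.
have -> : cball Rad = [set x : pt R | dot x x <= Rad ^+ 2].
  apply/seteqP; split => x; first exact: cball_dot.
  by rewrite /cball /= -sqr_enorm => h; apply: ler_sqr_ge0 h; exact: ltW.
apply: bounded_closed_compact; last exact: closed_dot_le.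
exists Rad; split; first exact: num_real.
move=> K RK x /= xS; rewrite /Num.Def.normr/= mx_normrE.
apply: bigmax_le => [|[i j] _ /=]; first exact: le_trans (ltW R0) (ltW RK).
rewrite ord1 comp_ord (le_trans (comp_le_enorm _ (ltn_ord j)))//.
by apply: le_trans (ltW RK); apply: ler_sqr_ge0; [exact: ltW|rewrite sqr_enorm].
Qed.

Lemma cball0 : cball Rad (0 : pt R).
Proof. by rewrite /cball /= enorm0 ltW. Qed.

Lemma within_sqr_enorm (A : set (pt R)) (B : field R) : {within A, continuous B} ->
  {within A, continuous (fun x => enorm (B x) ^+ 2)}.
Proof.
move=> cB; under eq_fun do rewrite sqr_enormE.
by do 2! (apply: withinD; last by apply: withinX; exact: within_compo);
  apply: withinX; exact: within_compo.
Qed.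

Lemma contw_bounded (B : field R) : contw Rad B ->
  exists2 N0, 0 <= N0 & forall x, cball Rad x -> enorm (B x) <= N0.
Proof.
move=> cB.
have [|||c cR H] := @EVT_max_rV R 3 (fun x => enorm (B x) ^+ 2) (cball Rad).
- by exists 0; exact: cball0.
- exact: cball_compact.
- exact: within_sqr_enorm.
exists (enorm (B c)); first exact: enorm_ge0.
move=> x xR; apply: ler_sqr_ge0; first exact: enorm_ge0.
by apply: H; rewrite inE.
Qed.

(* The quantity [rho2 x + (`|del ^+ 2 - phi x| + (del ^+ 2 - phi x))], with [phi] the squared
   distance from [B x] to [B (pi3 x)], is positive on the ball because [phi]
   vanishes on the axis; its minimum bounds [rho] from below where [phi] exceeds [del ^+ 2]. *)
Lemma contw_near_axis (B : field R) (del : R) : 0 < del -> contw Rad B ->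
  exists2 K, 0 <= K & forall x, cball Rad x -> enorm (B x - B (pi3 x)) <= del + K * rho x.
Proof.
move=> d0 cB.
have cD : contw Rad (fun x => B x - B (pi3 x)) := contwD cB (contwN (contw_pi3 cB)).
have [N0 N00 HN] := contw_bounded cD.
pose phi x := enorm (B x - B (pi3 x)) ^+ 2.
have cphi : {within cball Rad, continuous phi} by exact: (within_sqr_enorm cD).
have cdp : {within cball Rad, continuous (fun x => del ^+ 2 - phi x)}.
  by apply: withinB => //; exact: within_cst.
pose chi x := rho2 x + (`|del ^+ 2 - phi x| + (del ^+ 2 - phi x)).
have cchi : {within cball Rad, continuous chi}.
  apply: withinD; first by apply: withinD; apply: withinX; exact: within_coord.
  by apply: withinD => //; apply: within_comp1 cdp; exact: norm_continuous.
have [||c cR H] := @EVT_min_rV R 3 chi (cball Rad) _ _ cchi.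
- by exists 0; exact: cball0.
- exact: cball_compact.
have d20 : 0 < del ^+ 2 by rewrite exprn_gt0.
have part0 x : 0 <= `|del ^+ 2 - phi x| + (del ^+ 2 - phi x).
  by rewrite -lerBlDr sub0r (le_trans (ler_norm _))// normrN.
have chi0 : 0 < chi c.
  rewrite /chi; have := rho2_ge0 c; rewrite le_eqVlt => /predU1P[r0|r0]; last first.
    by rewrite ltr_wpDr.
  have pc : pi3 c = c.
    have /eqP := esym r0; rewrite paddr_eq0 ?sqr_ge0// !sqrf_eq0 => /andP[/eqP c0 /eqP c1].
    by apply: pt_eqP; rewrite comp_vec3 ?c0 ?c1.
  have -> : phi c = 0 by rewrite /phi pc subrr enorm0 expr0n.
  by rewrite -r0 subr0 add0r gtr0_norm// addr_gt0.
(* Where the distance exceeds [del], the bracket in [chi] vanishes, so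
   [chi c <= rho2 x <= rho x * Rad] and [N0] is at most [K * rho x]. *)
exists (N0 * Rad / chi c); first by rewrite divr_ge0 ?mulr_ge0// ltW.
move=> x xR.
have K0 : 0 <= N0 * Rad / chi c by rewrite divr_ge0 ?mulr_ge0// ltW.
have [h|h] := leP (enorm (B x - B (pi3 x))) del.
  by rewrite (le_trans h)// lerDl mulr_ge0// rho_ge0.
have ph : del ^+ 2 <= phi x by apply: lerXn2r; rewrite ?nnegrE ?enorm_ge0// ltW.
have rx : chi c <= rho x * Rad.
  have := H x; rewrite inE => /(_ xR) /le_trans; apply.
  rewrite /chi ler0_norm ?subr_le0// addrC addNr add0r -sqr_rho expr2.
  apply: ler_wpM2l; first exact: rho_ge0.
  exact: le_trans (rho_le_enorm x) xR.
apply: le_trans (HN x xR) _; rewrite -[leLHS]add0r; apply: lerD; first exact: ltW.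
rewrite mulrAC ler_pdivlMr// -mulrA; apply: ler_wpM2l => //.
by rewrite mulrC in rx.
Qed.

Lemma within_enorm (A : set (pt R)) (B : field R) : {within A, continuous B} ->
  {within A, continuous (fun x => enorm (B x))}.
Proof.
move=> /within_sqr_enorm cB.
have -> : (fun x => enorm (B x)) = Num.sqrt \o (fun x => enorm (B x) ^+ 2).
  by apply/funext => x; rewrite /= sqrtr_sqr ger0_norm ?enorm_ge0.
exact: within_comp1 (@sqrt_continuous R) cB.
Qed.

Lemma lipschitz_contw (B : field R) (L : R) :
  (forall x y, cball Rad x -> cball Rad y -> enorm (B x - B y) <= L * enorm (x - y)) ->
  contw Rad B.
Proof.
move=> hL; apply: within_vec => k k3; apply/subspace_continuousP => x xR.
have cx : {within cball Rad, continuous (fun y => L * enorm (x - y))}.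
  apply: withinM; first exact: within_cst.
  by apply: within_enorm; apply: contwD; [exact: contw_cst|apply: contwN; exact: contw_id].
move/subspace_continuousP : cx => /(_ x xR) cx.
have {}cx : L * enorm (x - y) @[y --> within (cball Rad) (nbhs x)] --> (0 : R).
  by rewrite (_ : 0 = L * enorm (x - x))// subrr enorm0 mulr0.
apply/cvgrPdist_lt => e e0; near=> y.
have yR : cball Rad y by near: y; exact: withinT.
rewrite -compB (le_lt_trans (comp_le_enorm _ k3))// (le_lt_trans (hL _ _ xR yR))//.
have : `|0 - L * enorm (x - y)| < e by near: y; move/cvgrPdist_lt : cx; apply.
by rewrite sub0r normrN; exact: le_lt_trans (ler_norm _).
Unshelve. all: by end_near. Qed.

(** [c01norm] adds two suprema, which bound their sets only once these are known to be bounded; [N0]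
    and [L] provide that. Both suprema being nonnegative, each is at most 1. *)
Lemma dualnorm_test (B : field R) : lipT Rad B -> c01norm Rad B <= 1 ->
  [/\ contw Rad B, (forall x, cball Rad x -> enorm (B x - B (pi3 x)) <= 0 + 1 * rho x) &
      (forall x, cball Rad x -> enorm (B x) <= 1)].
Proof.
move=> [[L hL] _]; rewrite /c01norm.
set S1 := [set _ | _ in _]; set S2 := [set _ | _ in _] => c1.
have cB := lipschitz_contw hL.
have [N0 _ BN] := contw_bounded cB.
have ub1 x : cball Rad x -> enorm (B x) <= sup S1.
  move=> xR; apply: ub_le_sup; last by exists x.
  by exists N0 => _ [y yR <-]; exact: BN.
have ub2 x y : cball Rad x -> cball Rad y -> x != y ->
    enorm (B x - B y) / enorm (x - y) <= sup S2.
  move=> xR yR xy; apply: ub_le_sup; last by exists (x, y).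
  exists L => _ [[u v] /= [uR [vR uv]] <-].
  rewrite ler_pdivrMr ?hL// lt_neqAle enorm_ge0 andbT eq_sym.
  by apply: contra uv => /eqP/enorm0_eq0/eqP; rewrite subr_eq0.
have s1 : 0 <= sup S1 by exact: le_trans (enorm_ge0 _) (ub1 0 cball0).
have s2 : 0 <= sup S2.
  have zR : cball Rad (vec3 0 0 Rad) by rewrite /cball /= enorm_axis gtr0_norm.
  apply: le_trans (ub2 _ _ zR cball0 _); first by rewrite divr_ge0 ?enorm_ge0.
  apply/eqP => /(congr1 (fun x => comp x 2)); rewrite comp_vec3 comp0 => h.
  by move: R0; rewrite h ltxx.
split => // x xR; last by have := ub1 x xR; lra.
rewrite add0r mul1r; have [e|xp] := eqVneq x (pi3 x).
  by rewrite -e subrr enorm0 rho_ge0.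
have := ub2 _ _ xR (pi3_cball xR) xp.
have r_gt0 : 0 < enorm (x - pi3 x).
  rewrite lt_neqAle enorm_ge0 andbT eq_sym.
  by apply: contra xp => /eqP/enorm0_eq0/eqP; rewrite subr_eq0.
rewrite ler_pdivrMr// pi3_sub => /le_trans; apply.
by rewrite ler_piMl ?rho_ge0//; lra.
Qed.

Lemma dualnorm_bound (T : current R) (c : R) :
  (forall B : field R, contw Rad B ->
    (forall x, cball Rad x -> enorm (B x - B (pi3 x)) <= 0 + 1 * rho x) ->
    (forall x, cball Rad x -> enorm (B x) <= 1) -> `|T B| <= c) ->
  T (fun=> 0) = 0 -> 0 <= dualnorm Rad T <= c.
Proof.
move=> H T0.
have z_in : [set T B | B in [set B | lipT Rad B /\ c01norm Rad B <= 1]] 0.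
  exists (fun=> 0) => //; split; first split.
  - by exists 0 => x y _ _; rewrite subrr enorm0 mul0r.
  - move=> x _; apply: pt_eqP; rewrite !comp_vec3 !comp0 !mul0r subrr//.
  rewrite /c01norm; set S1 := [set _ | _ in _]; set S2 := [set _ | _ in _].
  have -> : S1 = [set 0].
    apply/seteqP; split => [_ [x _ <-]|_ ->]; first by rewrite enorm0.
    by exists 0; [exact: cball0|rewrite enorm0].
  have S20 : S2 `<=` [set 0].
    by move=> _ [[x y] /= _ <-]; rewrite subrr enorm0 mul0r.
  rewrite sup1 add0r; have [->|/set0P S2n] := eqVneq S2 set0; first by rewrite sup0.
  by apply: ge_sup => // _ /S20 ->.
have ub : ubound [set T B | B in [set B | lipT Rad B /\ c01norm Rad B <= 1]] c.
  move=> _ [B [lB B1] <-]; have [cB Bp BN] := dualnorm_test lB B1.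
  by apply: le_trans (ler_norm _) _; exact: H.
by apply/andP; split; [apply: ub_le_sup => //; exists c|apply: ge_sup => //; exists 0].
Qed.

Lemma curve_cur0 (G : current R) : curves Rad G -> G (fun=> 0) = 0.
Proof. by move=> /curvesP[g [lg bg _ ->]]; exact: cur0 (curve_fm lg bg). Qed.

Lemma le0_of_small (d C e0 : R) : 0 < e0 ->
  (forall s, 0 < s -> s <= e0 -> d <= C * s) -> d <= 0.
Proof.
move=> e0_gt0 H; rewrite leNgt; apply/negP => d0.
have C0 : 0 < C.
  by have := lt_le_trans d0 (H e0 e0_gt0 (lexx _)); rewrite pmulr_lgt0.
pose s := Num.min e0 (d / (2 * C)).
have s0 : 0 < s by rewrite lt_min e0_gt0 divr_gt0// mulr_gt0.
have := H s s0; rewrite ge_min lexx => /(_ isT).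
have : C * s <= d / 2.
  have : s <= d / (2 * C) by rewrite ge_min lexx orbT.
  by rewrite ler_pdivlMr ?mulr_gt0// => h; lra.
by move: d0; lra.
Qed.

(** With zero deficit [e] reduces to [s]. As [K] depends on [del], first [s] tends to 0 with [del]
    fixed, and then [del] tends to 0. *)
Lemma curves_unique (G : current R) : curves Rad G -> Rratio Rad G = M ->
  forall B : field R, contw Rad B -> G B = Gamma0 Rad B.
Proof.
move=> cG GM B cB; have M0 : 0 < M := Mcal_gt0 R0.
have m0 : 0 < mass Rad G.
  (* A curve of zero mass has ratio 0 by the convention on division, whereas [M] is positive. *)
  rewrite lt_neqAle (curve_mass_ge0 cG) andbT; apply/eqP => mE.
  by move: M0; rewrite -GM /Rratio -mE invr0 mulr0 ltxx.
have [e0 e0_gt0 H] := curves_close.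
have [N0 N00 BN] := contw_bounded cB.
apply/eqP; rewrite -subr_eq0 -normr_le0.
apply: (@le0_of_small _ (4 * Rad) 1) => // del d0 _.
have [K K0 BK] := contw_near_axis d0 cB.
rewrite -subr_le0.
apply: (@le0_of_small _ (4 * Rad * crad Rad K + 4 * Rad * (1 + N0 ^+ 2 * Ecal Rad)
       + 2 * N0 * (cend0 Rad / Rad)) e0) => // s s0 se.
have := H G s cG m0 s0; rewrite GM subrr mul0r add0r => /(_ se).
by move=> /(_ B del K N0 (ltW d0) K0 N00 cB BK BN); rewrite lerBlDl.
Qed.

Lemma nondegeneracy : exists C0 : R, 0 < C0 /\
  forall G : current R, curves Rad G ->
    C0 * Num.min (dualnorm Rad (cur_sub G (Gamma0 Rad)) ^+ 2) 1 <= M - Rratio Rad G.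
Proof.
have M0 : 0 < M := Mcal_gt0 R0.
have [e0 e0_gt0 H] := curves_close.
pose C := 4 * Rad * crad Rad 1 + 4 * Rad * (1 + 1 ^+ 2 * Ecal Rad)
       + 2 * 1 * (cend0 Rad / Rad).
have C_gt0 : 0 < C.
  have h1 : 0 < 4 * Rad * crad Rad 1 by rewrite !mulr_gt0// crad_gt0.
  have h2 : 0 < 4 * Rad * (1 + 1 ^+ 2 * Ecal Rad).
    by rewrite !mulr_gt0// addr_gt0// mulr_gt0 ?expr1n// Ecal_gt0.
  have h3 : 0 < 2 * 1 * (cend0 Rad / Rad) by rewrite !mulr_gt0// ?invr_gt0// cend0_gt0.
  by rewrite !addr_gt0.
(* [M] covers curves of zero mass, whose ratio is 0; [e0 ^+ 2 / 4] covers large deficits and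
   guarantees [2 * sqrt eps <= e0] for the others; the last term inverts [d <= 2 * C * sqrt eps]. *)
pose C0 := Num.min M (Num.min (e0 ^+ 2 / 4) (4 * C ^+ 2)^-1).
have C0_gt0 : 0 < C0.
  by rewrite !lt_min M0 divr_gt0 ?exprn_gt0// invr_gt0 mulr_gt0 ?exprn_gt0.
have C0M : C0 <= M by rewrite ge_min lexx.
have C0e : C0 <= e0 ^+ 2 / 4 by rewrite !ge_min lexx orbT.
have C0C : C0 <= (4 * C ^+ 2)^-1 by rewrite !ge_min lexx !orbT.
exists C0; split => // G cG.
set d := dualnorm _ _; set eps := M - _.
have le_C0 : C0 * Num.min (d ^+ 2) 1 <= C0.
  by apply: ler_piMr; [exact: ltW|rewrite ge_min lexx orbT].
have := curve_mass_ge0 cG; rewrite le_eqVlt => /predU1P[mE|m0].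
  by apply: le_trans le_C0 _; rewrite /eps /Rratio -mE invr0 mulr0 subr0.
have [epsb|epss] := leP (e0 ^+ 2 / 4) eps.
  exact: le_trans le_C0 (le_trans C0e epsb).
have eps0 : 0 <= eps by rewrite subr_ge0; exact: curve_Rratio_le.
have dT s : 0 < s -> eps / s + s <= e0 -> 0 <= d <= C * (eps / s + s).
  move=> s0 se; apply: dualnorm_bound => [B cB BK BN|]; last first.
    rewrite /cur_sub (curve_cur0 cG) (cur0 (Gamma0_finite_mass R0)) subrr//.
  have := H G s cG m0 s0 se B 0 1 1 (lexx _) ler01 ler01 cB BK BN.
  by rewrite mulr0 add0r.
suff d2 : d ^+ 2 <= 4 * C ^+ 2 * eps.
  apply: (@le_trans _ _ (C0 * d ^+ 2)).
    by apply: ler_wpM2l; [exact: ltW|rewrite ge_min lexx].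
  apply: (@le_trans _ _ ((4 * C ^+ 2)^-1 * (4 * C ^+ 2 * eps))).
    by apply: ler_pM => //; [exact: ltW|exact: sqr_ge0].
  by rewrite mulKf// gt_eqF// mulr_gt0// exprn_gt0.
(* For [eps = 0] the choice [s = sqrt eps] is not positive, so [s] is sent to 0 instead. *)
move: eps0; rewrite le_eqVlt => /predU1P[epsE|eps0].
  have d0 : 0 <= d.
    by have := dT e0 e0_gt0; rewrite -epsE mul0r add0r lexx => /(_ isT)/andP[].
  have : d <= 0.
    apply: (@le0_of_small _ C e0) => // s s0 se.
    by have := dT s s0; rewrite -epsE mul0r add0r => /(_ se)/andP[].
  move=> d0'; have -> : d = 0 by apply/eqP; rewrite eq_le d0 d0'.
  by rewrite expr0n /= -epsE mulr0.
(* [s = sqrt eps] minimizes [eps / s + s], with value [2 * sqrt eps]. *)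
have s0 : 0 < Num.sqrt eps by rewrite sqrtr_gt0.
have sE : eps / Num.sqrt eps + Num.sqrt eps = 2 * Num.sqrt eps.
  rewrite -{1}(sqr_sqrtr (ltW eps0)) expr2 mulfK ?gt_eqF//; ring.
have se : eps / Num.sqrt eps + Num.sqrt eps <= e0.
  rewrite sE; apply: ler_sqr_ge0; first exact: ltW.
  by rewrite exprMn (sqr_sqrtr (ltW eps0)); lra.
have /andP[d0 dC] := dT _ s0 se; rewrite sE in dC.
have -> : 4 * C ^+ 2 * eps = (C * (2 * Num.sqrt eps)) ^+ 2.
  by rewrite !exprMn (sqr_sqrtr (ltW eps0)); ring.
by apply: lerXn2r; rewrite ?nnegrE// mulr_ge0 ?mulr_ge0 ?sqrtr_ge0// ltW.
Qed.

End Conclusion.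

Theorem mainTheorem5 (R : realType) (Rad : R) (hRad : 0 < Rad) :
  (* Gamma_0 belongs to X *)
  curves Rad (Gamma0 Rad) /\
  (* R(Gamma_0) = sup_{Gamma in N} R(Gamma) *)
  Rratio Rad (Gamma0 Rad) = sup [set Rratio Rad T | T in normal_currents Rad] /\
  (* uniqueness within X (as currents, i.e. as functionals on continuous fields) *)
  (forall G : current R, curves Rad G ->
     Rratio Rad G = sup [set Rratio Rad T | T in normal_currents Rad] ->
     forall B : field R, contw Rad B -> G B = Gamma0 Rad B) /\
  (* nondegeneracy with exponent N = 2 *)
  (exists C0 : R, 0 < C0 /\
     forall G : current R, curves Rad G ->
       C0 * Num.min (dualnorm Rad (cur_sub G (Gamma0 Rad)) ^+ 2) 1
         <= Rratio Rad (Gamma0 Rad) - Rratio Rad G).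
Proof.
rewrite sup_Rratio// Rratio_Gamma0//; split.
  by exists (g0 Rad); split; [right; exact: simple_arc_g0|].
split; first by [].
split; first exact: curves_unique.
exact: nondegeneracy.
Qed.
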